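(* Let $(f,\mu)$ be a system as in the context satisfying properties (a1)--(a6), (Diam), (BD), (Adj) and (AR) (all defined in the context), with $s_f=\dim_{\mathrm H}\Lambda$. Then there exist constants $0<c<C<\infty$ such that for all sufficiently small $\delta>0$, $$c\,\delta^{-s_f}\le \mathbb E_\mu(\tau_\delta)\le C\,\delta^{-s_f}\log(1/\delta).$$ Moreover, if in addition the system is Gibbs-Markov and $f$ has at least 2 full branches, then there exist constants $0<c<C<\infty$ such that for all sufficiently small $\delta>0$, $$c\,\delta^{-s_f}\log(1/\delta)\le \mathbb E_\mu(\tau_\delta)\le C\,\delta^{-s_f}\log(1/\delta).$$
   Context: **Map.** $I\subset\mathbb R$ is a bounded interval, $\mathcal Z=\{Z_i\}_{i\in\mathcal I}$ a finite or countable collection of subintervals of $I$ with pairwise disjoint interiors, and $f:\bigcup_i Z_i\to I$ is continuous and strictly monotonic on each $Z_i$; $f_i:=f|_{Z_i}$ and $D=I\setminus\bigcup_i Z_i$. The repeller is $\Lambda=\{x\in I: f^k(x)\in\bigcup_i Z_i \text{ for all } k\ge 0\}$, and the dynamical system is $f:\Lambda\to\Lambda$ (for $U\subset I$, $f(U)$ means $f(\Lambda\cap U)$). $\mathcal Z^n$ is the set of $n$-cylinders: maximal intervals $Z\subset I$ such that for each $0\le k\le n-1$, $f^k(Z)\subset Z_{i_k}$ for some $Z_{i_k}\in\mathcal Z$; $\mathcal Z^0=\{I\}$. **Measures.** $m$ is a nonatomic Borel probability measure with $m(D)=0$ which is conformal for a potential $\phi:\Lambda\to\mathbb R$, i.e.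 $\frac{dm}{d(m\circ f)}=e^{\phi}$. Set $\phi|_D=-\infty$, $S_n\phi=\sum_{i=0}^{n-1}\phi\circ f^i$, $\mathcal L\psi(x)=\sum_{y\in f^{-1}x}\psi(y)e^{\phi(y)}$. (a1) There is $C_d>0$ with $|e^{S_n\phi(x)-S_n\phi(y)}-1|\le C_d|f^n(x)-f^n(y)|$ whenever $f^i(x),f^i(y)$ lie in the same element of $\mathcal Z$ for each $i=0,\dots,n-1$. (a2) There is $n_0\in\mathbb N$ with $\sup_\Lambda e^{S_{n_0}\phi}<\inf_{\Lambda\setminus D}\mathcal L^{n_0}1$. (a3) For each $x\in\Lambda$, $\delta>0$ such that $J=B(x,\delta)$ satisfies $J\cap D=\emptyset$, there is $N=N(J)$ with $\inf_{\Lambda\setminus D}\mathcal L^N\mathbf 1_{J\cap\Lambda}>0$. (a2) implies that one can fix $n_1\in\mathbb N$ with $(2n_1+5)(C_d+1)\sup_\Lambda e^{S_{n_1}\phi}<1$. (a4) There is $c_m>0$ with $\inf_{Z\in\mathcal Z^{n_1}}m(f^{n_1}(Z))\ge c_m$. Under (a1)--(a4) there is a unique $f$-invariant probability measure absolutely continuous with respect to $m$; $\mu$ denotes this measure; its density $g=d\mu/dm$ is of bounded variation and bounded away from $0$. **Symbolic coding.** $\Sigma\subset\mathcal I^{\mathbb N_0}$ is the set of sequences $(i_0,i_1,\dots)$ for which there is $x\in\Lambda$ with $f^n(x)\in Z_{i_n}$ for all $n\ge0$; $\Pi:\Sigma\to I$ sends the sequence to $x$, $\Pi(i_0,i_1,\dots)=\lim_{n}f_{i_0}^{-1}\circ\cdots\circ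 f_{i_{n-1}}^{-1}(I)$; $\Sigma_n$, $\Sigma^*$ are the sets of words of length $n$, resp. all finite words, of $\Sigma$; $[w]$ is the set of sequences in $\Sigma$ beginning with $w$; $\tilde\mu$ is the measure on $\Sigma$ with $\mu=\Pi_*\tilde\mu$. (a5) (quasi-Bernoulli) There is $C_*>1$ with $C_*^{-1}\tilde\mu([\mathbf i])\tilde\mu([\mathbf j])\le\tilde\mu([\mathbf i\mathbf j])\le C_*\tilde\mu([\mathbf i])\tilde\mu([\mathbf j])$ for all finite words $\mathbf i,\mathbf j\in\Sigma^*$ (with $\mathbf i\mathbf j\in\Sigma^*$). (a6) ($\psi$-mixing) $\left|\frac{\tilde\mu(\bigcup[x_0,\dots,x_{i-1},y_0,\dots,y_{j-1},z_0,\dots,z_{\ell-1}])}{\tilde\mu([x_0,\dots,x_{i-1}])\tilde\mu([z_0,\dots,z_{\ell-1}])}-1\right|\le\gamma(j)$, the union being over all words $y_0\dots y_{j-1}$ of length $j$ for which the concatenated word is in $\Sigma_{i+j+\ell}$, with $\gamma(j)\to0$ as $j\to\infty$. **Further properties.** (Diam) There are $C_m<\infty$, $s>0$ with $m(U)\le C_m\,\mathrm{diam}(U)^s$ for all intervals $U\subset I$. (BD) There is $C_{bd}>0$ such that $C_{bd}^{-1}\le |(f^n)'(x)|/|(f^n)'(y)|\le C_{bd}$ for all $n$ and all $x,y\in\Lambda$ such that $f^i(x),f^i(y)$ lie in the same element of $\mathcal Z$ for each $0\le i\le n-1$. (Adj) There is $C>0$ such that for all $n\ge 1$, $Z_{n-1}\in\mathcal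 Z^{n-1}$ and adjacent $Z,Z'\in\mathcal Z^n$ contained in $Z_{n-1}$, $\frac1C\le\frac{\mu(Z)}{\mu(Z')}\le C$. Adjacent means there is an interval $A\subset Z_{n-1}$ such that $Z,Z'$ are the only elements of $\mathcal Z^n$ intersecting $A$; it is also assumed that each $Z\in\mathcal Z^n$ in $Z_{n-1}$ has an adjacent $Z'\in\mathcal Z^n$ in $Z_{n-1}$. (AR) There is $c>0$ such that $\frac{r^{s_f}}{c}\le m(B(x,r))\le c\,r^{s_f}$ for all $x\in\Lambda$ and $0<r\le1$, where $s_f=\dim_{\mathrm H}\Lambda$ is the Hausdorff dimension. **Gibbs-Markov.** $f$ is Markov if for each $Z\in\mathcal Z$, $f(Z)$ is a union of elements of $\mathcal Z$. $f$ has big images and pre-images (BIP) if there is a finite set $\{Z_j\}_{j\in\mathcal J}\subset\mathcal Z$ such that for all $Z\in\mathcal Z$ there are $j,k\in\mathcal J$ with $f(Z_j)\supseteq Z$ and $f(Z)\supseteq Z_k$. $\mu$ is Gibbs if there are a potential $\phi$, Lipschitz on each $Z\in\mathcal Z$ with uniform constant, and constants $K,P$ such that $K^{-1}\le\tilde\mu([i_0,\dots,i_{n-1}])/e^{S_n\phi(\Pi(\mathbf i))+nP}\le K$ for all words in $\Sigma_n$ and $\mathbf i\in[i_0,\dots,i_{n-1}]$. The system $(f,\mu)$ is Gibbs-Markov (with BIP) if $f$ is Markov, satisfies BIP, $|Df|\ge\gamma^{-1}>1$ on each $Z\in\mathcal Z$, and $\mu$ is Gibbs. $f$ has a full branch on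 $Z_i$ if $f(Z_i)=I$. **Cover time.** For $\delta>0$ and $x\in\Lambda$, $\tau_\delta(x)=\inf\{n\ge1:\{x,f(x),\dots,f^n(x)\}\text{ is }\delta\text{-dense in }\Lambda\}$, where $Z'\subset Z$ is $\delta$-dense in $Z$ if every $x\in Z$ has some $x'\in Z'$ with $|x-x'|\le\delta$. $\mathbb E_\mu$ is expectation with respect to $\mu$. *)

(* Defs.v *)
From HB Require Import structures.
From mathcomp Require Import all_boot all_order all_algebra.
From mathcomp Require Import all_classical all_reals all_analysis.

Set Implicit Arguments.
Unset Strict Implicit.
Unset Printing Implicit Defensive.

Import Order.TTheory GRing.Theory Num.Theory.
Import numFieldNormedType.Exports.

Local Open Scope classical_set_scope.
Local Open Scope ring_scope.

Definition strictly_monotone_on (R : realType) (A : set R) (f : R -> R) : Prop :=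
  (forall x y, A x -> A y -> x < y -> f x < f y) \/
  (forall x y, A x -> A y -> x < y -> f y < f x).

(* [imap] is total on R, but its values matter only on the union of the [br i].
   The index type being pointed says that the collection is not empty. *)
Record interval_map (R : realType) := IntervalMap {
  dom : set R;
  idx : pointedType;
  br : idx -> set R;
  imap : R -> R;
  dom_interval : is_interval dom;
  dom_bounded : bounded_set dom;
  idx_countable : countable [set: idx];
  br_interval : forall i, is_interval (br i);
  br_nondegenerate : forall i, (br i)° !=set0;
  br_sub : forall i, br i `<=` dom;
  br_disjoint : trivIset setT (fun i => (br i)°);
  imap_dom : forall i x, br i x -> dom (imap x);
  imap_continuous : forall i, {within br i, continuous imap};
  imap_monotone : forall i, strictly_monotone_on (br i) imap }.

Section SystemDefinitions.
Variables (R : realType) (T : interval_map R).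
Local Notation I := (dom T).
Local Notation Z := (@br R T).
Local Notation f := (imap T).

Definition holes : set R := I `\` \bigcup_i Z i.

Definition repeller : set R :=
  [set x | I x /\ forall k, (\bigcup_i Z i) (iter k f x)].

(* The points of the domain of f_{w_{n-1}} o ... o f_{w_0}. *)
Definition branch (w : nat -> idx T) (n : nat) : set R :=
  [set x | I x /\ forall k, (k < n)%N -> Z (w k) (iter k f x)].

(* Here f^k(W) is the full image, so that the 1-cylinders are the [br i]; no
   mass distinguishes it from the image of [repeller `&` W]. *)
Definition precylinder (n : nat) (W : set R) : Prop :=
  [/\ is_interval W, W `<=` I &
      forall k, (k < n)%N -> exists i, iter k f @` W `<=` Z i].

Definition cylinder (n : nat) : set (set R) :=
  [set W | precylinder n W /\
           forall V, precylinder n V -> W `<=` V -> V = W].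

Definition birkhoff_sum (phi : R -> R) (n : nat) (x : R) : R :=
  \sum_(0 <= i < n) phi (iter i f x).

(* Preimages are taken in the repeller: the others lie in no [br i], and
   exp phi vanishes on [holes]. *)
Definition transfer (phi : R -> R) (psi : R -> \bar R) (x : R) : \bar R :=
  \esum_(y in repeller `&` f @^-1` [set x]) (psi y * (expR (phi y))%:E)%E.

Definition sup_exp_birkhoff (phi : R -> R) (n : nat) : \bar R :=
  ereal_sup [set (expR (birkhoff_sum phi n x))%:E | x in repeller].

Definition inf_transfer (phi : R -> R) (n : nat) (psi : R -> \bar R) : \bar R :=
  ereal_inf [set iter n (transfer phi) psi x | x in repeller `\` holes].

Definition nonatomic (m : probability (measurableTypeR R) R) : Prop :=
  forall x : R, m [set x] = 0%E.

(* dm / d(m o f) = exp phi, where the measure m o f is A |-> m (f (A)) on each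
   branch and f (A) stands for f (repeller `&` A); in particular m gives no
   mass to the points of the [br i] outside the repeller. *)
Definition conformal (phi : R -> R) (m : probability (measurableTypeR R) R) : Prop :=
  exists mf : {measure set (measurableTypeR R) -> \bar R},
    (forall i (A : set (measurableTypeR R)), measurable A -> A `<=` Z i ->
       mf A = m (f @` (repeller `&` A))) /\
    (forall A : set (measurableTypeR R), measurable A ->
       A `<=` \bigcup_i Z i ->
       m A = (\int[mf]_(x in repeller `&` A) (expR (phi x))%:E)%E).

Definition bounded_distortion_potential (phi : R -> R) (Cd : R) : Prop :=
  0 < Cd /\
  forall n (w : nat -> idx T) x y,
    repeller x -> repeller y -> branch w n x -> branch w n y ->
    `|expR (birkhoff_sum phi n x - birkhoff_sum phi n y) - 1|
      <= Cd * `|iter n f x - iter n f y|.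

Definition contracting_potential (phi : R -> R) : Prop :=
  exists n0, (sup_exp_birkhoff phi n0 < inf_transfer phi n0 (cst 1%E))%E.

Definition covering_potential (phi : R -> R) : Prop :=
  forall x delta : R, repeller x -> 0 < delta -> ball x delta `&` holes = set0 ->
  exists N, (0 < inf_transfer phi N
                   (fun y => (\1_(ball x delta `&` repeller) y)%:E))%E.

Definition large_cylinder_images
    (m : probability (measurableTypeR R) R) (n1 : nat) : Prop :=
  exists cm : R, 0 < cm /\
  (cm%:E <= ereal_inf [set m (iter n1 f @` (repeller `&` W))
                      | W in cylinder n1])%E.

Definition imap_invariant (mu : probability (measurableTypeR R) R) : Prop :=
  forall A : set (measurableTypeR R), measurable A ->
    mu (repeller `&` f @^-1` A) = mu A.

Definition codes (s : nat -> idx T) (x : R) : Prop :=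
  repeller x /\ forall n, Z (s n) (iter n f x).

Definition shift_space : set (nat -> idx T) := [set s | exists x, codes s x].

(* The value 0 outside [shift_space] is irrelevant. *)
Definition coding (s : nat -> idx T) : R := xget 0 [set x | codes s x].

Definition word_cylinder (w : seq (idx T)) : set (nat -> idx T) :=
  [set s | shift_space s /\ mkseq s (size w) = w].

Definition admissible (w : seq (idx T)) : Prop := word_cylinder w !=set0.

(* All sequences, with the sigma-algebra generated by the [word_cylinder]s;
   one of these is [shift_space], on which this is the usual one. *)
Definition coding_space := g_sigma_algebraType (range word_cylinder).

HB.instance Definition _ := Measurable.on coding_space.

Definition symbolic_lift (mu : probability (measurableTypeR R) R)
    (mut : probability coding_space R) : Prop :=
  mut shift_space = 1%E /\
  forall A : set (measurableTypeR R), measurable A ->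
    mu A = mut (shift_space `&` coding @^-1` A).

Definition word_mass (mut : probability coding_space R) (w : seq (idx T)) : R :=
  fine (mut (word_cylinder w)).

Definition quasi_bernoulli (mut : probability coding_space R) : Prop :=
  exists C : R, 1 < C /\
  forall u v : seq (idx T), admissible u -> admissible v -> admissible (u ++ v) ->
    C^-1 * word_mass mut u * word_mass mut v <= word_mass mut (u ++ v)
      <= C * word_mass mut u * word_mass mut v.

Definition psi_mixing (mut : probability coding_space R) : Prop :=
  exists gamma : nat -> R, gamma @ \oo --> 0 /\
  forall (u v : seq (idx T)) (j : nat), admissible u -> admissible v ->
    `| fine (mut (\bigcup_(y in [set y | size y = j /\ admissible (u ++ y ++ v)])
                    word_cylinder (u ++ y ++ v)))
       / (word_mass mut u * word_mass mut v) - 1 | <= gamma j.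

(* 0 is added so that the diameter of the empty set is 0. *)
Definition diam (A : set R) : \bar R :=
  ereal_sup ([set 0%E] `|` [set `|x - y|%:E | x in A & y in A]).

Definition diam_regular (m : probability (measurableTypeR R) R) : Prop :=
  exists C s : R, 0 < s /\
  forall U : set R, is_interval U -> U `<=` I ->
    (m U <= C%:E * diam U `^ s)%E.

(* The derivative at x of f^n along the branch coded by w, one-sided when x is
   an end-point of that branch. *)
Definition branch_derivative (w : nat -> idx T) (n : nat) (x d : R) : Prop :=
  (iter n f y - iter n f x) / (y - x) @[y --> within (branch w n) x^'] --> d.

Definition bounded_distortion : Prop :=
  exists C : R, 0 < C /\
  forall n (w : nat -> idx T) x y,
    repeller x -> repeller y -> branch w n x -> branch w n y ->
    exists dx dy : R,
      [/\ branch_derivative w n x dx, branch_derivative w n y dy &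
          C^-1 <= `|dx| / `|dy| <= C].

Definition adjacent_cylinders (n : nat) (W V V' : set R) : Prop :=
  V <> V' /\
  exists A : set R, [/\ is_interval A, A `<=` W &
    [set U | cylinder n U /\ U `&` A !=set0] = [set V; V']].

Definition adjacent_comparable (mu : probability (measurableTypeR R) R) : Prop :=
  (exists C : R, 0 < C /\
   forall n W V V', cylinder n W -> cylinder n.+1 V -> cylinder n.+1 V' ->
     V `<=` W -> V' `<=` W -> adjacent_cylinders n.+1 W V V' ->
     C^-1 <= fine (mu V) / fine (mu V') <= C) /\
  (forall n W V, cylinder n W -> cylinder n.+1 V -> V `<=` W ->
     exists V', [/\ cylinder n.+1 V', V' `<=` W & adjacent_cylinders n.+1 W V V']).

Definition hausdorff_content (s delta : R) (A : set R) : \bar R :=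
  ereal_inf [set (\sum_(0 <= k <oo) diam (U k) `^ s)%E
            | U in [set U : (set R)^nat | A `<=` \bigcup_k U k /\
                      forall k, (diam (U k) <= delta%:E)%E]].

(* For s = 0 empty sets of a cover count for 1, since 0 `^ 0 = 1; this does not
   affect the infimum below. *)
Definition hausdorff_measure (s : R) (A : set R) : \bar R :=
  ereal_sup [set hausdorff_content s delta A | delta in [set delta | 0 < delta]].

Definition hausdorff_dim (A : set R) : \bar R :=
  ereal_inf [set s%:E | s in [set s | 0 <= s /\ hausdorff_measure s A = 0%E]].

Definition repeller_dim : R := fine (hausdorff_dim repeller).

Definition ahlfors_regular (m : probability (measurableTypeR R) R) : Prop :=
  exists c : R, 0 < c /\
  forall x r : R, repeller x -> 0 < r <= 1 ->
    ((r `^ repeller_dim / c)%:E <= m (ball x r))%E /\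
    (m (ball x r) <= (c * r `^ repeller_dim)%:E)%E.

(* Images and inclusions of the next definitions are those of the system
   restricted to the repeller: f (U) is f (repeller `&` U), and [br i] and
   [dom] stand for their traces on the repeller. *)
Definition image_on_repeller (i : idx T) : set R := f @` (repeller `&` Z i).

Definition markov : Prop :=
  forall i, exists J : set (idx T),
    image_on_repeller i = \bigcup_(j in J) (repeller `&` Z j).

Definition big_images_preimages : Prop :=
  exists J : seq (idx T), forall i, exists j k,
    [/\ j \in J, k \in J,
        repeller `&` Z i `<=` image_on_repeller j &
        repeller `&` Z k `<=` image_on_repeller i].

Definition full_branch (i : idx T) : Prop := image_on_repeller i = repeller.

Definition two_full_branches : Prop :=
  exists i j, [/\ i <> j, full_branch i & full_branch j].

Definition uniformly_expanding : Prop :=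
  exists gamma : R, 0 < gamma /\ 1 < gamma^-1 /\
  forall i x, Z i x ->
    exists d, branch_derivative (fun=> i) 1 x d /\ gamma^-1 <= `|d|.

Definition gibbs (mut : probability coding_space R) : Prop :=
  exists (phi : R -> R) (L K P : R),
    [/\ forall i x y, repeller x -> repeller y -> Z i x -> Z i y ->
          `|phi x - phi y| <= L * `|x - y|,
        0 < K &
        forall s n, shift_space s ->
          K^-1 <= word_mass mut (mkseq s n)
                    / expR (birkhoff_sum phi n (coding s) + n%:R * P) <= K].

Definition gibbs_markov (mut : probability coding_space R) : Prop :=
  [/\ markov, big_images_preimages, uniformly_expanding & gibbs mut].

Definition orbit_dense (delta : R) (n : nat) (x : R) : Prop :=
  forall y, repeller y ->
    exists2 k, (k <= n)%N & `|y - iter k f x| <= delta.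

(* +oo when there is no such n. *)
Definition cover_time (delta : R) (x : R) : \bar R :=
  ereal_inf [set n%:R%:E
            | n in [set n : nat | (1 <= n)%N /\ orbit_dense delta n x]].

Definition mean_cover_time (mu : probability (measurableTypeR R) R)
    (delta : R) : \bar R :=
  (\int[mu]_(x in repeller) cover_time delta x)%E.

End SystemDefinitions.

(* Main.v *)
Require Import Defs.
From mathcomp Require Import all_boot all_order all_algebra.
From mathcomp Require Import all_classical all_reals all_analysis measurable_realfun.
From mathcomp Require Import ring lra zify.

Import Order.TTheory GRing.Theory Num.Theory.
Import numFieldNormedType.Exports.

Local Open Scope classical_set_scope.
Local Open Scope ring_scope.

Set Implicit Arguments.
Unset Strict Implicit.
Unset Printing Implicit Defensive.

(** Write s for the dimension, so that m-balls of radius delta around points of the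
    repeller have mass of the order of delta ^ s.

    The measures.  Conformality and bounded distortion make m almost multiplicative
    along a branch ([m_distortion]), up to the mass of the image of the cylinder.  The
    quasi-Bernoulli property of mu forces these images to be big ([mu_follow],
    [m_follow_gt0]): a branch image carries a fixed proportion of mu, hence of m.  By
    mixing, finitely many words of one length j connect any word to any other
    ([connecting_words]), so that after a gap of length j the image of a cylinder even
    dominates a multiple of m ([m_decouple_ge]).  Thus m and mu both decouple the past
    from the future, and they are comparable on unions of cylinders
    ([compare_by_recurrence], [m_le_mu], [mu_le_m]): a rare union of cylinders is met
    after a number of trials of the order of the inverse of its mass for either
    measure, and a union bound for the other one compares the two masses.  An interval
    is a union of n-cylinders up to two cylinders ([cut_cylinders]), whose masses decay
    with n, so that mu also gives balls a mass of the order of delta ^ s.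

    The lower bound.  The points of a delta-dense orbit segment are the centres of
    balls that cover the repeller, so there are at least of the order of delta ^ (- s)
    of them ([cover_time_ge]); this holds for every point, not only in the mean.

    The upper bound.  By a second moment argument an interval of mass u is hit within
    a time of the order of 1 / u with a probability bounded below ([hit_window]).
    Separating such windows by gaps, the probability that the interval is avoided
    decays geometrically in the number of windows ([avoid_tail]).  A union bound over
    a grid of about 1 / delta intervals of length delta / 2 shows that
    log (1 / delta) windows are enough up to a constant ([mean_cover_time_le]).

    The logarithm in the lower bound.  With two full branches all words in two letters
    a and b are admissible.  The words a^(r+1) b x b...b with x any word of length r in
    the two letters cannot overlap each other ([marked_non_overlapping]), and their
    final run of letters b can be stopped when the mass is about delta ^ s.  With a
    suitable constant these cylinders are longer than 2 delta, so that a delta-dense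
    orbit must enter each of them ([deep_point]).  This is a coupon collector problem
    with 2 ^ r coupons, where 2 ^ r is a power of 1 / delta: while u coupons are
    missing, the next one is collected at a given time with probability at most of the
    order of u delta ^ s.  The harmonic number of the count of the missing coupons
    therefore decreases at a mean speed at most of the order of delta ^ s
    ([potential_drop]), whence a mean collecting time of the order of
    delta ^ (- s) log (2 ^ r) at least ([harmonic_mean_le]). *)


(** * Itineraries and cylinders *)

Section Coding.
Variables (R : realType) (T : interval_map R).
Local Notation f := (imap T).
Local Notation Z := (@br R T).
Local Notation Lam := (repeller T).

(** Branch domains may share end-points.  Choosing one branch for each point gives
    every point of the repeller exactly one itinerary, so that the cylinders of a
    given generation partition the repeller. *)
Definition code (x : R) : idx T := xget point [set i | Z i x].

Definition atom (i : idx T) : set R := [set x | Z i x /\ code x = i].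

Fixpoint piece (w : seq (idx T)) : set R :=
  if w is i :: w' then atom i `&` f @^-1` piece w' else setT.

Definition cyl (w : seq (idx T)) : set R := Lam `&` piece w.

Fixpoint itin (n : nat) (x : R) : seq (idx T) :=
  if n is n'.+1 then code x :: itin n' (f x) else [::].

Lemma size_itin n x : size (itin n x) = n.
Proof. by elim: n x => //= n IH x; rewrite IH. Qed.

Lemma code_br x i : Z i x -> Z (code x) x.
Proof. by move=> zx; exact: (@xgetI _ point [set i | Z i x] i). Qed.

Lemma atom_code i x : Z i x -> atom (code x) x.
Proof. by move=> zx; split => //; exact: code_br zx. Qed.

Lemma repeller_br x : Lam x -> exists i, Z i x.
Proof. by case=> _ /(_ 0%N) [i _ /= zx]; exists i. Qed.

Lemma repeller_atom x : Lam x -> atom (code x) x.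
Proof. by move=> /repeller_br [i zx]; exact: atom_code zx. Qed.

Lemma repeller_f x : Lam x -> Lam (f x).
Proof.
move=> Lx; have [i zx] := repeller_br Lx; split; first exact: imap_dom zx.
by move=> k; rewrite -iterSr; case: Lx.
Qed.

Lemma repeller_iter n x : Lam x -> Lam (iter n f x).
Proof. by move=> Lx; elim: n => //= n; exact: repeller_f. Qed.

Lemma repeller_back i x : Z i x -> Lam (f x) -> Lam x.
Proof.
move=> zx [_ Lfx]; split; first exact: br_sub zx.
by case=> [|k]; [exists i | rewrite iterSr].
Qed.

Lemma pieceP w x : Lam x -> piece w x <-> itin (size w) x = w.
Proof.
elim: w x => [|i w IH] x Lx //=; split.
  by move=> [[zx <-] /IH ->//]; exact: repeller_f.
move=> [ci iw]; split; last by apply/IH => //; exact: repeller_f.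
by rewrite -ci; exact: repeller_atom.
Qed.

Lemma cylP w x : cyl w x <-> Lam x /\ itin (size w) x = w.
Proof. by split=> [[Lx /pieceP]|[Lx /pieceP]]; [auto | split; auto]. Qed.

Lemma cyl_itin n x : Lam x -> cyl (itin n x) x.
Proof. by move=> Lx; apply/cylP; rewrite size_itin. Qed.

Lemma cyl_nil : cyl [::] = Lam.
Proof. by rewrite /cyl /= setIT. Qed.

Lemma piece_cat u v x :
  piece (u ++ v) x <-> piece u x /\ piece v (iter (size u) f x).
Proof.
elim: u x => [|i u IH] x /=; first by split=> [|[]].
rewrite -?iterS iterSr; split; first by case=> ax /IH [].
by case=> -[ax pu] pv; split=> //; apply/IH.
Qed.

Lemma cyl_cat u v :
  cyl (u ++ v) = cyl u `&` (iter (size u) f) @^-1` cyl v.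
Proof.
apply/seteqP; split=> x.
  by case=> Lx /piece_cat [pu pv]; do 2!split=> //; exact: repeller_iter.
by case=> -[Lx pu] [_ pv]; split=> //; apply/piece_cat.
Qed.

Lemma itin_cat m n x : itin (m + n) x = itin m x ++ itin n (iter m f x).
Proof.
by elim: m x => [|m IH] x //; rewrite addSn [LHS]/= IH /= -?iterS iterSr.
Qed.

Lemma nth_itin i0 n x k : (k < n)%N -> nth i0 (itin n x) k = code (iter k f x).
Proof.
by elim: n x k => [|n IH] x [|k] // kn; rewrite /= IH // -?iterS ?iterSr.
Qed.

Lemma piece_branch w x : dom T x -> piece w x -> branch (nth point w) (size w) x.
Proof.
move=> Ix pw; split=> //; elim: w x pw {Ix} => [|i w IH] x //= [[zx _] pw] [|k] kn //.
by rewrite -?iterS iterSr; exact: IH.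
Qed.

Lemma cyl_branch w x : cyl w x -> branch (nth point w) (size w) x.
Proof. by case=> -[Ix _] pw; exact: piece_branch. Qed.

(** Two intervals that share two points share an open interval, which distinct
    branch domains do not. *)
Lemma br_two_points i j x y : x < y ->
  Z i x -> Z i y -> Z j x -> Z j y -> i = j.
Proof.
move=> xy ix iy jx jy.
have [//|nij] := pselect (i = j).
have oo k : Z k x -> Z k y -> (Z k)° ((x + y) / 2).
  move=> kx ky; apply/nbhs_ballP; exists ((y - x) / 2) => /=; first lra.
  move=> z; rewrite /ball /= ltr_norml => /andP[z1 z2].
  by apply: (@br_interval _ T k x y) => //; apply/andP; split; lra.
have := @br_disjoint _ T i j I I; apply.
by exists ((x + y) / 2); split; apply: oo.
Qed.

Definition between (x z y : R) : Prop := x < z < y \/ y < z < x.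

Lemma f_between i x z y : Z i x -> Z i y -> between x z y ->
  Z i z /\ between (f x) (f z) (f y).
Proof.
move=> ix iy b; have iz : Z i z.
  by case: b => /andP[b1 b2]; [apply: (@br_interval _ T i x y)|apply: (@br_interval _ T i y x)] => //;
     rewrite !ltW.
split=> //; case: b => /andP[b1 b2]; case: (@imap_monotone _ T i) => mf.
- by left; apply/andP; split; apply: mf.
- by right; apply/andP; split; apply: mf.
- by right; apply/andP; split; apply: mf.
- by left; apply/andP; split; apply: mf.
Qed.

(** Two end-points in Z i force the branch chosen at a point z between them to be i:
    its domain is a nondegenerate interval that contains z, so that it meets Z i in
    a second point. *)
Lemma atom_between i x z y : atom i x -> atom i y -> between x z y -> atom i z.
Proof.
wlog xy : x y / x < z < y => [H|] ax ay.
  by case=> b; [apply: (H x y)|apply: (H y x)] => //; left.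
case=> [_|]; last lra.
have [xz zy] := andP xy.
have [iz _] := f_between ax.1 ay.1 (or_introl xy); split=> //.
set k := code z; have kz : Z k z := code_br iz.
have [u [ku nuz]] : exists u, Z k u /\ u != z.
  have [p] := @br_nondegenerate _ T k.
  move=> /nbhs_ballP [e /= e0 pe].
  have [pz|pz] := eqVneq p z; last by exists p; split=> //; apply: pe; exact: ballxx.
  exists (p + e / 2); split; last by rewrite -pz gt_eqF //; lra.
  by apply: pe; rewrite /ball /= opprD addrA subrr sub0r normrN gtr0_norm; lra.
have [iax iay] := (ax.1, ay.1).
move: nuz; rewrite neq_lt => /orP[uz|zu].
- apply: (@br_two_points _ _ (Num.max u x) z) => //.
  + by rewrite gt_max uz.
  + by apply: (@br_interval _ T k u z) => //; rewrite le_max lexx /= ge_max !ltW.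
  + by apply: (@br_interval _ T i x z) => //; rewrite le_max lexx orbT /= ge_max !ltW.
- apply: (@br_two_points _ _ z (Num.min u y)) => //.
  + by rewrite lt_min zu.
  + by apply: (@br_interval _ T k z u) => //; rewrite ge_min lexx /= le_min !ltW.
  + by apply: (@br_interval _ T i z y) => //; rewrite ge_min lexx orbT /= le_min !ltW.
Qed.

Lemma piece_between w x z y : piece w x -> piece w y -> between x z y ->
  piece w z.
Proof.
elim: w x y z => [|i w IH] x y z //= [ax wx] [ay wy] b.
split; first exact: atom_between b.
by apply: (IH (f x) (f y)) => //; have [] := f_between ax.1 ay.1 b.
Qed.

Lemma between_itv (A : set R) :
  (forall x y z, A x -> A y -> between x z y -> A z) -> is_interval A.
Proof.
move=> H x y Ax Ay z /andP[]; rewrite !le_eqVlt => /orP[/eqP<-//|xz] /orP[/eqP->//|zy].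
by apply: (H x y) => //; left; rewrite xz.
Qed.

Lemma atom_itv i : is_interval (atom i).
Proof. by apply: between_itv => x y z ax ay; exact: atom_between. Qed.

Lemma piece_itv w : is_interval (piece w).
Proof. by apply: between_itv => x y z ax ay; exact: piece_between. Qed.

(** Being monotone on each branch, the iterates keep betweenness for as long as the
    two outer points follow the same branches. *)
Lemma branch_between (w : nat -> idx T) n x z y :
  branch w n x -> branch w n y -> between x z y ->
  branch w n z /\ between (iter n f x) (iter n f z) (iter n f y).
Proof.
move=> [Ix bx] [Iy by_] b.
have H k : (k <= n)%N -> between (iter k f x) (iter k f z) (iter k f y).
  elim: k => // k IH kn.
  by have [] := f_between (bx k kn) (by_ k kn) (IH (ltnW kn)).
split; last exact: H.
split.
  by case: b => /andP[b1 b2]; [apply: (@dom_interval _ T x y)|apply: (@dom_interval _ T y x)] => //;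
     rewrite !ltW.
move=> k kn; have [] := f_between (bx k kn) (by_ k kn) (H k (ltnW kn)) => //.
Qed.

Lemma branch_itv (w : nat -> idx T) n : is_interval (branch w n).
Proof. by apply: between_itv => x y z bx b_y /(branch_between bx b_y) []. Qed.

Lemma branch_two_points (w w' : nat -> idx T) n x y : x < y ->
  branch w n x -> branch w n y -> branch w' n x -> branch w' n y ->
  forall k, (k < n)%N -> w k = w' k.
Proof.
move=> xy [_ bx] [_ by_] [_ bx'] [_ by'].
have ne k : (k <= n)%N -> iter k f x != iter k f y.
  elim: k => [|k IH] kn /=; first by rewrite lt_eqF.
  have := IH (ltnW kn); rewrite !neq_lt => /orP[] lt;
  case: (@imap_monotone _ T (w k)) => mf.
  - by rewrite mf //; [exact: bx|exact: by_].
  - by rewrite orbC mf //; [exact: bx|exact: by_].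
  - by rewrite orbC mf //; [exact: by_|exact: bx].
  - by rewrite mf //; [exact: by_|exact: bx].
move=> k kn; have := ne k (ltnW kn); rewrite neq_lt => /orP[] lt.
  by apply: (br_two_points lt); [exact: bx|exact: by_|exact: bx'|exact: by'].
by apply: (br_two_points lt); [exact: by_|exact: bx|exact: by'|exact: bx'].
Qed.

Lemma cyl_two_points (v v' : seq (idx T)) x y : size v = size v' -> x < y ->
  branch (nth point v) (size v) x -> branch (nth point v) (size v) y ->
  branch (nth point v') (size v') x -> branch (nth point v') (size v') y ->
  v = v'.
Proof.
move=> ss xy vx vy v'x v'y; apply: (@eq_from_nth _ point) => //.
rewrite -ss in v'x v'y; exact: branch_two_points xy vx vy v'x v'y.
Qed.

(** Two cylinders that straddle the same end of K overlap in a nondegenerate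
    interval, hence are equal.  This is what lets estimates for words reach
    intervals. *)
Lemma cut_cylinders (K : set R) n : is_interval K ->
  exists v1 v2 : seq (idx T), [/\ size v1 = n, size v2 = n &
    forall v, size v = n -> cyl v `&` K !=set0 -> cyl v `<=` K \/ v = v1 \/ v = v2].
Proof.
move=> iK.
have bra (w : seq (idx T)) x y z : cyl w x -> cyl w y -> x <= z <= y ->
    branch (nth point w) (size w) z.
  by move=> wx wy; apply: branch_itv; exact: cyl_branch.
(* The cylinders that leave K to the left, and those that leave it to the right. *)
pose L := [set v | size v = n /\ exists p q, [/\ cyl v p, cyl v q, K p, ~ K q & q < p]].
pose U := [set v | size v = n /\ exists p q, [/\ cyl v p, cyl v q, K p, ~ K q & p < q]].
have L1 v v' : L v -> L v' -> v = v'.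
  move=> [sv [p [q [vp vq Kp nKq qp]]]] [sv' [p' [q' [vp' vq' Kp' nKq' qp']]]].
  pose a := Num.max q q'; pose b := Num.min p p'.
  have qp1 : q < p'.
    rewrite ltNge; apply/negP => p'q; apply: nKq; apply: (iK p' p) => //.
    by rewrite p'q ltW.
  have qp2 : q' < p.
    rewrite ltNge; apply/negP => pq'; apply: nKq'; apply: (iK p p') => //.
    by rewrite pq' ltW.
  have ab : a < b by rewrite lt_min !gt_max qp qp1 qp2 qp'.
  apply: (@cyl_two_points _ _ a b) => //; first by rewrite sv.
  - by apply: (bra _ q p) => //; rewrite le_max lexx /= ge_max !ltW.
  - by apply: (bra _ q p) => //; rewrite ge_min lexx /= andbT le_min !ltW.
  - by apply: (bra _ q' p') => //; rewrite le_max lexx orbT /= ge_max !ltW.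
  - by apply: (bra _ q' p') => //; rewrite ge_min lexx orbT /= andbT le_min !ltW.
have U1 v v' : U v -> U v' -> v = v'.
  move=> [sv [p [q [vp vq Kp nKq qp]]]] [sv' [p' [q' [vp' vq' Kp' nKq' qp']]]].
  pose a := Num.max p p'; pose b := Num.min q q'.
  have qp1 : p' < q.
    rewrite ltNge; apply/negP => p'q; apply: nKq; apply: (iK p p') => //.
    by rewrite p'q ltW.
  have qp2 : p < q'.
    rewrite ltNge; apply/negP => pq'; apply: nKq'; apply: (iK p' p) => //.
    by rewrite pq' ltW.
  have ab : a < b by rewrite lt_min !gt_max qp qp1 qp2 qp'.
  apply: (@cyl_two_points _ _ a b) => //; first by rewrite sv.
  - by apply: (bra _ p q) => //; rewrite le_max lexx /= ge_max !ltW.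
  - by apply: (bra _ p q) => //; rewrite ge_min lexx /= andbT le_min !ltW.
  - by apply: (bra _ p' q') => //; rewrite le_max lexx orbT /= ge_max !ltW.
  - by apply: (bra _ p' q') => //; rewrite ge_min lexx orbT /= andbT le_min !ltW.
pose d := nseq n (point : idx T).
have get (A : set (seq (idx T))) : (forall v, A v -> size v = n) ->
    exists v1, size v1 = n /\ (A !=set0 -> A v1).
  move=> As; have [A0|A0] := pselect (A !=set0).
    by case: A0 => v Av; exists v; split; [exact: As|].
  by exists d; rewrite size_nseq; split=> // /A0.
have [v1 [s1 L1']] := get L (fun v h => h.1).
have [v2 [s2 U1']] := get U (fun v h => h.1).
exists v1, v2; split=> // v sv [p [vp Kp]].
have [sub|nsub] := pselect (cyl v `<=` K); [by left|right].
have [q [vq nKq]] : exists q, cyl v q /\ ~ K q.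
  by apply: contrapT => /forallNP h; apply: nsub => q vq; apply: contrapT => nKq; apply: (h q).
have [qp|pq|e] := ltgtP q p.
- left; have Lv : L v by (split=> //; exists p, q).
  apply: (L1 _ _ Lv); by apply: L1'; exists v.
- right; have Uv : U v by (split=> //; exists p, q).
  apply: (U1 _ _ Uv); by apply: U1'; exists v.
- by rewrite e in nKq.
Qed.

End Coding.

(** * Measurability *)

Section BorelInduction.
Variable R : realType.

Lemma borel_ind (C : set R -> Prop) :
  (forall x, C `]-oo, x[%classic) ->
  (forall A, C A -> C (~` A)) ->
  (forall F : (set R)^nat, (forall n, C (F n)) -> C (\bigcup_n F n)) ->
  forall A : set (measurableTypeR R), measurable A -> C A.
Proof.
move=> C0 CC CU A mA.
have C00 : C set0.
  have H : C (~` (\bigcup_n ~` `]-oo, (- n%:R : R)[%classic)).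
    by apply: (CC _); apply: CU => n; apply: (CC _).
  suff -> : set0 = ~` (\bigcup_n ~` `]-oo, (- n%:R : R)[%classic) by [].
  apply/esym/seteqP; split=> // x; apply => /=.
  exists (Num.truncn `|x|).+1 => //=; rewrite in_itv /=; apply/negP; rewrite -leNgt.
  have := truncnS_gt `|x|; have := ler_norm (- x); rewrite normrN; lra.
have : (@RGenInftyO.G R).-sigma.-measurable A by rewrite -RGenInftyO.measurableE.
apply: smallest_sub; last by move=> B [x ->].
by split=> // B CB; rewrite setTD; apply: CC.
Qed.

End BorelInduction.

Section Measurability.
Variables (R : realType) (T : interval_map R).
Local Notation f := (imap T).
Local Notation Z := (@br R T).
Local Notation Lam := (repeller T).
Local Notation mR := (measurableTypeR R).
Implicit Types (i : idx T) (u v w : seq (idx T)).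

Lemma measurable_br i : measurable (Z i : set mR).
Proof. by apply: is_interval_measurable; exact: br_interval. Qed.

Lemma measurable_atom i : measurable (atom i : set mR).
Proof. by apply: is_interval_measurable; exact: atom_itv. Qed.

Lemma measurable_br_preimage i (A : set mR) : measurable A ->
  measurable (Z i `&` f @^-1` A : set mR).
Proof.
have mf : measurable_fun (Z i : set mR) f.
  by apply: subspace_continuous_measurable_fun; [exact: measurable_br|exact: imap_continuous].
by apply: mf; exact: measurable_br.
Qed.

Lemma measurable_repeller : measurable (Lam : set mR).
Proof.
pose G := fix G n : set R := if n is n'.+1 then \bigcup_i (Z i `&` f @^-1` G n') else
  \bigcup_i Z i.
have mG n : measurable (G n : set mR).
  by elim: n => [|n IH]; apply: countable_bigcupT_measurable (@idx_countable _ T) _ => i;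
    [exact: measurable_br|exact: measurable_br_preimage].
have -> : Lam = \bigcap_n G n.
  apply/seteqP; split=> x.
    move=> Lx n _; elim: n x Lx => [|n IH] x Lx; have [i zx] := repeller_br Lx; first by exists i.
    by exists i => //; split => //; apply: IH; exact: repeller_f.
  move=> Gx; split; first by have [i _ zx] := Gx 0%N I; exact: br_sub zx.
  move=> k; have := Gx k I; elim: k x {Gx} => [|k IH] x //=.
  by move=> [i _ [zx /IH]]; rewrite -iterS iterSr.
by apply: bigcapT_measurable.
Qed.

Lemma measurable_preimage (A : set mR) : measurable A ->
  measurable (Lam `&` f @^-1` A : set mR).
Proof.
move=> mA.
have -> : Lam `&` f @^-1` A = Lam `&` \bigcup_i (Z i `&` f @^-1` A).
  apply/seteqP; split=> x [Lx]; last by move=> [i _ []].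
  by move=> fx; split=> //; have [i zx] := repeller_br Lx; exists i.
apply: measurableI; first exact: measurable_repeller.
apply: countable_bigcupT_measurable (@idx_countable _ T) _ => i.
exact: measurable_br_preimage.
Qed.

Lemma measurable_iter_preimage n (A : set mR) : measurable A ->
  measurable (Lam `&` (iter n f) @^-1` A : set mR).
Proof.
move=> mA; elim: n => [|n IH]; first exact: measurableI measurable_repeller mA.
have -> : Lam `&` iter n.+1 f @^-1` A = Lam `&` f @^-1` (Lam `&` iter n f @^-1` A).
  apply/seteqP; split=> x [Lx] /=.
    by rewrite -iterS iterSr => Ax; do 2!split=> //; exact: repeller_f.
  by rewrite -iterS iterSr => -[_ Ax].
exact: measurable_preimage.
Qed.

Lemma measurable_cyl w : measurable (cyl w : set mR).
Proof.
elim: w => [|i w IH]; first by rewrite cyl_nil; exact: measurable_repeller.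
have -> : cyl (i :: w) = atom i `&` (Lam `&` f @^-1` cyl w).
  apply/seteqP; split=> x; first by case=> Lx [ax wx]; do 3!split=> //; exact: repeller_f.
  by case=> ax [Lx [_ wx]].
by apply: measurableI; [exact: measurable_atom|exact: measurable_preimage].
Qed.

Lemma image_itv i (J : set R) : is_interval J -> J `<=` Z i -> is_interval (f @` J).
Proof.
move=> iJ JZ; apply/connected_intervalP; apply: connected_continuous_connected.
  exact/connected_intervalP.
exact: continuous_subspaceW JZ (@imap_continuous _ T i).
Qed.

Lemma f_inj i x y : Z i x -> Z i y -> f x = f y -> x = y.
Proof.
move=> zx zy e; case: (ltgtP x y) => // xy; case: (@imap_monotone _ T i) => mf.
- by have := mf _ _ zx zy xy; rewrite e ltxx.
- by have := mf _ _ zx zy xy; rewrite e ltxx.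
- by have := mf _ _ zy zx xy; rewrite e ltxx.
- by have := mf _ _ zy zx xy; rewrite e ltxx.
Qed.

Lemma measurable_image i (A : set mR) : measurable A -> A `<=` Z i ->
  measurable (f @` A : set mR).
Proof.
move=> mA AZ.
suff : measurable (f @` (Z i `&` A) : set mR) by rewrite (setIidr AZ).
have mZ : measurable (f @` Z i : set mR).
  by apply: is_interval_measurable; apply: (@image_itv i) => //; exact: br_interval.
move: A mA {AZ}; apply: borel_ind => [x|A mA|F mF].
- apply: is_interval_measurable; apply: (@image_itv i); last exact: subIsetl.
  move=> y z [zy yx] [zz zx] u /andP[yu uz]; split.
    by apply: (@br_interval _ T i y z) => //; rewrite yu.
  by move: zx; rewrite /= !in_itv /=; exact: le_lt_trans.
- have -> : f @` (Z i `&` ~` A) = f @` Z i `\` f @` (Z i `&` A).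
    apply/seteqP; split=> y.
      move=> [x [zx nAx] <-]; split; first by exists x.
      by move=> [x' [zx' Ax'] e]; apply: nAx; rewrite -(f_inj zx' zx e).
    move=> [[x zx <-] n]; exists x => //; split=> // Ax; apply: n; exists x => //.
  exact: measurableD.
- rewrite setI_bigcupr image_bigcup.
  exact: bigcupT_measurable.
Qed.

(** Images of cylinders are traces of intervals: each branch is continuous. *)
Lemma image_piece_itv w : is_interval (iter (size w) f @` piece w).
Proof.
(* The induction runs on intersections with an interval, as f maps one to another. *)
suff H J : is_interval J -> is_interval (iter (size w) f @` (piece w `&` J)).
  by have := H setT (fun _ _ _ _ _ _ => I); rewrite setIT.
elim: w J => [|i w IH] J iJ /=; first by rewrite setTI image_id.
have -> : [set f (iter (size w) f x) | x in (atom i `&` f @^-1` piece w) `&` J] =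
    iter (size w) f @` (piece w `&` f @` (atom i `&` J)).
  apply/seteqP; split=> y.
    move=> [x [[ax wx] Jx] <-]; exists (f x); last by rewrite -iterS iterSr.
    by split=> //; exists x.
  move=> [z [wz [x [ax Jx] e]] <-]; exists x; last by rewrite -iterS iterSr e.
  by split=> //; split=> //; rewrite /preimage /= e.
apply: IH; apply: (@image_itv i); last by move=> x [[]].
move=> x y [ax Jx] [ay Jy] z xzy; split; first exact: (atom_itv ax ay).
exact: iJ xzy.
Qed.

Definition follow (w : seq (idx T)) : set R := iter (size w) f @` cyl w.

Lemma followE w : follow w = Lam `&` (iter (size w) f @` piece w).
Proof.
apply/seteqP; split=> y.
  by move=> [x [Lx wx] <-]; split; [exact: repeller_iter|exists x].
move=> [Ly [x wx e]]; exists x => //; split=> //; rewrite -{}e in Ly.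
elim: w x wx Ly => [|i w IH] x //= [[zx _] wx].
rewrite -iterS iterSr => L; exact: repeller_back zx (IH _ wx L).
Qed.

Lemma iter_cyl_inj w x y : cyl w x -> cyl w y ->
  iter (size w) f x = iter (size w) f y -> x = y.
Proof.
elim: w x y => [|i w IH] x y //= [Lx [[zx _] wx]] [Ly [[zy _] wy]].
rewrite -!iterS !iterSr => e; apply: (f_inj zx zy); apply: IH e; split=> //; exact: repeller_f.
Qed.

Lemma image_iterS n (A : set R) : iter n.+1 f @` A = iter n f @` (f @` A).
Proof. apply/seteqP; split=> y.
  by move=> [x Ax <-]; exists (f x); [exists x|rewrite iterSr].
by move=> [_ [x Ax <-] <-]; exists x; rewrite // iterSr. Qed.

Lemma image_cylS i w (A : set R) : A `<=` cyl (i :: w) -> f @` A `<=` cyl w.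
Proof. by move=> Aw _ [x /Aw [Lx [ax wx]] <-]; split=> //; exact: repeller_f. Qed.

Lemma measurable_iter_image w (A : set mR) : measurable A -> A `<=` cyl w ->
  measurable (iter (size w) f @` A : set mR).
Proof.
elim: w A => [|i w IH] A mA Aw; first by rewrite image_id.
rewrite [size _]/= image_iterS; apply: IH; last exact: image_cylS Aw.
by apply: (@measurable_image i) => // x /Aw [_ [[]]].
Qed.

Lemma measurable_follow w : measurable (follow w : set mR).
Proof. by apply: measurable_iter_image => //; exact: measurable_cyl. Qed.

Lemma iter_image_cylI w (B : set R) :
  iter (size w) f @` (cyl w `&` iter (size w) f @^-1` B) = follow w `&` B.
Proof.
apply/seteqP; split=> y; first by move=> [x [wx Bx] <-]; split=> //; exists x.
by move=> [[x wx <-] Bx]; exists x.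
Qed.

(** Words are labelled by natural numbers, so that sums over words become series. *)
Definition label (w : seq (idx T)) : nat :=
  pickle (map (sval (cid (countable_injP _ (@idx_countable _ T)))) w).

Lemma label_inj : injective label.
Proof.
rewrite /label; case: cid => g /= gi u v /(pcan_inj pickleK) /inj_map; apply.
by move=> x y e; apply: gi; rewrite ?inE.
Qed.

End Measurability.

(** * Real-valued probabilities *)

Lemma half_pow_small (R : realType) (e : R) : 0 < e ->
  exists k, k%:R <= e^-1 + 1 /\ 2 ^- k <= e.
Proof.
move=> e0; exists (Num.truncn e^-1).+1; split.
  by rewrite -natr1 lerD2r truncn_le // invr_ge0 ltW.
rewrite -[leRHS]invrK lef_pV2 ?posrE ?invr_gt0 ?exprn_gt0 //.
apply: le_trans (ltW (truncnS_gt _)) _; move: (Num.truncn e^-1).+1 => k.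
by rewrite -natrX ler_nat ltnW // ltn_expl.
Qed.

Section RealProbability.
Context (d : measure_display) (X : measurableType d) (R : realType).
Implicit Types (nu : probability X R) (A B E : set X).

Definition pr nu A : R := fine (nu A).

Lemma prE nu A : measurable A -> (pr nu A)%:E = nu A.
Proof. by move=> mA; rewrite fineK // fin_num_measure. Qed.

Lemma pr_ge0 nu A : 0 <= pr nu A.
Proof. exact: fine_ge0. Qed.

Lemma pr_le nu A B : measurable A -> measurable B -> A `<=` B ->
  pr nu A <= pr nu B.
Proof.
by move=> mA mB AB; rewrite -lee_fin !prE //; apply: le_measure; rewrite ?inE.
Qed.

Lemma pr_le1 nu A : measurable A -> pr nu A <= 1.
Proof. by move=> mA; rewrite -lee_fin prE // probability_le1. Qed.

Lemma pr0 nu : pr nu set0 = 0.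
Proof. by rewrite /pr measure0. Qed.

Lemma prU nu A B : measurable A -> measurable B -> [disjoint A & B] ->
  pr nu (A `|` B) = pr nu A + pr nu B.
Proof.
move=> mA mB AB; apply: EFin_inj; rewrite EFinD !prE //; last exact: measurableU.
by rewrite measureU //; apply/eqP; rewrite -disj_set2E.
Qed.

Lemma pr_split nu A E : measurable A -> measurable E ->
  pr nu A = pr nu (A `&` E) + pr nu (A `\` E).
Proof.
move=> mA mE; rewrite -prU; [by rewrite setUIDK| exact: measurableI | exact: measurableD|].
by rewrite disj_set2E; apply/eqP/seteqP; split=> // x [[_ Ex] [_]].
Qed.

Lemma prU_le nu A B : measurable A -> measurable B ->
  pr nu (A `|` B) <= pr nu A + pr nu B.
Proof.
move=> mA mB; rewrite -lee_fin EFinD !prE //; last exact: measurableU.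
exact: measureU2.
Qed.

Lemma pr_cover nu (I : eqType) (s : seq I) (F : I -> set X) A :
  (forall i, measurable (F i)) -> measurable A ->
  (forall x, A x -> exists2 i, i \in s & F i x) ->
  pr nu A <= \sum_(i <- s) pr nu (F i).
Proof.
move=> mF; elim: s A => [|i s IH] A mA AF.
  by rewrite big_nil (_ : A = set0) ?pr0 //; apply/seteqP; split=> // x /AF[].
rewrite big_cons (pr_split _ mA (mF i)) lerD //.
  by apply: pr_le => //; exact: measurableI.
apply: IH => [|x [/AF [j]]]; first exact: measurableD.
by rewrite inE => /orP[/eqP-> //|js Fj _]; exists j.
Qed.

Lemma pr_partition nu (I : finType) (h : X -> I) A :
  (forall i, measurable (A `&` h @^-1` [set i])) ->
  pr nu A = \sum_i pr nu (A `&` h @^-1` [set i]).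
Proof.
move=> mAh.
have mU (s : seq I) : measurable (\bigcup_(i in [set` s]) (A `&` h @^-1` [set i])).
  by rewrite bigcup_seq; apply: bigsetU_measurable.
have H (s : seq I) : uniq s ->
    pr nu (\bigcup_(i in [set` s]) (A `&` h @^-1` [set i])) =
    \sum_(i <- s) pr nu (A `&` h @^-1` [set i]).
  elim: s => [|i s IH] /=; first by rewrite big_nil bigcup_seq big_nil pr0.
  move=> /andP[nis us]; rewrite big_cons -IH // bigcup_seq big_cons -bigcup_seq prU //.
  rewrite disj_set2E; apply/eqP/seteqP; split=> // x [[_ hi] [j /= js [_ hj]]].
  by move: nis; rewrite -hi hj js.
rewrite -H ?index_enum_uniq //; congr pr; apply/seteqP; split=> x; last by move=> [i _ []].
by move=> Ax; exists (h x) => //=; rewrite mem_index_enum.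
Qed.

(** The F u may overlap, as subadditivity suffices on the left; only the G u are
    summed exactly. *)
Lemma pr_countable_le nu1 nu2 (U : choiceType) (lab : U -> nat) (P : set U)
    (F G : U -> set X) (c : R) : injective lab -> 0 <= c ->
  (forall u, measurable (F u)) -> (forall u, measurable (G u)) ->
  trivIset P G ->
  (forall u, P u -> pr nu1 (F u) <= c * pr nu2 (G u)) ->
  pr nu1 (\bigcup_(u in P) F u) <= c * pr nu2 (\bigcup_(u in P) G u).
Proof.
move=> labi c0 mF mG tG FG.
have bigE (H : U -> set X) :
    \bigcup_(u in P) H u = \bigcup_n \bigcup_(u in P `&` lab @^-1` [set n]) H u.
  apply/seteqP; split=> x; first by move=> [u Pu Hu]; exists (lab u) => //; exists u.
  by move=> [n _ [u [Pu _] Hu]]; exists u.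
have one (H : U -> set X) n : (exists2 u, P u /\ lab u = n &
    \bigcup_(u in P `&` lab @^-1` [set n]) H u = H u) \/
    ((forall u, P u -> lab u <> n) /\ \bigcup_(u in P `&` lab @^-1` [set n]) H u = set0).
  have [[u [Pu un]]|/forallNP no] := pselect (exists u, P u /\ lab u = n).
    left; exists u => //; apply/seteqP; split=> x; last by exists u.
    by move=> [v [Pv /= vn]]; rewrite (labi v u) // vn.
  right; split; first by move=> u Pu un; apply: (no u).
  by apply/seteqP; split=> // x [u [Pu un]]; case: (no u).
have mbig (H : U -> set X) n : (forall u, measurable (H u)) ->
    measurable (\bigcup_(u in P `&` lab @^-1` [set n]) H u).
  by move=> mH; case: (one H n) => [[u _ ->]|[_ ->]].
have mbb (H : U -> set X) : (forall u, measurable (H u)) -> measurable (\bigcup_(u in P) H u).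
  by move=> mH; rewrite bigE; apply: bigcupT_measurable => n; exact: mbig.
rewrite -lee_fin EFinM !prE; [|exact: mbb|exact: mbb].
rewrite [in leRHS]bigE measure_semi_bigcup; last 3 first.
- by move=> n; exact: mbig.
- move=> n p _ _ [x [[u [Pu <-] Gu] [v [Pv <-] Gv]]].
  by congr lab; apply: tG => //; exists x.
- by rewrite -bigE; exact: mbb.
apply: (@le_trans _ _ (\sum_(n <oo) nu1 (\bigcup_(u in P `&` lab @^-1` [set n]) F u))%E).
  rewrite bigE; apply: measure_sigma_subadditive => //.
    by move=> n; exact: mbig.
  by rewrite -bigE; exact: mbb.
rewrite -nneseriesZl //.
apply: lee_nneseries => [n _ _|n _]; first exact: measure_ge0.
have [[u [Pu un] eF]|[no eF]] := one F n; last by rewrite eF measure0 mule_ge0 // ?lee_fin ?measure_ge0.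
have [[v [Pv vn] eG]|[no eG]] := one G n; last by case: (no u).
rewrite eF eG; have -> : v = u by apply: labi; rewrite vn un.
by have := FG u Pu; rewrite -lee_fin EFinM !prE.
Qed.

Lemma pr_countable_ge nu1 nu2 (U : choiceType) (lab : U -> nat) (P : set U)
    (F G : U -> set X) (c : R) : injective lab -> 0 <= c ->
  (forall u, measurable (F u)) -> (forall u, measurable (G u)) ->
  trivIset P F ->
  (forall u, P u -> c * pr nu2 (G u) <= pr nu1 (F u)) ->
  c * pr nu2 (\bigcup_(u in P) G u) <= pr nu1 (\bigcup_(u in P) F u).
Proof.
move=> labi; rewrite le_eqVlt => /orP[/eqP<-|c0] mF mG tF GF; first by rewrite mul0r pr_ge0.
rewrite -ler_pdivlMl //; apply: (pr_countable_le labi) => //; first by rewrite invr_ge0 ltW.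
by move=> u Pu; rewrite ler_pdivlMl //; exact: GF.
Qed.

(** For finite measures absolute continuity is uniform. *)
Lemma pr_abs_cont nu1 nu2 : nu1 `<< nu2 -> forall e : R, 0 < e ->
  exists2 dl : R, 0 < dl & forall A, measurable A -> pr nu2 A < dl -> pr nu1 A < e.
Proof.
move=> ac e e0.
pose c := charge_of_finite_measure nu1.
have [P [N PN]] := Hahn_decomposition c.
have [dl [dl0 H]] := @charge_variation_continuous _ _ _ c P N PN nu2 ac e e0.
exists dl => // A mA Adl; rewrite -lte_fin prE //.
apply: le_lt_trans (H A mA _); last by move: Adl; rewrite -lte_fin prE.
by have := abse_charge_variation PN mA; apply: le_trans; exact: lee_abs.
Qed.

Lemma pr_full nu E A : measurable E -> measurable A -> pr nu E = 1 -> pr nu (A `\` E) = 0.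
Proof.
move=> mE mA E1; apply/eqP; rewrite eq_le pr_ge0 andbT.
have := pr_split nu measurableT mE; rewrite setTI E1 {1}/pr probability_setT /= => h.
apply: le_trans (_ : pr nu (setT `\` E) <= _); last lra.
by apply: pr_le; [exact: measurableD|exact: measurableD|exact: setSD].
Qed.

(** Bonferroni: the second order lower bound of the inclusion-exclusion formula. *)
Lemma pr_bonferroni nu (F : nat -> set X) (n : nat) : (forall i, measurable (F i)) ->
  \sum_(i < n) (pr nu (F i) - \sum_(j < i) pr nu (F j `&` F i))
    <= pr nu (\bigcup_(i < n) F i).
Proof.
move=> mF; elim: n => [|n IH]; first by rewrite big_ord0 pr_ge0.
have mU k : measurable (\bigcup_(i < k) F i) by apply: bigcup_measurable.
rewrite big_ord_recr /=.
have -> : \bigcup_(i < n.+1) F i = \bigcup_(i < n) F i `|` F n.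
  apply/seteqP; split=> x.
    move=> [i /=]; rewrite ltnS leq_eqVlt => /orP[/eqP->|ilt Fx]; [by right|by left; exists i].
  by case=> [[i /= ilt Fx]|Fx]; [exists i => //=; exact: ltnW|exists n => /=].
have -> : \bigcup_(i < n) F i `|` F n = \bigcup_(i < n) F i `|` (F n `\` \bigcup_(i < n) F i).
  apply/seteqP; split=> x; last by case=> [Ux|[Fx _]]; [left|right].
  case=> [Ux|Fx]; first by left.
  by have [Ux|nUx] := pselect ((\bigcup_(i < n) F i) x); [left|right].
rewrite prU; [|exact: mU|by apply: measurableD; [exact: mF|exact: mU]|].
  2: by rewrite disj_set2E; apply/eqP/seteqP; split=> // x [Ux [_]].
apply: lerD => //; rewrite lerBlDr (pr_split _ (mF n) (mU n)) addrC lerD2l.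
rewrite -(big_mkord xpredT (fun j => pr nu (F j `&` F n))).
apply: pr_cover => [i||x [Fnx [i /= ilt Fi]]]; [exact: measurableI|exact: measurableI|].
by exists i => //; rewrite mem_index_iota.
Qed.

End RealProbability.

Section MeanBound.
Context (d : measure_display) (X : measurableType d) (R : realType).

(** No measurability is asked of g and h, so that cover times can be integrated
    without any: the integral is a supremum over the simple functions below. *)
Lemma integral_le_ge0 (mu : {measure set X -> \bar R}) (D : set X) (g h : X -> \bar R) :
  (forall x, D x -> (0 <= g x)%E) -> (forall x, D x -> (g x <= h x)%E) ->
  (\int[mu]_(x in D) g x <= \int[mu]_(x in D) h x)%E.
Proof.
move=> g0 gh; rewrite !ge0_integralE //; last by move=> x Dx; exact: le_trans (g0 x Dx) (gh x Dx).
apply: ub_ereal_sup => _ [k /= kg <-]; apply: ereal_sup_ubound; exists k => //= x.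
apply: le_trans (kg x) _; rewrite /patch; case: ifPn => // /set_mem; exact: gh.
Qed.

(** The tail formula for means: if q is the first index at which W fails, the time is
    at most q S, that is S times the number of indices before. *)
Lemma mean_le_tail (mu : probability X R) (D : set X) (W : nat -> set X) (h : X -> \bar R)
    (S b : R) : measurable D -> (forall q, measurable (W q)) -> 0 < S ->
  (forall x, D x -> (0 <= h x)%E) ->
  (forall q x, D x -> ~ W q x -> (h x <= (q%:R * S)%:E)%E) ->
  (forall n, \sum_(q < n) pr mu (W q) <= b) ->
  (\int[mu]_(x in D) h x <= (S * b)%:E)%E.
Proof.
move=> mD mW S0 h0 hW Wb.
pose g q x : \bar R := (S * \1_(W q) x)%:E.
have g0 q x : (0 <= g q x)%E by rewrite lee_fin mulr_ge0 // ltW.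
have sumS N x : (forall q, (q < N)%N -> W q x) -> ((N%:R * S)%:E <= \sum_(q <oo) g q x)%E.
  move=> Wx; apply: le_trans (nneseries_lim_ge N (fun q _ _ => g0 q x)).
  rewrite big_mkord (eq_bigr (fun=> S%:E)); last first.
    by move=> q _; rewrite /g indicE mem_set ?mulr1 //; exact: Wx.
  by rewrite sumEFin lee_fin sumr_const card_ord mulr_natl.
apply: le_trans (_ : \int[mu]_(x in D) (\sum_(q <oo) g q x) <= _)%E.
  apply: integral_le_ge0 => // x Dx.
  have [[q nW]|/forallNP aW] := pselect (exists q, ~ W q x).
    have exq : exists q, `[< ~ W q x >] by exists q; apply/asboolP.
    case: (ex_minnP exq) => q0 /asboolP nW0 min.
    apply: le_trans (hW q0 x Dx nW0) _; apply: sumS => q' qq; apply: contrapT => nWq'.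
    by have := min q' (introT (asboolP _) nWq'); rewrite leqNgt qq.
  have -> : (\sum_(q <oo) g q x = +oo)%E; last exact: leey.
  apply/eqyP => A A0; apply: le_trans (sumS (Num.truncn (A / S)).+1 x _).
    by rewrite lee_fin -ler_pdivrMr //; exact/ltW/truncnS_gt.
  by move=> q _; apply: contrapT; exact: aW.
have mg q : measurable_fun D (g q).
  by apply/measurable_EFinP; apply: measurable_funM => //; exact: measurable_indic.
rewrite integral_nneseries //.
apply: lime_le; first by apply: is_cvg_nneseries => q _ _; apply: integral_ge0.
apply: nearW => n; rewrite big_mkord.
apply: le_trans (_ : \sum_(q < n) (S * pr mu (W q))%:E <= _)%E; last first.
  by rewrite sumEFin lee_fin -mulr_sumr ler_pM2l.
apply: lee_sum => q _; rewrite /g.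
under eq_integral do rewrite EFinM.
rewrite ge0_integralZl //; last 2 first.
- by apply/measurable_EFinP; exact: measurable_indic.
- by rewrite lee_fin ltW.
rewrite integral_indic // EFinM prE //.
by apply: lee_wpmul2l; [rewrite lee_fin ltW|apply: le_measure; rewrite ?inE //; exact: measurableI].
Qed.

End MeanBound.

(** * The conformal measure along branches *)

Section ConformalMeasure.
Variables (R : realType) (T : interval_map R) (phi : R -> R).
Variables (m : probability (measurableTypeR R) R) (Cd : R) (n1 : nat).
Local Notation f := (imap T).
Local Notation Z := (@br R T).
Local Notation Lam := (repeller T).
Local Notation mR := (measurableTypeR R).
Local Notation S := (birkhoff_sum T phi).
Implicit Types (i : idx T) (u v w : seq (idx T)) (A B : set mR).

Hypothesis m_dom : m (dom T) = 1%E.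
Hypothesis m_holes : m (holes T) = 0%E.
Hypothesis m_conformal : conformal T phi m.
Hypothesis a1 : bounded_distortion_potential T phi Cd.
Hypothesis n1_large :
  (((2 * n1 + 5)%:R * (Cd + 1))%:E * sup_exp_birkhoff T phi n1 < 1)%E.

Lemma m_repeller : pr m Lam = 1.
Proof.
have mI : measurable (dom T : set mR) by apply: is_interval_measurable; exact: dom_interval.
have mU : measurable (\bigcup_i Z i : set mR).
  by apply: countable_bigcupT_measurable (@idx_countable _ T) _ => i; exact: measurable_br.
have mL := @measurable_repeller R T.
have LU : Lam `<=` \bigcup_i Z i by move=> x /repeller_br [i zx]; exists i.
have UI : \bigcup_i Z i `<=` dom T by move=> x [i _ zx]; exact: br_sub zx.
have [mf [_ cmf]] := m_conformal.
have UL : m (\bigcup_i Z i `\` Lam) = 0%E.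
  rewrite cmf; [|exact: measurableD|by move=> x []].
  rewrite (_ : Lam `&` _ = set0) ?integral_set0 //.
  by apply/seteqP; split=> // x [Lx [_]].
have : pr m (dom T) = 1 by rewrite /pr m_dom.
rewrite (pr_split m mI mU) (_ : pr m (dom T `\` _) = 0); last by rewrite /pr m_holes.
rewrite addr0 (setIidr UI) (pr_split m mU mL) (_ : pr m (_ `\` _) = 0); last by rewrite /pr UL.
by rewrite addr0 (setIidr LU).
Qed.

Lemma m_step i A (b1 b2 : R) : measurable A -> A `<=` Lam `&` Z i -> 0 <= b1 ->
  (forall x, A x -> b1 <= expR (phi x) <= b2) ->
  b1 * pr m (f @` A) <= pr m A <= b2 * pr m (f @` A).
Proof.
move=> mA AZ b10 b12; have [mf [mfZ mfE]] := m_conformal.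
have mfA : mf A = m (f @` A).
  rewrite (mfZ i) //; last by move=> x /AZ[].
  by congr (m (f @` _)); apply/setIidr => x /AZ[].
have mA' : m A = (\int[mf]_(x in A) (expR (phi x))%:E)%E.
  rewrite mfE //; last by move=> x /AZ[_ zx]; exists i.
  by rewrite setIidr // => x /AZ[].
have mfi : measurable (f @` A : set mR) by apply: (@measurable_image _ _ i) => // x /AZ[].
rewrite -!lee_fin !EFinM !prE // mA' -mfA -!integral_cst //.
apply/andP; split; apply: integral_le_ge0 => x Ax; rewrite lee_fin ?expR_ge0 //;
  by have /andP[] := b12 x Ax.
Qed.

Lemma birkhoffS n x : S n.+1 x = phi x + S n (f x).
Proof.
rewrite /birkhoff_sum big_nat_recl //=; congr (_ + _); apply: eq_bigr => i _.
by rewrite -iterS iterSr.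
Qed.

Lemma Cd_gt0 : 0 < Cd. Proof. by case: a1. Qed.

Lemma expR_phi_close i x y e : Lam x -> Lam y -> Z i x -> Z i y ->
  `|f x - f y| <= e -> expR (phi x) <= (1 + Cd * e) * expR (phi y).
Proof.
move=> Lx Ly zx zy fxy; have [Cd0 /(_ 1%N (fun=> i) x y Lx Ly)] := a1.
have br1 z : Lam z -> Z i z -> branch (fun=> i) 1 z by move=> [Iz _] zz; split=> // -[|k].
move=> /(_ (br1 _ Lx zx) (br1 _ Ly zy)); rewrite /birkhoff_sum !big_nat1 /= => H.
rewrite -[X in expR X <= _](subrK (phi y)) expRD ler_pM2r ?expR_gt0 //.
have := le_trans (ler_norm _) (le_trans H (ler_wpM2l (ltW Cd0) fxy)); lra.
Qed.

Lemma cell_close (lo e a b : R) : 0 < e -> lo <= a -> lo <= b ->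
  Num.truncn ((a - lo) / e) = Num.truncn ((b - lo) / e) -> `|a - b| <= e.
Proof.
move=> e0 la lb E.
have Ha : 0 <= (a - lo) / e by rewrite divr_ge0 ?subr_ge0 // ltW.
have Hb : 0 <= (b - lo) / e by rewrite divr_ge0 ?subr_ge0 // ltW.
have /andP[a1' a2'] := truncn_itv Ha; have /andP[b1' b2'] := truncn_itv Hb.
rewrite -E in b1' b2'; move: a1' a2' b1' b2'.
rewrite !ler_pdivlMr // !ltr_pdivrMr // -natr1; set k := _%:R.
rewrite mulrDl mul1r => *; rewrite ler_norml; apply/andP; split; lra.
Qed.

Lemma le_mul_limit (p q c : R) : 0 <= q -> 0 <= c ->
  (forall e, 0 < e -> p <= (1 + c * e) ^+ 2 * q) -> p <= q.
Proof.
move=> q0 c0 H; apply/ler_addgt0Pr => z z0.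
pose e := Num.min 1 (z / (c ^+ 2 * q + 2 * c * q + 1)).
have D0 : 0 < c ^+ 2 * q + 2 * c * q + 1 by rewrite ltr_wpDl // addr_ge0 // !mulr_ge0 // exprn_ge0.
have e0 : 0 < e by rewrite lt_min ltr01 divr_gt0.
have e1 : e <= 1 by rewrite ge_min lexx.
have e2 : e * (c ^+ 2 * q + 2 * c * q + 1) <= z by rewrite -ler_pdivlMr // ge_min lexx orbT.
apply: le_trans (H e e0) _.
have : c ^+ 2 * q * e ^+ 2 <= c ^+ 2 * q * e.
  by rewrite ler_wpM2l ?mulr_ge0 ?exprn_ge0 // expr2 ger_pMr.
nra.
Qed.

(** The density of m with respect to the pull-back of m along a branch is the
    exponential of the Birkhoff sum.  Only bounds are needed, and these pass from
    one iterate to the next without any integral: cut the domain into pieces on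
    which the potential is almost constant. *)
Lemma m_iter w A (b1 b2 : R) : measurable A -> A `<=` cyl w -> 0 < b1 -> 0 < b2 ->
  (forall x, A x -> b1 <= expR (S (size w) x) <= b2) ->
  b1 * pr m (iter (size w) f @` A) <= pr m A <= b2 * pr m (iter (size w) f @` A).
Proof.
elim: w A b1 b2 => [|i w IH] A b1 b2 mA Aw b10 b20 b12.
  rewrite image_id; have [[x Ax]|/forallNP A0] := pselect (exists x, A x).
    have := b12 x Ax; rewrite /birkhoff_sum big_geq // expR0 => /andP[b1x b2x].
    by rewrite ler_piMl ?pr_ge0 // ler_peMl ?pr_ge0.
  by rewrite (_ : A = set0) ?pr0 ?mulr0 ?lexx //; apply/seteqP; split=> // x /A0.
have [M M0 domM] : exists2 M : R, 0 <= M & forall x, dom T x -> - M <= x.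
  have [M [_ HM]] := @dom_bounded _ T; exists (`|M| + 1); first by rewrite addr_ge0.
  move=> x Ix; have /(_ _ Ix) /= : globally (dom T) [set y | `|y| <= `|M| + 1].
    by apply: HM; rewrite (le_lt_trans (ler_norm M)) // ltrDl.
  by rewrite ler_norml => /andP[].
have Azi x : A x -> Lam x /\ Z i x by move=> /Aw [Lx [[zx _] _]].
have gi x : A x -> - M <= f x by move=> /Azi[_ zx]; apply: domM; exact: imap_dom zx.
have C0 := Cd_gt0.
have mfwA : measurable (iter (size w).+1 f @` A : set mR).
  exact: (@measurable_iter_image _ _ (i :: w)).
suff H e : 0 < e -> b1 * pr m (iter (size w).+1 f @` A) <= (1 + Cd * e) ^+ 2 * pr m A
    /\ pr m A <= (1 + Cd * e) ^+ 2 * (b2 * pr m (iter (size w).+1 f @` A)).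
  apply/andP; split.
    by apply: (@le_mul_limit _ _ Cd); rewrite ?pr_ge0 ?(ltW C0) // => e /H[].
  by apply: (@le_mul_limit _ _ Cd); rewrite ?mulr_ge0 ?pr_ge0 ?(ltW C0) ?(ltW b20) // => e /H[].
move=> e0; set k := 1 + Cd * e; have k0 : 0 < k by rewrite addr_gt0 // mulr_gt0.
(* Pieces on which f varies by at most e, so that exp phi varies by a factor at most k. *)
pose lab x := Num.truncn ((f x - - M) / e).
pose C l := `[(l%:R * e - M), (l.+1%:R * e - M)[%classic : set R.
pose F l : set R := A `&` f @^-1` C l.
have labC l x : A x -> C l (f x) -> lab x = l.
  move=> Ax; rewrite /C /= in_itv /= => /andP[h1 h2]; rewrite /lab; apply: truncn_def.
  by rewrite ler_pdivlMr // ltr_pdivrMr // opprK; apply/andP; split; lra.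
have mF l : measurable (F l : set mR).
  have -> : F l = A `&` (Z i `&` f @^-1` C l).
    by apply/seteqP; split=> x; [case=> Ax Cx; do 2!split=> //; have [] := Azi x Ax|case=> Ax []].
  by apply: measurableI => //; apply: measurable_br_preimage; exact: measurable_itv.
have FA l : F l `<=` A by move=> x [].
have AF : \bigcup_(l in setT) F l = A.
  apply/seteqP; split=> x; first by move=> [l _ []].
  move=> Ax; exists (lab x) => //; split=> //; rewrite /C /= in_itv /=.
  have : 0 <= (f x - - M) / e.
    by rewrite divr_ge0 ?(ltW e0) // opprK; have := gi x Ax; lra.
  move=> /truncn_itv/andP[]; rewrite -/(lab x) ler_pdivlMr // ltr_pdivrMr // opprK => h1 h2; apply/andP; split; lra.
have tF : trivIset setT F.
  by move=> l l' _ _ [x [[Ax Cx] [_ Cx']]]; rewrite -(labC l x Ax Cx) -(labC l' x Ax Cx').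
pose G l : set R := iter (size w).+1 f @` F l.
have GE : \bigcup_(l in setT) G l = iter (size w).+1 f @` A by rewrite -AF image_bigcup.
have mG l : measurable (G l : set mR).
  by apply: (@measurable_iter_image _ _ (i :: w)) => // x /FA; exact: Aw.
have tG : trivIset setT G.
  move=> l l' _ _ [_ [[x Fx <-] [x' Fx' e']]]; apply: tF => //; exists x; split=> //.
  have <- // : x' = x.
  by apply: (@iter_cyl_inj _ _ (i :: w)) => //; apply: Aw; [case: Fx'|case: Fx].
have key l : b1 / k ^+ 2 * pr m (G l) <= pr m (F l) <= k ^+ 2 * b2 * pr m (G l).
  have [[y Fy]|/forallNP F0] := pselect (exists y, F l y); last first.
    have -> : F l = set0 by apply/seteqP; split=> // x /F0.
    rewrite /G; have -> : F l = set0 by apply/seteqP; split=> // x /F0.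
    by rewrite image_set0 pr0 !mulr0 lexx.
  have close x x' : F l x -> F l x' -> expR (phi x) <= k * expR (phi x').
    move=> Fx Fx'; have [Lx zx] := Azi x (FA _ _ Fx); have [Lx' zx'] := Azi x' (FA _ _ Fx').
    apply: (expR_phi_close (i := i)) => //; apply: (@cell_close (- M) e) => //.
    - by apply: gi; case: Fx.
    - by apply: gi; case: Fx'.
    by have [[Ax Cx] [Ax' Cx']] := (Fx, Fx'); rewrite -/(lab x) -/(lab x') (labC l) // (labC l).
  set t := expR (phi y); have t0 : 0 < t by exact: expR_gt0.
  have /andP[s1 s2] : t / k * pr m (f @` F l) <= pr m (F l) <= k * t * pr m (f @` F l).
    apply: (@m_step i) => //; first by move=> x /FA /Azi.
      by rewrite divr_ge0 ?ltW.
    move=> x Fx; rewrite (close x y Fx Fy) andbT ler_pdivrMr // mulrC; exact: close.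
  have mfF : measurable (f @` F l : set mR).
    by apply: (@measurable_image _ _ i) => // x /FA /Azi[].
  have /andP[r1 r2] : b1 / (k * t) * pr m (iter (size w) f @` (f @` F l)) <= pr m (f @` F l)
     <= b2 * k / t * pr m (iter (size w) f @` (f @` F l)).
    apply: IH => //.
    - by apply: image_cylS => x /FA; exact: Aw.
    - by rewrite divr_gt0 // mulr_gt0.
    - by rewrite divr_gt0 // mulr_gt0.
    move=> _ [x Fx <-]; have /andP[] := b12 x (FA _ _ Fx).
    rewrite [size _]/= birkhoffS expRD; set q := expR (S _ _) => q1 q2.
    have q0 : 0 < q := expR_gt0 _.
    rewrite ler_pdivrMr ?mulr_gt0 // ler_pdivlMr //.
    have c1 := close x y Fx Fy; have c2 := close y x Fy Fx; rewrite -/t in c1 c2.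
    apply/andP; split.
      by apply: le_trans q1 _; rewrite mulrC ler_pM2l.
    rewrite mulrC; apply: le_trans (_ : k * expR (phi x) * q <= _); first by rewrite ler_pM2r.
    by rewrite -mulrA mulrC ler_pM2r.
  rewrite /G image_iterS; set g := pr m (iter _ _ @` _) in r1 r2 *.
  apply/andP; split.
    apply: le_trans s1; have -> : b1 / k ^+ 2 * g = t / k * (b1 / (k * t) * g).
      by field; rewrite !gt_eqF.
    by rewrite ler_pM2l // divr_gt0.
  apply: le_trans s2 _; have -> : k ^+ 2 * b2 * g = k * t * (b2 * k / t * g).
    by field; rewrite !gt_eqF.
  by rewrite ler_pM2l // mulr_gt0.
split.
  rewrite -GE -{1}AF -ler_pdivlMl // mulrA; apply: (@pr_countable_le _ _ _ _ _ _ id) => //.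
    by rewrite mulr_ge0 ?exprn_ge0 // ltW // ?invr_gt0.
  move=> l _; have /andP[+ _] := key l; rewrite -ler_pdivlMl ?divr_gt0 ?exprn_gt0 //.
  by rewrite invf_div [_ / b1]mulrC.
rewrite -GE -{1}AF mulrA; apply: (@pr_countable_le _ _ _ _ _ _ id) => //.
  by rewrite mulr_ge0 ?exprn_ge0 // ltW.
by move=> l _; have /andP[] := key l.
Qed.

Lemma birkhoff_distortion : exists2 K : R, 0 < K & forall w x y, cyl w x -> cyl w y ->
  expR (S (size w) x) <= K * expR (S (size w) y).
Proof.
have [M [_ HM]] := @dom_bounded _ T.
have C0 := Cd_gt0.
exists (1 + Cd * ((`|M| + 1) *+ 2)).
  by rewrite addr_gt0 // mulr_gt0 // mulrn_wgt0 // ltr_wpDl.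
move=> w x y wx wy; have [_ /(_ (size w) (nth point w) x y)] := a1.
move=> /(_ wx.1 wy.1 (cyl_branch wx) (cyl_branch wy)) H.
rewrite -[X in expR X <= _](subrK (S (size w) y)) expRD ler_pM2r ?expR_gt0 //.
have dM z : dom T z -> `|z| <= `|M| + 1.
  move=> Iz; have /(_ _ Iz) // : globally (dom T) [set y | `|y| <= `|M| + 1].
  by apply: HM; rewrite (le_lt_trans (ler_norm M)) // ltrDl.
have Ix := dM _ (repeller_iter (size w) wx.1).1; have Iy := dM _ (repeller_iter (size w) wy.1).1.
have := le_trans (ler_normB (iter (size w) f x) (iter (size w) f y)) (lerD Ix Iy).
rewrite -mulr2n => D.
have := le_trans (ler_norm _) (le_trans H (ler_wpM2l (ltW C0) D)); lra.
Qed.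

(** On a cylinder the density of m with respect to its pull-back is constant up to
    a factor.  The comparison is multiplied out because the masses may vanish. *)
Lemma m_distortion : exists2 K : R, 0 < K & forall w A, measurable A -> A `<=` cyl w ->
  pr m A * pr m (follow w) <= K * (pr m (cyl w) * pr m (iter (size w) f @` A)) /\
  pr m (cyl w) * pr m (iter (size w) f @` A) <= K * (pr m A * pr m (follow w)).
Proof.
have [K K0 HK] := birkhoff_distortion; exists (K ^+ 2); first exact: exprn_gt0.
move=> w A mA Aw; have [[x wx]|/forallNP w0] := pselect (exists x, cyl w x); last first.
  have -> : A = set0 by apply/seteqP; split=> // x /Aw /w0.
  have -> : cyl w = set0 by apply/seteqP; split=> // x /w0.
  by rewrite image_set0 pr0 !(mul0r, mulr0).
set b := expR (S (size w) x); have b0 : 0 < b := expR_gt0 _.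
have B y : cyl w y -> b / K <= expR (S (size w) y) <= K * b.
  by move=> wy; rewrite (HK _ _ _ wy wx) andbT ler_pdivrMr // mulrC; exact: HK.
have bK : 0 < b / K by rewrite divr_gt0.
have Kb : 0 < K * b by rewrite mulr_gt0.
have /andP[c1 c2] := m_iter (@measurable_cyl _ _ w) (@subset_refl _ _) bK Kb B.
have /andP[A1 A2] := m_iter mA Aw bK Kb (fun y Ay => B y (Aw y Ay)).
rewrite -/(follow w) in c1 c2; set F := pr m (follow w) in c1 c2 *.
set G := pr m (iter _ _ @` _) in A1 A2 *.
have F0 : 0 <= F := pr_ge0 _ _; have G0 : 0 <= G := pr_ge0 _ _.
have e : K ^+ 2 * (b / K) = K * b by field; rewrite gt_eqF.
split.
  apply: le_trans (ler_wpM2r F0 A2) _.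
  have -> : K * b * G * F = K ^+ 2 * (b / K * F * G) by rewrite -e; ring.
  by rewrite ler_pM2l ?exprn_gt0 // ler_wpM2r.
apply: le_trans (ler_wpM2r G0 c2) _.
have -> : K * b * F * G = K ^+ 2 * (b / K * G * F) by rewrite -e; ring.
by rewrite ler_pM2l ?exprn_gt0 // ler_wpM2r.
Qed.

Lemma birkhoff_cat n p x : S (n + p) x = S n x + S p (iter n f x).
Proof.
elim: n x => [|n IH] x; first by rewrite {2}/birkhoff_sum big_geq // add0r.
by rewrite addSn !birkhoffS IH addrA iterSr.
Qed.

Lemma expR_birkhoff_le k x : Lam x -> expR (S (k * n1) x) <= 2 ^- k.
Proof.
have H x' : Lam x' -> expR (S n1 x') <= 2^-1.
  move=> Lx; have C0 := Cd_gt0.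
  have := n1_large; set c := (2 * n1 + 5)%:R * (Cd + 1) => n1l.
  have c2 : 2 <= c.
    have h : (5 : R) <= (2 * n1 + 5)%:R by rewrite (ler_nat R 5); lia.
    rewrite /c; nra.
  have : (c%:E * (expR (S n1 x'))%:E < 1)%E.
    apply: le_lt_trans n1l; apply: lee_wpmul2l; first by rewrite lee_fin; lra.
    by apply: ereal_sup_ubound; exists x'.
  rewrite -EFinM lte_fin => h; have e0 := expR_gt0 (S n1 x'); nra.
elim: k x => [|k IH] x Lx; first by rewrite mul0n /birkhoff_sum big_geq // expR0 expr0 invr1.
rewrite mulSn birkhoff_cat expRD exprS invfM ler_pM ?expR_ge0 //; first exact: H.
by apply: IH; exact: repeller_iter.
Qed.

(** Each block of n1 iterates multiplies the density by at most 1/2. *)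
Lemma m_decay k w : (k * n1 <= size w)%N -> pr m (cyl w) <= 2 ^- k.
Proof.
move=> kw; set v := take (k * n1) w.
have sv : size v = (k * n1)%N by rewrite size_take; case: ltngtP kw => // ->.
have sub : cyl w `<=` cyl v by rewrite -(cat_take_drop (k * n1) w) cyl_cat => x [].
apply: le_trans (pr_le _ (measurable_cyl _) (measurable_cyl _) sub) _.
have p2 : (0 : R) < 2 ^- k by rewrite invr_gt0 exprn_gt0.
have [[x wx]|/forallNP w0] := pselect (exists x, cyl v x); last first.
  by rewrite (_ : cyl v = set0) ?pr0 ?ltW //; apply/seteqP; split=> // x /w0.
have [K K0 HK] := birkhoff_distortion.
have /andP[_] : expR (S (size v) x) / K * pr m (follow v) <= pr m (cyl v) <= 2 ^- k * pr m (follow v).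
  apply: m_iter => //; [exact: measurable_cyl|by rewrite divr_gt0 ?expR_gt0|].
  move=> y wy; rewrite ler_pdivrMr // mulrC HK //=.
  by rewrite sv expR_birkhoff_le //; case: wy.
move=> h; apply: le_trans h _; rewrite ler_piMr ?(ltW p2) // pr_le1 //.
exact: measurable_follow.
Qed.

End ConformalMeasure.

(** * The symbolic measure read on the interval *)

Section SymbolicLift.
Variables (R : realType) (T : interval_map R).
Variables (m mu : probability (measurableTypeR R) R) (mut : probability (coding_space T) R).
Local Notation f := (imap T).
Local Notation Z := (@br R T).
Local Notation Lam := (repeller T).
Local Notation mR := (measurableTypeR R).
Local Notation Sig := (@shift_space R T).
Implicit Types (i : idx T) (u v w : seq (idx T)) (A B : set mR) (s : nat -> idx T).

Hypothesis m_rep : pr m Lam = 1.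
Hypothesis m_nonatomic : nonatomic m.
Hypothesis mu_invariant : imap_invariant T mu.
Hypothesis mu_ac : mu `<< m.
Hypothesis mut_lift : symbolic_lift mu mut.

Lemma pr_null A : measurable A -> pr m A = 0 -> pr mu A = 0.
Proof.
move=> mA A0; rewrite /pr; have /null_content_dominatesP ac := mu_ac.
by rewrite (ac A mA) //; apply: etrans (esym (prE m mA)) _; rewrite A0.
Qed.

Lemma mu_repeller : pr mu Lam = 1.
Proof.
have mL := @measurable_repeller R T.
have pT (nu : probability mR R) : pr nu setT = 1 by rewrite /pr probability_setT.
have := pr_split m (@measurableT _ mR) mL; rewrite pT setTI m_rep => H.
have := pr_split mu (@measurableT _ mR) mL; rewrite pT setTI => ->.
rewrite (_ : pr mu (_ `\` _) = 0) ?addr0 //; apply: pr_null; first exact: measurableD.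
lra.
Qed.

Lemma mu_iter_invariant n A : measurable A -> pr mu (Lam `&` iter n f @^-1` A) = pr mu A.
Proof.
have mL := @measurable_repeller R T.
elim: n A => [|n IH] A mA /=.
  rewrite [RHS](pr_split _ mA mL) [X in _ + X](_ : _ = 0) ?addr0 1?setIC //.
  exact: pr_full mu_repeller.
rewrite -[RHS](IH A mA) /pr -(mu_invariant (measurable_iter_preimage T n mA)).
congr (fine (mu _)); apply/seteqP; split=> x [Lx] /=.
  by rewrite -iterS iterSr => Ax; do 2!split=> //; exact: repeller_f.
by rewrite -iterS iterSr => -[].
Qed.

Lemma countable_words : countable [set: seq (idx T)].
Proof. by apply/countable_injP; exists (@label R T) => u v _ _; exact: label_inj. Qed.

Lemma measurable_bigcup_words d (X : sigmaRingType d) (D : set (seq (idx T)))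
    (F : seq (idx T) -> set X) : (forall w, D w -> measurable (F w)) ->
  measurable (\bigcup_(w in D) F w).
Proof.
move=> mF; rewrite bigcup_mkcond; apply: countable_bigcupT_measurable countable_words _ => w.
by case: ifPn => // /set_mem; exact: mF.
Qed.

(** The points with several codes: their orbits meet a common end-point of two branches. *)
Definition ambiguous : set R :=
  \bigcup_(w in [set w : seq (idx T) | size w = 2 /\ nth point w 0 <> nth point w 1])
    \bigcup_k (Lam `&` iter k f @^-1` (Z (nth point w 0) `&` Z (nth point w 1))).

Let mZZ i j : measurable (Z i `&` Z j : set mR).
Proof. by apply: measurableI; exact: measurable_br. Qed.

Lemma measurable_ambiguous : measurable (ambiguous : set mR).
Proof.
apply: measurable_bigcup_words => w _; apply: bigcupT_measurable => k.
exact: measurable_iter_preimage.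
Qed.

(** The ambiguous points are countably many preimages of single points, and
    invariance reduces their mass to that of the points themselves. *)
Lemma mu_ambiguous : mu ambiguous = 0%E.
Proof.
apply/eqP; rewrite -measure_le0.
have -> : ambiguous = \bigcup_n (\bigcup_(w in [set w : seq (idx T) | [/\ size w = 2, nth point w 0 <> nth point w 1 & label w = n]])
    \bigcup_k (Lam `&` iter k f @^-1` (Z (nth point w 0) `&` Z (nth point w 1)))).
  apply/seteqP; split=> x.
    by move=> [w [w2 w01] xw]; exists (label w) => //; exists w.
  by move=> [n _ [w [w2 w01 _] xw]]; exists w.
apply: le_trans (measure_sigma_subadditive _ _ _ (@subset_refl _ _)) _.
- move=> n; apply: measurable_bigcup_words => w _; apply: bigcupT_measurable => k.
  exact: measurable_iter_preimage.
- apply: bigcupT_measurable => n; apply: measurable_bigcup_words => w _; apply: bigcupT_measurable => k.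
  exact: measurable_iter_preimage.
rewrite eseries0 // => n _ _.
set D := (X in \bigcup_(w in X) _).
have [[w [w2 w01 wn]]|/forallNP noD] := pselect (exists w, D w); last first.
  rewrite (_ : bigcup _ _ = set0) ?measure0 //.
  by apply/seteqP; split=> // x [w /noD].
have -> : D = [set w].
  apply/seteqP; split=> w'; last by move=> ->.
  by move=> [_ _ w'n]; apply: (@label_inj R T); rewrite wn.
rewrite bigcup_set1; apply/eqP; rewrite -measure_le0.
apply: le_trans (measure_sigma_subadditive _ _ _ (@subset_refl _ _)) _.
- by move=> k; exact: measurable_iter_preimage.
- by apply: bigcupT_measurable => k; exact: measurable_iter_preimage.
rewrite eseries0 // => k _ _.
set i := nth point w 0 in w01 *; set j := nth point w 1 in w01 *.
rewrite -[LHS](prE mu (measurable_iter_preimage T k (@mZZ i j))).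
rewrite mu_iter_invariant //; congr EFin; apply: pr_null => //.
have [[x [ix jx]]|/forallNP no] := pselect (exists x, (Z i `&` Z j) x); last first.
  by rewrite (_ : _ `&` _ = set0) ?pr0 //; apply/seteqP; split=> // x /no.
suff -> : Z i `&` Z j = [set x] by rewrite /pr m_nonatomic.
apply/seteqP; split=> y; last by move=> ->.
move=> [iy jy]; have [xy|yx|//] := ltgtP x y; exfalso; apply: w01.
  exact: (br_two_points xy).
exact: (br_two_points yx).
Qed.

Lemma codingP s : Sig s -> codes s (coding s).
Proof. by move=> [x sx]; apply: (@xgetI _ 0 [set x | codes s x] x). Qed.

Lemma codes_branch s n x : codes s x -> branch s n x.
Proof. by move=> [[Ix _] sx]; split. Qed.

Lemma branch_mkseq s n x : branch (nth point (mkseq s n)) n x <-> branch s n x.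
Proof.
split=> -[Ix H]; split=> // k kn; have := H k kn; by rewrite nth_mkseq.
Qed.

Lemma measurable_word_cylinder w : measurable (word_cylinder w : set (coding_space T)).
Proof. by apply: sub_sigma_algebra; exists w. Qed.

Lemma word_cylinder_nil : word_cylinder [::] = Sig.
Proof. by apply/seteqP; split=> s; [case|split]. Qed.

Lemma measurable_shift_space : measurable (Sig : set (coding_space T)).
Proof. by rewrite -word_cylinder_nil; exact: measurable_word_cylinder. Qed.

Lemma measurable_code1 s : Sig s -> measurable ([set s] : set (coding_space T)).
Proof.
move=> Ss; rewrite (_ : [set s] = \bigcap_n word_cylinder (mkseq s n)).
  by apply: bigcapT_measurable => n; exact: measurable_word_cylinder.
apply/seteqP; split=> t; first by move=> -> n _; split=> //; rewrite size_mkseq.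
move=> H; apply: funext => k; have [_] := H k.+1 I; rewrite size_mkseq.
by move=> /(congr1 (fun w => nth point w k)); rewrite !nth_mkseq.
Qed.

(** The coding map is measurable: it is below a on the cylinders that lie below a
    and on at most one more sequence, the one whose cylinders straddle a. *)
Lemma measurable_coding A : measurable A ->
  measurable (Sig `&` (@coding _ T) @^-1` A : set (coding_space T)).
Proof.
have mS := measurable_shift_space.
apply: (borel_ind (C := fun A => measurable (Sig `&` (@coding _ T) @^-1` A : set (coding_space T)))).
- move=> a.
  pose D := [set w : seq (idx T) | forall x, branch (nth point w) (size w) x -> x < a].
  pose P := [set s | [/\ Sig s, coding s < a & forall n, ~ D (mkseq s n)]].
  have -> : Sig `&` @coding _ T @^-1` `]-oo, a[%classic = \bigcup_(w in D) word_cylinder w `|` P.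
    apply/seteqP; split=> s.
      move=> [Ss]; rewrite /= in_itv /= => sa.
      have [[n Dn]|/forallNP no] := pselect (exists n, D (mkseq s n)); last by right.
      by left; exists (mkseq s n) => //; split=> //; rewrite size_mkseq.
    case=> [[w Dw [Ss sw]]|[Ss sa _]]; split=> //; rewrite /= in_itv //=.
    apply: Dw; rewrite -{1}sw; apply/branch_mkseq; exact/codes_branch/codingP.
  apply: measurableU.
    by apply: measurable_bigcup_words => w _; exact: measurable_word_cylinder.
  have P1 s t : P s -> P t -> s = t.
    move=> [Ss sa nDs] [St ta nDt]; apply: funext => k.
    have get r : Sig r -> (forall n, ~ D (mkseq r n)) -> exists2 z, a <= z & branch r k.+1 z.
      move=> Sr /(_ k.+1) /existsNP [z /not_implyP [bz za]].
      exists z; first by rewrite leNgt; apply/negP.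
      by apply/branch_mkseq; rewrite size_mkseq in bz.
    have [z az bz] := get s Ss nDs; have [z' az' bz'] := get t St nDt.
    set x := coding s in sa; set y := coding t in ta.
    have bx : branch s k.+1 x := codes_branch _ (codingP Ss).
    have b_y : branch t k.+1 y := codes_branch _ (codingP St).
    pose c := Num.max x y.
    have ca : c < a by rewrite gt_max sa.
    have inn (r : nat -> idx T) (p q e : R) : branch r k.+1 p -> branch r k.+1 q ->
        p <= e -> e < q -> branch r k.+1 e.
      by move=> bp bq pe eq; apply: (branch_itv bp bq); rewrite pe ltW.
    have xc : x <= c by rewrite le_max lexx.
    have yc : y <= c by rewrite le_max lexx orbT.
    have cm : c < (c + a) / 2 by lra.
    apply: (branch_two_points cm _ _ _ _ (ltnSn k)).
    - by apply: (inn s x z) => //; lra.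
    - by apply: (inn s x z) => //; lra.
    - by apply: (inn t y z') => //; lra.
    - by apply: (inn t y z') => //; lra.
  have [[s Ps]|/forallNP P0] := pselect (exists s, P s).
    have -> : P = [set s] by apply/seteqP; split=> t; [move=> Pt; exact: P1|move=> ->].
    by apply: measurable_code1; case: Ps.
  by rewrite (_ : P = set0) //; apply/seteqP; split=> // s /P0.
- move=> B mB; have -> : Sig `&` @coding _ T @^-1` (~` B) = Sig `\` (Sig `&` @coding _ T @^-1` B).
    by apply/seteqP; split=> s; [move=> [Ss nB]; split=> // -[]|move=> [Ss nB]; split=> // Bs; apply: nB].
  exact: measurableD.
- by move=> F mF; rewrite preimage_bigcup setI_bigcupr; exact: bigcupT_measurable.
Qed.

Lemma codes_unique s x k : codes s x -> ~ ambiguous x -> s k = code T (iter k f x).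
Proof.
move=> [Lx sx] nE; apply: contrapT => ne; apply: nE.
exists [:: s k; code T (iter k f x)] => //; exists k => //=.
split=> //; split; first exact: sx.
exact: code_br (sx k).
Qed.

(** The ambiguous points being null, a set of sequences and a set of points that
    correspond to each other elsewhere have the same mass. *)
Lemma mut_mu (S : set (coding_space T)) A : measurable S -> measurable A -> S `<=` Sig ->
  (forall s, Sig s -> ~ ambiguous (coding s) -> S s <-> A (coding s)) ->
  fine (mut S) = pr mu A.
Proof.
move=> mS mA SS SA; have [_ lift] := mut_lift.
have mE := measurable_ambiguous.
pose N := Sig `&` @coding _ T @^-1` ambiguous.
have mN : measurable (N : set (coding_space T)) by exact: measurable_coding.
have mA' := measurable_coding mA.
have N0 : pr mut N = 0 by rewrite /pr -lift // mu_ambiguous.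
have z (B : set (coding_space T)) : measurable B -> pr mut (B `&` N) = 0.
  move=> mB; apply/eqP; rewrite eq_le pr_ge0 andbT -N0.
  by apply: pr_le => //; exact: measurableI.
transitivity (pr mut (Sig `&` @coding _ T @^-1` A)); last by rewrite /pr lift.
rewrite -/(pr mut S) (pr_split _ mS mN) [RHS](pr_split _ mA' mN) !z // !add0r; congr pr.
apply/seteqP; split=> s [] => [Ss nN|[Ss As] nN].
  split=> //; split; first exact: SS.
  by apply/SA => //; [exact: SS|move=> h; apply: nN; split=> //; exact: SS].
by split=> //; apply/SA => // h; apply: nN.
Qed.

Lemma mkseq_codes s x n : codes s x -> ~ ambiguous x -> mkseq s n = itin T n x.
Proof.
move=> sx nE; apply: (@eq_from_nth _ point); rewrite size_mkseq ?size_itin // => k kn.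
by rewrite nth_mkseq // nth_itin // (codes_unique _ sx).
Qed.

Lemma word_massE w : word_mass mut w = pr mu (cyl w).
Proof.
apply: mut_mu; [exact: measurable_word_cylinder|exact: measurable_cyl|by move=> s []|].
move=> s Ss nE; have sx := codingP Ss.
split=> [[_ sw]|/cylP [_ iw]]; last by split=> //; rewrite (mkseq_codes _ sx).
by apply/cylP; split; [case: sx|rewrite -(mkseq_codes _ sx)].
Qed.

Lemma admissible_cyl w : cyl w !=set0 -> admissible w.
Proof.
move=> [x /cylP [Lx iw]]; exists (fun k => code T (iter k f x)); split.
  exists x; split=> // k; have [i zx] := repeller_br (repeller_iter k Lx); exact: code_br zx.
rewrite -[RHS]iw; apply: (@eq_from_nth _ point); rewrite size_mkseq ?size_itin // => k kn.
by rewrite nth_mkseq // nth_itin.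
Qed.

Lemma admissible_drop u v : admissible (u ++ v) -> admissible v.
Proof.
move=> [s [[x [Lx sx]] suv]]; exists (fun k => s (size u + k)%N); split.
  exists (iter (size u) f x); split; first exact: repeller_iter.
  by move=> n; rewrite -iterD addnC; exact: sx.
apply: (@eq_from_nth _ point); rewrite size_mkseq // => k kv.
rewrite nth_mkseq //; move: suv => /(congr1 (fun w => nth point w (size u + k))).
by rewrite nth_mkseq ?size_cat ?ltn_add2l // nth_cat ltnNge leq_addr /= addKn.
Qed.

Lemma admissible_take u v : admissible (u ++ v) -> admissible u.
Proof.
move=> [s [Ss suv]]; exists s; split=> //.
apply: (@eq_from_nth _ point); rewrite size_mkseq // => k ku.
rewrite nth_mkseq //; move: suv => /(congr1 (fun w => nth point w k)).
by rewrite nth_mkseq ?size_cat ?ltn_addr // nth_cat ku.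
Qed.

Lemma word_gap_massE u v j :
  fine (mut (\bigcup_(y in [set y | size y = j /\ admissible (u ++ y ++ v)])
                    word_cylinder (u ++ y ++ v))) =
  pr mu (cyl u `&` iter (size u + j) f @^-1` cyl v).
Proof.
have E : cyl u `&` iter (size u + j) f @^-1` cyl v = cyl u `&` (Lam `&` iter (size u + j) f @^-1` cyl v).
  by rewrite setIA; congr (_ `&` _); apply/esym/setIidPl => x [].
apply: mut_mu.
- by apply: measurable_bigcup_words => y _; exact: measurable_word_cylinder.
- by rewrite E; apply: measurableI; [exact: measurable_cyl|apply: measurable_iter_preimage; exact: measurable_cyl].
- by move=> s [y _ []].
move=> s Ss nE; have sx := codingP Ss; have [Lx _] := sx.
split.
  move=> [y [yj _] [_ suv]].
  have : cyl (u ++ y ++ v) (coding s) by apply/cylP; split=> //; rewrite -(mkseq_codes _ sx).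
  by rewrite catA !cyl_cat size_cat yj => -[[]].
rewrite E => -[ux [_ vx]]; set x := coding s in sx nE ux vx Lx *.
have uyv : cyl (u ++ itin T j (iter (size u) f x) ++ v) x.
  rewrite catA cyl_cat size_cat size_itin; split=> //; rewrite cyl_cat; split=> //.
  by apply: cyl_itin; exact: repeller_iter.
exists (itin T j (iter (size u) f x)).
  by split; [rewrite size_itin|apply: admissible_cyl; exists x].
by split=> //; case/cylP: uyv => _; rewrite -(mkseq_codes _ sx).
Qed.

Hypothesis a5 : quasi_bernoulli mut.
Hypothesis a6 : psi_mixing mut.

(** Division by 0 gives 0, so on a word of mass 0 the mixing ratio would deviate
    from 1 by 1 at every gap, which the decay of gamma excludes. *)
Lemma admissible_gt0 w : admissible w -> 0 < pr mu (cyl w).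
Proof.
move=> aw; rewrite lt_neqAle pr_ge0 andbT eq_sym; apply/negP => /eqP w0.
have [gamma [g0 H]] := a6.
have g1 j : 1 <= gamma j.
  have := H w w j aw aw; rewrite !word_massE w0 mulr0 invr0 mulr0 sub0r normrN1.
  by [].
have : 1 <= limn gamma.
  by apply: limr_ge; [apply/cvg_ex; exists 0|apply: nearW].
by rewrite (cvg_lim _ g0) // ler10.
Qed.

(** Any gap j with gamma j at most 1/2 will do. *)
Lemma mu_supermixing : exists j, forall u v, admissible u -> admissible v ->
  2^-1 * (pr mu (cyl u) * pr mu (cyl v)) <=
    pr mu (cyl u `&` iter (size u + j) f @^-1` cyl v).
Proof.
have [gamma [g0 H]] := a6.
have /cvgrPdist_le /(_ 2^-1) := g0; rewrite invr_gt0 ltr0n => /(_ isT) [j _ /(_ j (leqnn j)) /=].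
rewrite sub0r normrN => gj; exists j => u v au av.
have := le_trans (H u v j au av) (le_trans (ler_norm _) gj).
rewrite word_gap_massE !word_massE; set p := pr mu _ * _ => h.
have p0 : 0 < p by rewrite mulr_gt0 // admissible_gt0.
move: h; rewrite ler_norml => /andP[h _]; rewrite -ler_pdivlMr //; lra.
Qed.

Lemma mu_quasi_bernoulli : exists2 C : R, 1 < C &
  (forall u v, pr mu (cyl (u ++ v)) <= C * (pr mu (cyl u) * pr mu (cyl v))) /\
  (forall u v, admissible (u ++ v) ->
     pr mu (cyl u) * pr mu (cyl v) <= C * pr mu (cyl (u ++ v))).
Proof.
have [C [C1 H]] := a5; exists C => //; have C0 : 0 < C by exact: lt_trans C1.
have H' u v : admissible (u ++ v) ->
    C^-1 * pr mu (cyl u) * pr mu (cyl v) <= pr mu (cyl (u ++ v)) <= C * pr mu (cyl u) * pr mu (cyl v).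
  by move=> auv; rewrite -!word_massE; apply: H => //; [exact: admissible_take auv|exact: admissible_drop auv].
split=> u v.
  have [auv|nuv] := pselect (cyl (u ++ v) !=set0).
    by have /andP[_] := H' u v (admissible_cyl auv); rewrite mulrA.
  rewrite (_ : cyl (u ++ v) = set0) ?pr0 ?mulr_ge0 ?pr_ge0 ?(ltW C0) //.
  by apply/seteqP; split=> // x ux; apply: nuv; exists x.
by move=> auv; have /andP[+ _] := H' u v auv; rewrite -mulrA ler_pdivrMl.
Qed.

End SymbolicLift.

(** * Unions of cylinders *)

Section WordSets.
Variables (R : realType) (T : interval_map R).
Local Notation f := (imap T).
Local Notation Lam := (repeller T).
Local Notation mR := (measurableTypeR R).
Implicit Types (i : idx T) (u v w : seq (idx T)) (P Q : set (seq (idx T))) (A B : set mR).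
Implicit Types nu : probability mR R.

(** Unions of n-cylinders are coded by sets of words, so that passing to longer
    cylinders, to complements or to preimages is an operation on words. *)
Definition cyls n P : set R := [set x | Lam x /\ P (itin T n x)].

Definition back n B : set R := Lam `&` iter n f @^-1` B.

Lemma measurable_back n B : measurable B -> measurable (back n B : set mR).
Proof. exact: measurable_iter_preimage. Qed.

Lemma cyl_back w n B : cyl w `&` iter n f @^-1` B = cyl w `&` back n B.
Proof. by rewrite setIA; congr (_ `&` _); apply/esym/setIidPl => x []. Qed.

Lemma back_back n k B : back n (back k B) = back (n + k) B.
Proof.
apply/seteqP; split=> x [Lx] /=; first by move=> [_ Bx]; split=> //; rewrite /preimage /= addnC iterD.
move=> Bx; split=> //; split; first exact: repeller_iter.
by move: Bx; rewrite /preimage /= addnC iterD.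
Qed.

Lemma back_bigcup n (D : set (seq (idx T))) (F : seq (idx T) -> set R) :
  back n (\bigcup_(w in D) F w) = \bigcup_(w in D) back n (F w).
Proof. by rewrite /back preimage_bigcup setI_bigcupr. Qed.

Lemma cylsE n P : cyls n P = \bigcup_(w in [set w | size w = n /\ P w]) cyl w.
Proof.
apply/seteqP; split=> x.
  move=> [Lx Px]; exists (itin T n x); last exact: cyl_itin.
  by split=> //; exact: size_itin.
by move=> [w [sw Pw] /cylP [Lx iw]]; split=> //; rewrite -sw iw.
Qed.

Lemma measurable_cyls n P : measurable (cyls n P : set mR).
Proof. by rewrite cylsE; apply: measurable_bigcup_words => w _; exact: measurable_cyl. Qed.

Lemma trivIset_cyl n P : trivIset [set w | size w = n /\ P w] (@cyl R T).
Proof.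
move=> u v [un _] [vn _] [x [/cylP [_ ux] /cylP [_ vx]]].
by rewrite -ux -vx un vn.
Qed.

Lemma cyls1 w : cyls (size w) [set w] = cyl w.
Proof. by apply/seteqP; split=> x; [move=> h; apply/cylP|move=> /cylP]. Qed.

Lemma cylsI n P Q : cyls n P `&` cyls n Q = cyls n (P `&` Q).
Proof. by apply/seteqP; split=> x; [move=> [[Lx Px] [_ Qx]]|move=> [Lx [Px Qx]]]. Qed.

Lemma take_itin n k x : take n (itin T (n + k) x) = itin T n x.
Proof. by rewrite itin_cat take_size_cat ?size_itin. Qed.

Lemma drop_itin n k x : drop n (itin T (n + k) x) = itin T k (iter n f x).
Proof. by rewrite itin_cat drop_size_cat ?size_itin. Qed.

Lemma cyls_back n k P : back n (cyls k P) = cyls (n + k) [set w | P (drop n w)].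
Proof.
apply/seteqP; split=> x [Lx].
  by move=> [_ Px]; split=> //=; rewrite drop_itin.
rewrite /= drop_itin => Px; split=> //; split=> //; exact: repeller_iter.
Qed.

Lemma cyls_refine n k P : cyls n P = cyls (n + k) [set w | P (take n w)].
Proof.
by apply/seteqP; split=> x [Lx Px]; split=> //; move: Px; rewrite /= take_itin.
Qed.

Lemma cylsI_back n k P Q :
  cyls n P `&` back n (cyls k Q) = cyls (n + k) [set w | P (take n w) /\ Q (drop n w)].
Proof. by rewrite (cyls_refine n k) cyls_back cylsI. Qed.

Lemma cylsC n P : Lam `\` cyls n P = cyls n (~` P).
Proof.
apply/seteqP; split=> x [Lx nx]; split=> //; first by move=> Px; apply: nx.
by move=> [_].
Qed.

Lemma decoupling_le nu (c : R) g n k P Q : 0 <= c ->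
  (forall u v, size u = n -> size v = k ->
     pr nu (cyl u `&` back g (cyl v)) <= c * (pr nu (cyl u) * pr nu (cyl v))) ->
  pr nu (cyls n P `&` back g (cyls k Q)) <= c * (pr nu (cyls n P) * pr nu (cyls k Q)).
Proof.
move=> c0 H.
have H1 u : size u = n -> pr nu (cyl u `&` back g (cyls k Q)) <= c * pr nu (cyls k Q) * pr nu (cyl u).
  move=> un; rewrite [X in back g X]cylsE back_bigcup setI_bigcupr.
  rewrite -mulrA [pr nu (cyls _ _) * _]mulrC mulrA cylsE.
  apply: (pr_countable_le (@label_inj R T)).
  - by rewrite mulr_ge0 ?pr_ge0.
  - by move=> v; apply: measurableI; [exact: measurable_cyl|by apply: measurable_back; exact: measurable_cyl].
  - by move=> v; exact: measurable_cyl.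
  - exact: trivIset_cyl.
  by move=> v [vk _]; rewrite -mulrA; exact: H.
rewrite [pr nu (cyls n P) * _]mulrC mulrA (cylsE n P) setI_bigcupl.
apply: (pr_countable_le (@label_inj R T)).
- by rewrite mulr_ge0 ?pr_ge0.
- by move=> v; apply: measurableI; [exact: measurable_cyl|by apply: measurable_back; exact: measurable_cyls].
- by move=> v; exact: measurable_cyl.
- exact: trivIset_cyl.
by move=> u [un _]; exact: H1.
Qed.

Lemma decoupling_ge nu (c : R) g n k P Q : 0 <= c ->
  (forall u v, size u = n -> size v = k ->
     c * (pr nu (cyl u) * pr nu (cyl v)) <= pr nu (cyl u `&` back g (cyl v))) ->
  c * (pr nu (cyls n P) * pr nu (cyls k Q)) <= pr nu (cyls n P `&` back g (cyls k Q)).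
Proof.
move=> c0 H.
have H1 u : size u = n -> c * pr nu (cyls k Q) * pr nu (cyl u) <= pr nu (cyl u `&` back g (cyls k Q)).
  move=> un; rewrite [X in back g X]cylsE back_bigcup setI_bigcupr.
  rewrite -mulrA [pr nu (cyls _ _) * _]mulrC mulrA cylsE.
  apply: (pr_countable_ge (@label_inj R T)).
  - by rewrite mulr_ge0 ?pr_ge0.
  - by move=> v; apply: measurableI; [exact: measurable_cyl|by apply: measurable_back; exact: measurable_cyl].
  - by move=> v; exact: measurable_cyl.
  - move=> v v' Pv Pv' [x [[_ [_ vx]] [_ [_ vx']]]]; apply: (trivIset_cyl Pv Pv').
    by exists (iter g f x).
  by move=> v [vk _]; rewrite -mulrA; exact: H.
rewrite [pr nu (cyls n P) * _]mulrC mulrA (cylsE n P) setI_bigcupl.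
apply: (pr_countable_ge (@label_inj R T)).
- by rewrite mulr_ge0 ?pr_ge0.
- by move=> v; apply: measurableI; [exact: measurable_cyl|by apply: measurable_back; exact: measurable_cyls].
- by move=> v; exact: measurable_cyl.
- move=> v v' Pv Pv' [x [[vx _] [vx' _]]]; apply: (trivIset_cyl Pv Pv').
  by exists x.
by move=> u [un _]; exact: H1.
Qed.

(** An interval is approximated from outside and from inside by unions of
    n-cylinders, with an error of two cylinders, which is small for n large. *)
Lemma interval_cyls n B : is_interval B ->
  exists v1 v2, [/\ size v1 = n, size v2 = n,
    Lam `&` B `<=` cyls n [set v | cyl v `&` B !=set0],
    cyls n [set v | cyl v `&` B !=set0] `<=` (Lam `&` B) `|` (cyl v1 `|` cyl v2) &
    Lam `&` B `<=` cyls n [set v | cyl v !=set0 /\ cyl v `<=` B] `|` (cyl v1 `|` cyl v2)].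
Proof.
move=> iB; have [v1 [v2 [s1 s2 H]]] := @cut_cylinders R T B n iB.
exists v1, v2; split=> // x [Lx].
- by move=> Bx; split=> //; exists x; split=> //; exact: cyl_itin.
- move=> /= Bv; have xv := cyl_itin n Lx.
  have [sub|[e|e]] := H _ (size_itin T n x) Bv.
  + by left; split=> //; exact: sub.
  + by right; left; rewrite -e.
  + by right; right; rewrite -e.
- move=> Bx; have xv := cyl_itin n Lx.
  have [|sub|[e|e]] := H _ (size_itin T n x); first by exists x.
  + by left; split=> //; split=> //; exists x.
  + by right; left; rewrite -e.
  + by right; right; rewrite -e.
Qed.

Lemma le_limit_half (p q c : R) : 0 <= c -> (forall k, p <= q + c * 2 ^- k) -> p <= q.
Proof.
move=> c0 H; apply/ler_addgt0Pr => e e0.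
have ec0 : 0 < e / (c + 1) by rewrite divr_gt0 // ltr_wpDl.
have [k [_ k2]] := half_pow_small ec0; apply: le_trans (H k) _; rewrite lerD2l.
apply: le_trans (ler_wpM2l c0 k2) _; rewrite mulrCA ler_piMr ?(ltW e0) //.
by rewrite ler_pdivrMr ?mul1r ?lerDl // ltr_wpDl.
Qed.

End WordSets.

(** * Decoupling the past from the future *)

Section Decoupling.
Variables (R : realType) (T : interval_map R).
Variables (m mu : probability (measurableTypeR R) R).
Local Notation f := (imap T).
Local Notation Lam := (repeller T).
Local Notation mR := (measurableTypeR R).
Implicit Types (i : idx T) (u v w y : seq (idx T)) (P Q : set (seq (idx T))) (A B : set mR).

Hypothesis m_rep : pr m Lam = 1.
Hypothesis mu_rep : pr mu Lam = 1.
Hypothesis mu_inv : forall n A, measurable A -> pr mu (back T n A) = pr mu A.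
Hypothesis mu_ac : mu `<< m.

Variables (K C : R) (n1 j : nat).
Hypothesis K0 : 0 < K.
Hypothesis distortion : forall w A, measurable A -> A `<=` cyl w ->
  pr m A * pr m (follow w) <= K * (pr m (cyl w) * pr m (iter (size w) f @` A)) /\
  pr m (cyl w) * pr m (iter (size w) f @` A) <= K * (pr m A * pr m (follow w)).
Hypothesis m_decay : forall k w, (k * n1 <= size w)%N -> pr m (cyl w) <= 2 ^- k.
Hypothesis C1 : 1 < C.
Hypothesis mu_cat_le : forall u v,
  pr mu (cyl (u ++ v)) <= C * (pr mu (cyl u) * pr mu (cyl v)).
Hypothesis mu_cat_ge : forall u v, admissible (u ++ v) ->
  pr mu (cyl u) * pr mu (cyl v) <= C * pr mu (cyl (u ++ v)).
Hypothesis mu_gt0 : forall w, admissible w -> 0 < pr mu (cyl w).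
Hypothesis mu_mix : forall u v, admissible u -> admissible v ->
  2^-1 * (pr mu (cyl u) * pr mu (cyl v)) <= pr mu (cyl u `&` back T (size u + j) (cyl v)).

Let C0 : 0 < C. Proof. exact: lt_trans C1. Qed.

Let mcyl w : measurable (cyl w : set mR). Proof. exact: measurable_cyl. Qed.

Let mcyls n P : measurable (cyls n P : set mR). Proof. exact: measurable_cyls. Qed.

Let mback n A : measurable A -> measurable (back T n A : set mR).
Proof. exact: measurable_back. Qed.

Lemma cyl_empty w : ~ admissible w -> cyl w = set0.
Proof.
by move=> nw; apply/seteqP; split=> // x wx; apply: nw; apply: admissible_cyl; exists x.
Qed.

(** By absolute continuity mu is small on long cylinders, uniformly, and the
    quasi-Bernoulli bound turns smallness at one length into exponential decay. *)
Lemma mu_decay : exists2 L0, (0 < L0)%N &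
  forall k w, (k * L0 <= size w)%N -> pr mu (cyl w) <= 2 ^- k.
Proof.
have e0 : 0 < (2 * C)^-1 by rewrite invr_gt0 mulr_gt0.
have [dl dl0 H] := pr_abs_cont mu_ac e0.
have dl2 : 0 < dl / 2 by rewrite divr_gt0.
have [k1 [_ k1dl]] := half_pow_small dl2.
exists (k1 * n1).+1 => //; elim=> [|k IH] w kw; first by rewrite expr0 invr1 pr_le1.
have sw : ((k1 * n1).+1 <= size w)%N by apply: leq_trans kw; rewrite mulSn leq_addr.
rewrite -(cat_take_drop (k1 * n1).+1 w); apply: le_trans (mu_cat_le _ _) _.
have h1 : pr mu (cyl (take (k1 * n1).+1 w)) <= (2 * C)^-1.
  apply/ltW/H => //; apply: le_lt_trans (_ : dl / 2 < dl); last lra.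
  apply: le_trans k1dl; apply: m_decay.
  by rewrite size_takel // leqnSn.
have h2 : pr mu (cyl (drop (k1 * n1).+1 w)) <= 2 ^- k.
  by apply: IH; rewrite size_drop leq_subRL // -mulSn.
apply: le_trans (_ : C * ((2 * C)^-1 * 2 ^- k) <= _); first by rewrite ler_pM2l // ler_pM ?pr_ge0.
by rewrite exprS !invfM mulrA mulrCA mulfV ?gt_eqF // mulr1.
Qed.

Lemma mu_decouple n k P Q :
  pr mu (cyls n P `&` back T n (cyls k Q)) <= C * (pr mu (cyls n P) * pr mu (cyls k Q)).
Proof.
apply: decoupling_le => [|u v un vk]; first exact: ltW.
by rewrite -un -cyl_back -cyl_cat; exact: mu_cat_le.
Qed.

Lemma mu_mixing n k P Q : 2^-1 * (pr mu (cyls n P) * pr mu (cyls k Q)) <=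
  pr mu (cyls n P `&` back T (n + j) (cyls k Q)).
Proof.
apply: decoupling_ge => [|u v <- _]; first by rewrite invr_ge0.
have [au|nu] := pselect (admissible u); last first.
  by rewrite (cyl_empty nu) pr0 mul0r mulr0 pr_ge0.
have [av|nv] := pselect (admissible v); last first.
  by rewrite (cyl_empty nv) pr0 !mulr0 pr_ge0.
exact: mu_mix.
Qed.

Lemma mu_decouple_itv w B : is_interval B ->
  pr mu (cyl w `&` back T (size w) (Lam `&` B)) <= C * (pr mu (cyl w) * pr mu (Lam `&` B)).
Proof.
move=> iB; have [L0 _ H] := mu_decay.
have mB : measurable (Lam `&` B : set mR).
  by apply: measurableI; [exact: measurable_repeller|exact: is_interval_measurable].
apply: (@le_limit_half _ _ _ (C * pr mu (cyl w) * 2)).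
  by rewrite !mulr_ge0 ?pr_ge0 // ltW.
move=> k; have [v1 [v2 [s1 s2 h1 h2 _]]] := interval_cyls T (k * L0) iB.
set Q := [set v | _] in h1 h2.
apply: le_trans (_ : pr mu (cyls (size w) [set w] `&` back T (size w) (cyls (k * L0) Q)) <= _).
  apply: pr_le; [|by apply: measurableI; [|exact: mback]|].
    by apply: measurableI => //; exact: mback.
  by rewrite cyls1; apply: setIS => x [Lx Bx]; split=> //; exact: h1.
apply: le_trans (mu_decouple _ _ _ _) _; rewrite cyls1 -mulrA -mulrA -mulrDr ler_pM2l //.
rewrite -mulrDr ler_wpM2l ?pr_ge0 //.
have mv : measurable (cyl v1 `|` cyl v2 : set mR) by exact: measurableU.
apply: le_trans (pr_le _ (mcyls _ _) (measurableU _ _ mB mv) h2) _.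
apply: le_trans (prU_le _ mB mv) _; rewrite lerD2l.
apply: le_trans (prU_le _ (mcyl v1) (mcyl v2)) _.
by rewrite mulr_natl mulr2n lerD // H ?s1 ?s2.
Qed.

(** Quasi-Bernoulli masses force big images: the normalized image of mu under a
    branch is dominated by C times mu, so its support cannot be small. *)
Lemma mu_follow w y : admissible (w ++ y) ->
  pr mu (cyl y) <= C ^+ 2 * pr mu (follow w `&` cyl y).
Proof.
move=> awy; have w0 := mu_gt0 (admissible_take awy).
pose B := (iter (size w) f @` piece w) `&` piece y.
have iB : is_interval B.
  move=> a b [wa ya] [wb yb] z ab; split; first exact: (image_piece_itv wa wb).
  exact: (piece_itv ya yb).
have FE : follow w `&` cyl y = Lam `&` B.
  by rewrite followE /cyl setIACA setIid.
have := mu_cat_ge awy.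
have -> : cyl (w ++ y) = cyl w `&` back T (size w) (Lam `&` B).
  rewrite cyl_cat -FE -cyl_back; apply/seteqP; split=> x [wx]; last by move=> [].
  by move=> yx; split=> //; split=> //; exists x.
move=> h; have := le_trans h (ler_wpM2l (ltW C0) (mu_decouple_itv w iB)).
rewrite [C * (C * _)]mulrA -expr2 mulrCA ler_pM2l //; first by rewrite FE.
Qed.

Lemma mu_m_gt0 (e : R) : 0 < e -> exists2 dl : R, 0 < dl &
  forall A, measurable A -> e <= pr mu A -> dl <= pr m A.
Proof.
move=> e0; have [dl dl0 H] := pr_abs_cont mu_ac e0; exists dl => // A mA eA.
by rewrite leNgt; apply/negP => /(H A mA); rewrite ltNge eA.
Qed.

(** Big images for m, from big images for mu and absolute continuity. *)
Lemma m_follow_gt0 : exists2 c0 : R, 0 < c0 & forall w, admissible w -> c0 <= pr m (follow w).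
Proof.
have pC : 0 < (C ^+ 2)^-1 by rewrite invr_gt0 exprn_gt0.
have [dl dl0 H] := mu_m_gt0 pC; exists dl => // w aw.
apply: H; first exact: measurable_follow.
have := @mu_follow w [::]; rewrite cats0 => /(_ aw); rewrite cyl_nil mu_rep setIidl.
  by rewrite -ler_pdivrMl ?exprn_gt0 // mulr1.
by move=> x; rewrite followE => -[].
Qed.

(** Bounded distortion, with denominators bounded below by the big images. *)
Lemma m_decouple_le : exists2 C2 : R, 0 < C2 & forall w A, measurable A ->
  pr m (cyl w `&` back T (size w) A) <= C2 * (pr m (cyl w) * pr m A).
Proof.
have [c0 c00 H] := m_follow_gt0; exists (K / c0); first by rewrite divr_gt0.
move=> w A mA; have [aw|nw] := pselect (admissible w); last first.
  by rewrite (cyl_empty nw) set0I pr0 mul0r mulr0.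
have mwA : measurable (cyl w `&` back T (size w) A : set mR) by apply: measurableI => //; exact: mback.
have [+ _] := distortion mwA (@subIsetl _ _ _).
rewrite -cyl_back iter_image_cylI => h.
rewrite mulrAC ler_pdivlMr //; apply: le_trans (_ : pr m (cyl w `&` iter (size w) f @^-1` A) * pr m (follow w) <= _).
  by rewrite ler_wpM2l ?pr_ge0 // H.
apply: le_trans h _; rewrite ler_pM2l // ler_wpM2l ?pr_ge0 // pr_le //.
by apply: measurableI => //; exact: measurable_follow.
Qed.

(** The mass of the points that go from w to v across a gap of length j is at least
    half of the product of the masses.  The connecting words outside a large finite
    set have so little mass that by the quasi-Bernoulli bound they account for at
    most a quarter, so that some word of the finite set connects w to v. *)
Lemma connecting_words : exists ys : seq (seq (idx T)), forall w v,
  admissible w -> admissible v ->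
  exists2 y, y \in ys & size y = j /\ cyl (w ++ y ++ v) !=set0.
Proof.
pose A N := cyls j [set y : seq (idx T) | (N <= label y)%N].
have : pr mu (A n) @[n --> \oo] --> 0.
  have : (mu \o A) @ \oo --> mu (\bigcap_n A n).
    apply: nonincreasing_cvg_mu.
    - by rewrite (le_lt_trans (probability_le1 _ _)) ?ltry //; exact: mcyls.
    - by move=> i; exact: mcyls.
    - by apply: bigcapT_measurable => i; exact: mcyls.
    - by move=> p q pq; apply/subsetPset => x [Lx qx]; split=> //; exact: leq_trans qx.
  rewrite (_ : \bigcap_n A n = set0) ?measure0; last first.
    apply/seteqP; split=> // x /(_ (label (itin T j x)).+1 I) [_] /=.
    by rewrite ltnn.
  by move=> /fine_cvg.
have e0 : 0 < (4 * C ^+ 2)^-1 by rewrite invr_gt0 mulr_gt0 // exprn_gt0.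
move=> /cvgrPdist_le /(_ _ e0) [N _ /(_ N (leqnn N)) /=].
rewrite sub0r normrN ger0_norm ?pr_ge0 // => AN.
pose g l := xget [::] [set y : seq (idx T) | size y = j /\ label y = l].
exists [seq g l | l <- iota 0 N] => w v aw av; apply: contrapT => no.
have w0 := mu_gt0 aw; have v0 := mu_gt0 av.
suff : pr mu (cyl w `&` back T (size w + j) (cyl v)) <= 4^-1 * (pr mu (cyl w) * pr mu (cyl v)).
  move=> /(le_trans (mu_mix aw av)); rewrite ler_pM2r ?mulr_gt0 // => h; lra.
apply: le_trans (_ : pr mu (cyls (size w) [set w] `&` back T (size w)
    (cyls j [set y | (N <= label y)%N] `&` back T j (cyls (size v) [set v]))) <= _).
  apply: pr_le; [by apply: measurableI => //; exact: mback| |].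
    by apply: measurableI => //; apply: mback; apply: measurableI => //; exact: mback.
  rewrite !cyls1; move=> x [wx [Lx vx]].
  have vx' : cyl v (iter j f (iter (size w) f x)) by rewrite -iterD addnC.
  have Ly := repeller_iter (size w) Lx.
  do 2!split=> //; split; last by split.
  split=> //=; rewrite leqNgt; apply/negP => yN.
  set y := itin T j (iter (size w) f x) in yN; apply: no; exists y; last first.
    have sy : size y = j by exact: size_itin.
    split=> //; exists x; rewrite catA !cyl_cat size_cat sy; split=> //.
    by split=> //; exact: cyl_itin.
  apply/mapP; exists (label y); first by rewrite mem_iota.
  apply: (@label_inj R T); have [] // := xgetPex [::] (_ : exists y', size y' = j /\ label y' = label y).
  by exists y; split=> //; exact: size_itin.
rewrite [X in back T (size w) X]cylsI_back; apply: le_trans (mu_decouple _ _ _ _) _.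
rewrite -cylsI_back !cyls1 [leLHS]mulrCA [leRHS]mulrCA ler_pM2l //.
have := mu_decouple j (size v) [set y | (N <= label y)%N] [set v]; rewrite cyls1 => h.
apply: le_trans (ler_wpM2l (ltW C0) h) _.
rewrite !mulrA -expr2 ler_pM2r //; apply: le_trans (ler_wpM2l _ AN) _.
  by rewrite exprn_ge0 // ltW.
by rewrite invfM mulrCA mulfV ?mulr1 // expf_neq0 // gt_eqF.
Qed.

(** The image of m under a branch, pushed forward j more steps, is bounded below
    by m.  Indeed the sets of points that may follow w y, for y among the finitely
    many connecting words, cover the repeller up to a null set: every nonempty
    cylinder meets one of them, and only two cylinders of each generation meet a
    given one without lying in it. *)
Lemma m_decouple_ge : exists2 kap : R, 0 < kap & forall w A, measurable A ->
  kap * (pr m (cyl w) * pr m A) <= pr m (cyl w `&` back T (size w + j) A).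
Proof.
have [ys Hys] := connecting_words.
have [e e0 He] : exists2 e : R, 0 < e & forall y, y \in ys -> admissible y -> e <= pr mu (cyl y).
  elim: ys {Hys} => [|y ys [e e0 He]]; first by exists 1.
  have [ay|ny] := pselect (admissible y).
    exists (Num.min e (pr mu (cyl y))); first by rewrite lt_min e0 mu_gt0.
    move=> z; rewrite inE => /orP[/eqP-> _|zs az]; first by rewrite ge_min lexx orbT.
    by rewrite ge_min He.
  by exists e => // z; rewrite inE => /orP[/eqP->|zs az] //; exact: He.
have eC : 0 < e / C ^+ 2 by rewrite divr_gt0 // exprn_gt0.
have [dl dl0 Hdl] := mu_m_gt0 eC.
pose N := (size ys).+1.
pose kap := dl / K / (K * N%:R).
have kap0 : 0 < kap by rewrite !divr_gt0 // mulr_gt0.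
exists kap => // w A mA.
have [aw|nw] := pselect (admissible w); last by rewrite (cyl_empty nw) pr0 !(mul0r, mulr0) pr_ge0.
pose Y := [seq y <- ys | `[< size y = j /\ admissible (w ++ y) >]].
have YP y : y \in Y -> [/\ y \in ys, size y = j & admissible (w ++ y)].
  by rewrite mem_filter => /andP[/asboolP[]].
have mF y : measurable (follow (w ++ y) : set mR) by exact: measurable_follow.
have mL := @measurable_repeller R T.
(* A point outside all these sets lies in a cylinder cut by one of them. *)
have cover : pr m (Lam `\` \bigcup_(y in [set` Y]) follow (w ++ y)) = 0.
  set D := _ `\` _.
  have mD : measurable (D : set mR).
    by apply: measurableD => //; rewrite bigcup_seq; exact: bigsetU_measurable.
  apply/eqP; rewrite eq_le pr_ge0 andbT.
  apply: (@le_limit_half _ _ _ (2 * (size Y)%:R)) => [|k]; first by rewrite mulr_ge0.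
  rewrite add0r.
  have /choice [g Hg] : forall y : seq (idx T), exists vv : seq (idx T) * seq (idx T),
      [/\ size vv.1 = (k * n1)%N, size vv.2 = (k * n1)%N &
      forall v, size v = (k * n1)%N -> cyl v `&` (iter (size (w ++ y)) f @` piece (w ++ y)) !=set0 ->
        cyl v `<=` iter (size (w ++ y)) f @` piece (w ++ y) \/ v = vv.1 \/ v = vv.2].
    move=> y; have [v1 [v2 [s1 s2 H]]] := @cut_cylinders R T _ (k * n1) (@image_piece_itv R T (w ++ y)).
    by exists (v1, v2).
  pose G y : set mR := cyl (g y).1 `|` cyl (g y).2.
  have mG y : measurable (G y) by apply: measurableU.
  apply: le_trans (_ : \sum_(y <- Y) pr m (G y) <= _).
    apply: pr_cover => // x [Lx nx]; have xv := cyl_itin (k * n1) Lx.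
    have av : admissible (itin T (k * n1) x) by apply: admissible_cyl; exists x.
    have [y yys [sy [z wyvz]]] := Hys w _ aw av.
    have awy : admissible (w ++ y).
      by apply: admissible_cyl; exists z; move: wyvz; rewrite catA cyl_cat => -[].
    have yY : y \in Y by rewrite mem_filter yys andbT; apply/asboolP.
    exists y => //; have [_ _ H] := Hg y.
    have [||[E|E]] := H _ (size_itin T (k * n1) x).
    - exists (iter (size (w ++ y)) f z); move: wyvz; rewrite catA cyl_cat => -[[Lz wyz] vz].
      by split=> //; exists z.
    - by move=> sub; exfalso; apply: nx; exists y => //; rewrite followE; split=> //; exact: sub.
    - by left; rewrite -E.
    - by right; rewrite -E.
  apply: le_trans (_ : \sum_(y <- Y) 2 * 2 ^- k <= _).
    apply: ler_sum => y _; apply: le_trans (prU_le _ (mcyl _) (mcyl _)) _.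
    by have [s1 s2 _] := Hg y; rewrite mulr_natl mulr2n; apply: lerD; apply: m_decay; rewrite ?s1 ?s2.
  by rewrite big_const_seq count_predT iter_addr_0 -[_ *+ size Y]mulr_natr mulrAC.
have cylw0 : 0 <= pr m (cyl w) := pr_ge0 _ _.
set X := pr m (_ `&` back T _ A).
have one y : y \in Y -> pr m (cyl w) * pr m (follow (w ++ y) `&` A) <= K ^+ 2 / dl * X.
  move=> /YP [yys sy awy].
  have mwy : measurable (cyl (w ++ y) : set mR) by exact: mcyl.
  have sub : cyl (w ++ y) `<=` cyl w by rewrite cyl_cat => x [].
  have [_ d1] := distortion mwy sub; rewrite cyl_cat iter_image_cylI -cyl_cat in d1.
  have h1 : dl <= pr m (follow w `&` cyl y).
    apply: Hdl; first by apply: measurableI => //; exact: measurable_follow.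
    rewrite ler_pdivrMr ?exprn_gt0 // mulrC; apply: le_trans (mu_follow awy).
    by apply: He => //; exact: admissible_drop awy.
  have h2 : pr m (cyl w) * dl <= K * pr m (cyl (w ++ y)).
    apply: le_trans (ler_wpM2l cylw0 h1) _; apply: le_trans d1 _; rewrite ler_pM2l //.
    by rewrite ler_piMr ?pr_ge0 // pr_le1 //; exact: measurable_follow.
  have mwyA : measurable (cyl (w ++ y) `&` iter (size (w ++ y)) f @^-1` A : set mR).
    by rewrite cyl_back; apply: measurableI => //; exact: mback.
  have [_ d2] := distortion mwyA (@subIsetl _ _ _); rewrite iter_image_cylI in d2.
  have h3 : pr m (cyl (w ++ y)) * pr m (follow (w ++ y) `&` A) <= K * X.
    apply: le_trans d2 _; rewrite ler_pM2l //; apply: le_trans (_ : pr m (cyl (w ++ y) `&` iter (size (w ++ y)) f @^-1` A) <= _).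
      by rewrite ler_piMr ?pr_ge0 // pr_le1.
    apply: pr_le => //; first by apply: measurableI => //; exact: mback.
    by rewrite cyl_back size_cat sy; exact: setSI.
  have F0 := pr_ge0 m (follow (w ++ y) `&` A).
  have -> : K ^+ 2 / dl * X = K * (K * X) / dl by ring.
  rewrite ler_pdivlMr // mulrAC.
  apply: le_trans (ler_wpM2r F0 h2) _; rewrite -mulrA ler_pM2l //.
have mU : measurable (\bigcup_(y in [set` Y]) follow (w ++ y) : set mR).
  by rewrite bigcup_seq; exact: bigsetU_measurable.
have AL : pr m (A `\` Lam) = 0.
  exact: pr_full.
have AF : pr m A <= \sum_(y <- Y) pr m (follow (w ++ y) `&` A).
  rewrite (pr_split _ mA mL) AL addr0.
  have mAL : measurable (A `&` Lam : set mR) by exact: measurableI.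
  rewrite (pr_split _ mAL mU) (_ : pr m (_ `\` _) = 0); last first.
    apply/eqP; rewrite eq_le pr_ge0 andbT -cover.
    apply: pr_le; [exact: measurableD|exact: measurableD|].
    by apply: setSD => x [].
  rewrite addr0; apply: pr_cover.
  - by move=> y; apply: measurableI.
  - exact: measurableI.
  - by move=> x [[Ax _] [y yY Fx]]; exists y.
rewrite mulrC; apply: le_trans (_ : (\sum_(y <- Y) K ^+ 2 / dl * X) * kap <= _).
  rewrite ler_pM2r //; apply: le_trans (ler_wpM2l cylw0 AF) _.
  by rewrite mulr_sumr big_seq [leRHS]big_seq; apply: ler_sum => y yY; exact: one.
rewrite big_const_seq count_predT iter_addr_0 -[_ *+ size Y]mulr_natr.
have -> : K ^+ 2 / dl * X * (size Y)%:R * kap = ((size Y)%:R / N%:R) * X.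
  by rewrite /kap; field; rewrite !gt_eqF // ltr0n.
rewrite ler_piMl ?pr_ge0 // ler_pdivrMr ?ltr0n // mul1r ler_nat ltnW // ltnS size_filter.
exact: count_size.
Qed.

End Decoupling.

(** * Recurrence to unions of cylinders *)

Section Recurrence.
Variables (R : realType) (T : interval_map R).
Local Notation f := (imap T).
Local Notation Lam := (repeller T).
Local Notation mR := (measurableTypeR R).
Implicit Types (P Q : set (seq (idx T))) (A B : set mR) (nu : probability mR R).

Definition decoupled_below nu (kap : R) (j : nat) : Prop := forall n k P Q,
  kap * (pr nu (cyls n P) * pr nu (cyls k Q)) <= pr nu (cyls n P `&` back T (n + j) (cyls k Q)).

(** The windows of length L are preceded by gaps of length j, across which the
    measure decouples. *)
Definition miss L j Q q : set R :=
  [set x | Lam x /\ forall i, (i < q)%N -> ~ cyls L Q (iter (i * (L + j) + j) f x)].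

Lemma missS L j Q q : miss L j Q q.+1 = miss L j Q q `\` back T (q * (L + j) + j) (cyls L Q).
Proof.
apply/seteqP; split=> x.
  move=> [Lx H]; split; first by split=> // i iq; apply: H; exact: ltnW.
  by move=> [_]; exact: H.
move=> [[Lx H] nH]; split=> // i; rewrite ltnS leq_eqVlt => /orP[/eqP->|/H //] Gx.
by apply: nH.
Qed.

Lemma miss_cyls L j Q q : exists P, miss L j Q q = cyls (q * (L + j)) P.
Proof.
elim: q => [|q [P E]].
  by exists setT; apply/seteqP; split=> x [Lx _]; split.
rewrite missS E cyls_back; set n := (_ + L)%N.
have -> : (q.+1 * (L + j) = n)%N by rewrite /n mulSn; lia.
have -> : cyls (q * (L + j)) P = cyls n [set w | P (take (q * (L + j)) w)].
  by rewrite /n -addnA [(j + L)%N]addnC -cyls_refine.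
set P1 := [set w | _]; set P2 := [set w | _].
exists (P1 `&` ~` P2); rewrite -cylsI -cylsC.
by apply/seteqP; split=> x; [move=> [[Lx Px] nx]|move=> [[Lx Px] [_ nx]]].
Qed.

Lemma measurable_miss L j Q q : measurable (miss L j Q q : set mR).
Proof. by have [P ->] := miss_cyls L j Q q; exact: measurable_cyls. Qed.

Lemma decoupled_below_le1 nu kap j k Q : pr nu Lam = 1 -> decoupled_below nu kap j ->
  kap * pr nu (cyls k Q) <= 1.
Proof.
move=> nL /(_ 0%N k setT Q); have -> : @cyls R T 0 setT = Lam.
  by apply/seteqP; split=> x // -[].
rewrite nL mul1r => h; apply: le_trans h _; apply: pr_le1; apply: measurableI.
  exact: measurable_repeller.
by apply: measurable_back; exact: measurable_cyls.
Qed.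

Lemma miss_tail nu kap j L Q q : pr nu Lam = 1 -> decoupled_below nu kap j ->
  pr nu (miss L j Q q) <= (1 - kap * pr nu (cyls L Q)) ^+ q.
Proof.
move=> nL dec; have h1 := decoupled_below_le1 L Q nL dec.
elim: q => [|q IH]; first by rewrite expr0 pr_le1 //; exact: measurable_miss.
have [P E] := miss_cyls L j Q q.
have mB : measurable (back T (q * (L + j) + j) (cyls L Q) : set mR).
  by apply: measurable_back; exact: measurable_cyls.
have := pr_split nu (measurable_miss L j Q q) mB; rewrite -missS => h.
have := dec (q * (L + j))%N L P Q; rewrite -E => h2.
have h3 : pr nu (miss L j Q q.+1) <= pr nu (miss L j Q q) * (1 - kap * pr nu (cyls L Q)).
  by rewrite mulrBr mulr1 mulrCA; lra.
apply: le_trans h3 _; rewrite exprSr ler_wpM2r //; lra.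
Qed.

Lemma pow_1sub_le (x : R) q : 0 <= x <= 1 -> (1 - x) ^+ q * (1 + q%:R * x) <= 1.
Proof.
move=> /andP[x0 x1]; elim: q => [|q IH]; first by rewrite expr0 mul0r addr0 mul1r.
apply: le_trans IH; rewrite exprSr -mulrA ler_wpM2l ?exprn_ge0 ?subr_ge0 //.
have q0 : 0 <= (q%:R : R) by []; rewrite -natr1; nra.
Qed.

(** An event of small probability is likely to happen once in a number of trials
    of the order of the inverse of its probability.  Comparing how fast two
    mutually controlled measures see the same event compares their values on it. *)
Lemma compare_by_recurrence nu1 nu2 (kap C eta c1 : R) j :
  0 < kap -> 0 < C -> 0 < eta -> 0 < c1 -> pr nu1 Lam = 1 ->
  decoupled_below nu1 kap j ->
  (forall n k Q, pr nu2 (back T n (cyls k Q)) <= C * pr nu2 (cyls k Q)) ->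
  (forall A, measurable A -> A `<=` Lam -> 1 - eta <= pr nu1 A -> c1 <= pr nu2 A) ->
  exists2 D : R, 0 < D & forall k Q, pr nu1 (cyls k Q) <= D * pr nu2 (cyls k Q).
Proof.
move=> kap0 C0 eta0 c10 nL dec inv cmp.
exists (((eta * kap)^-1 + 1) * C / c1).
  by rewrite divr_gt0 // mulr_gt0 // addr_gt0 // invr_gt0 mulr_gt0.
move=> L Q; set g := pr nu1 (cyls L Q).
have g1 : g <= 1 by apply: pr_le1; exact: measurable_cyls.
have [->|g0'] := eqVneq g 0.
  by rewrite !mulr_ge0 ?pr_ge0 ?invr_ge0 ?(ltW c10) ?(ltW C0) ?addr_ge0 ?invr_ge0 // mulr_ge0 // ltW.
have g0 : 0 < g by rewrite lt_neqAle eq_sym g0' pr_ge0.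
have kg1 := decoupled_below_le1 L Q nL dec; rewrite -/g in kg1.
(* After q trials the event has occurred with nu1-probability at least 1 - eta. *)
pose q := (Num.truncn (eta * kap * g)^-1).+1.
have d0 : 0 < eta * kap * g by rewrite !mulr_gt0.
have q1 : (eta * kap * g)^-1 <= q%:R by exact/ltW/truncnS_gt.
have q2 : q%:R * g <= (eta * kap)^-1 + 1.
  have : q%:R <= (eta * kap * g)^-1 + 1.
    by rewrite /q -natr1 lerD2r truncn_le // invr_ge0 ltW.
  move=> /(ler_wpM2r (ltW g0)) /le_trans; apply; rewrite mulrDl mul1r invfM mulrVK ?unitfE ?gt_eqF //.
  by rewrite lerD2l.
have mM := measurable_miss L j Q q.
have missq : pr nu1 (miss L j Q q) <= eta.
  apply: le_trans (miss_tail L Q q nL dec) _; rewrite -/g.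
  have x01 : 0 <= kap * g <= 1 by rewrite kg1 mulr_ge0 ?ltW.
  have := pow_1sub_le q x01; set z := (1 - _) ^+ q => hz.
  have z0 : 0 <= z by rewrite exprn_ge0 // subr_ge0.
  have e1 : 1 <= eta * (q%:R * (kap * g)).
    have -> : eta * (q%:R * (kap * g)) = eta * kap * g * q%:R by ring.
    by rewrite -ler_pdivrMl // mulr1.
  have : z * (q%:R * (kap * g)) <= eta * (q%:R * (kap * g)).
    by apply: le_trans e1; apply: le_trans hz; rewrite ler_wpM2l // lerDr.
  by rewrite ler_pM2r // !mulr_gt0.
pose E := Lam `\` miss L j Q q.
have mE : measurable (E : set mR) by apply: measurableD => //; exact: measurable_repeller.
have E1 : 1 - eta <= pr nu1 E.
  have := pr_split nu1 (@measurable_repeller R T : measurable (Lam : set mR)) mM.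
  rewrite nL (setIidr _) -/E; last by move=> x [].
  lra.
have E2 : pr nu2 E <= q%:R * (C * pr nu2 (cyls L Q)).
  apply: le_trans (_ : \sum_(i <- iota 0 q) pr nu2 (back T (i * (L + j) + j) (cyls L Q)) <= _).
    apply: pr_cover => [i||x [Lx nM]]; [|exact: mE|].
      by apply: measurable_back; exact: measurable_cyls.
    apply: contrapT => no; apply: nM; split=> // i iq Gx; apply: no.
    by exists i => //; rewrite mem_iota.
  apply: le_trans (ler_sum _ (fun i _ => inv _ _ _)) _.
  by rewrite big_const_seq count_predT size_iota iter_addr_0 -[_ *+ q]mulr_natl.
have := le_trans (cmp E mE (@subDsetl _ _ _) E1) E2 => h.
rewrite mulrAC ler_pdivlMr // mulrC.
apply: le_trans (ler_wpM2r (ltW g0) h) _.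
have -> : q%:R * (C * pr nu2 (cyls L Q)) * g = q%:R * g * (C * pr nu2 (cyls L Q)) by ring.
by rewrite -[leRHS]mulrA ler_wpM2r // mulr_ge0 ?pr_ge0 // ltW.
Qed.

End Recurrence.

(** * Comparability of the two measures *)

Section Comparability.
Variables (R : realType) (T : interval_map R).
Variables (m mu : probability (measurableTypeR R) R).
Local Notation Lam := (repeller T).
Local Notation mR := (measurableTypeR R).
Implicit Types (w v : seq (idx T)) (P Q : set (seq (idx T))) (A B : set mR).

Hypothesis m_rep : pr m Lam = 1.
Hypothesis mu_rep : pr mu Lam = 1.
Hypothesis mu_inv : forall n A, measurable A -> pr mu (back T n A) = pr mu A.
Hypothesis mu_ac : mu `<< m.
Variables (C2 kap : R) (j : nat).
Hypothesis C2_gt0 : 0 < C2.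
Hypothesis kap_gt0 : 0 < kap.
Hypothesis m_decouple_le : forall w A, measurable A ->
  pr m (cyl w `&` back T (size w) A) <= C2 * (pr m (cyl w) * pr m A).
Hypothesis m_decouple_ge : forall w A, measurable A ->
  kap * (pr m (cyl w) * pr m A) <= pr m (cyl w `&` back T (size w + j) A).
Hypothesis mu_mixing : decoupled_below T mu 2^-1 j.

Let mL : measurable (Lam : set mR). Proof. exact: measurable_repeller. Qed.

(** m decouples across gaps and mu is invariant; by absolute continuity an event of
    m-probability close to 1 has mu-probability at least 1/2. *)
Lemma m_le_mu : exists2 D : R, 0 < D & forall k Q, pr m (cyls k Q) <= D * pr mu (cyls k Q).
Proof.
have e0 : 0 < (2^-1 : R) by rewrite invr_gt0.
have [dl dl0 H] := pr_abs_cont mu_ac e0.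
apply: (@compare_by_recurrence _ _ m mu kap 1 (dl / 2) 2^-1 j) => //.
- by rewrite divr_gt0.
- move=> n k P Q; apply: decoupling_ge => [|u v <- _]; first exact: ltW.
  by apply: m_decouple_ge; exact: measurable_cyl.
- by move=> n k Q; rewrite mul1r mu_inv //; exact: measurable_cyls.
move=> A mA AL h.
have := pr_split m mL mA; rewrite m_rep (setIidr AL) => h1.
have := pr_split mu mL mA; rewrite mu_rep (setIidr AL) => h2.
have : pr mu (Lam `\` A) < 2^-1.
  by apply: H; [exact: measurableD|lra].
lra.
Qed.

(** The roles are exchanged; m is not invariant, but the decoupling bound applied to
    all words of length n shows that pulling back costs at most a constant. *)
Lemma mu_le_m : exists2 D : R, 0 < D & forall k Q, pr mu (cyls k Q) <= D * pr m (cyls k Q).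
Proof.
have e0 : 0 < (2^-1 : R) by rewrite invr_gt0.
have [dl dl0 H] := mu_m_gt0 mu_ac e0.
apply: (@compare_by_recurrence _ _ mu m 2^-1 C2 2^-1 dl j) => //.
  move=> n k Q; have := @decoupling_le _ T m C2 n n k setT Q (ltW C2_gt0).
  have -> : @cyls R T n setT = Lam by apply/seteqP; split=> x // -[].
  rewrite m_rep mul1r (setIidr _); last by move=> x [].
  by apply=> u v <- _; apply: m_decouple_le; exact: measurable_cyl.
by move=> A mA _ h; apply: H => //; lra.
Qed.

End Comparability.

(** * Hitting an interval *)

Section HittingIntervals.
Variables (R : realType) (T : interval_map R) (mu : probability (measurableTypeR R) R).
Local Notation f := (imap T).
Local Notation Lam := (repeller T).
Local Notation mR := (measurableTypeR R).
Implicit Types (w : seq (idx T)) (P Q : set (seq (idx T))) (A B : set mR).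

Hypothesis mu_rep : pr mu Lam = 1.
Hypothesis mu_inv : forall n A, measurable A -> pr mu (back T n A) = pr mu A.

Variables (C : R) (L0 j : nat).
Hypothesis C1 : 1 < C.
Hypothesis L0_gt0 : (0 < L0)%N.
Hypothesis mu_decay : forall k w, (k * L0 <= size w)%N -> pr mu (cyl w) <= 2 ^- k.
Hypothesis mu_decouple : forall n k P Q,
  pr mu (cyls n P `&` back T n (cyls k Q)) <= C * (pr mu (cyls n P) * pr mu (cyls k Q)).
Hypothesis mu_mixing : decoupled_below T mu 2^-1 j.

Let C0 : 0 < C. Proof. exact: lt_trans C1. Qed.

Let mcyls n P : measurable (cyls n P : set mR). Proof. exact: measurable_cyls. Qed.

Let mback n A : measurable A -> measurable (back T n A : set mR).
Proof. exact: measurable_back. Qed.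

Definition inside B : set (seq (idx T)) := [set v | cyl v !=set0 /\ cyl v `<=` B].

Lemma cyls_inside_sub n B : cyls n (inside B) `<=` Lam `&` B.
Proof. by move=> x [Lx [_ sub]]; split=> //; apply: sub; exact: cyl_itin. Qed.

Lemma cyls_inside_mono n k B : cyls n (inside B) `<=` cyls (n + k) (inside B).
Proof.
move=> x [Lx [_ sub]]; split=> //; split; first by exists x; exact: cyl_itin.
by apply: subset_trans sub; rewrite itin_cat cyl_cat => y [].
Qed.

(** For a short delay t the first and the second visit are read on overlapping
    words.  At the level of the words of length t the interval is still a union of
    cylinders up to two, each of mass at most 2 ^- k, and these words do not overlap
    with the second visit. *)
Lemma interval_correlation n t k B : is_interval B ->
  let U := cyls n (inside B) in (k * L0 <= t)%N ->
  pr mu (U `&` back T t U) <= C * (pr mu U ^+ 2 + 2 * 2 ^- k * pr mu U).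
Proof.
move=> iB U kt; have mU : measurable (U : set mR) by exact: mcyls.
have U0 : 0 <= pr mu U := pr_ge0 _ _.
have k0 : (0 : R) <= 2 ^- k by rewrite invr_ge0 exprn_ge0.
have [tn|nt] := leqP t n; last first.
  apply: le_trans (_ : C * pr mu U ^+ 2 <= _); last first.
    by rewrite ler_pM2l // lerDl !mulr_ge0.
  by rewrite expr2 {1 3}/U (cyls_refine n (t - n)) subnKC ?(ltnW nt) //; exact: mu_decouple.
have [v1 [v2 [s1 s2 _ _ h]]] := interval_cyls T t iB; rewrite -/(inside B) in h.
set W := cyls t (inside B) in h.
have WU : W `<=` U by rewrite /U -(subnKC tn); exact: cyls_inside_mono.
have mW : measurable (W : set mR) by exact: mcyls.
have mbU := mback t mU.
have mcv (v : seq (idx T)) : measurable (cyl v : set mR) by exact: measurable_cyl.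
have mI A : measurable A -> measurable (A `&` back T t U : set mR) by move=> mA; exact: measurableI.
have dec (v : seq (idx T)) : size v = t -> pr mu (cyl v `&` back T t U) <= C * (2 ^- k * pr mu U).
  move=> sv; have := mu_decouple (size v) n [set v] (inside B); rewrite cyls1 sv => hv.
  apply: le_trans hv _; rewrite ler_pM2l // ler_wpM2r //.
  by apply: mu_decay; rewrite sv.
apply: le_trans (_ : pr mu (W `&` back T t U) + (pr mu (cyl v1 `&` back T t U) + pr mu (cyl v2 `&` back T t U)) <= _).
  apply: le_trans (_ : pr mu ((W `&` back T t U) `|` ((cyl v1 `&` back T t U) `|` (cyl v2 `&` back T t U))) <= _).
    apply: pr_le; [exact: mI|by apply: measurableU; [|apply: measurableU]; exact: mI|].
    move=> x [Ux bx]; have [Wx|[v1x|v2x]] := h x (cyls_inside_sub Ux).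
    - by left; split.
    - by right; left; split.
    - by right; right; split.
  apply: le_trans (prU_le _ (mI _ mW) (measurableU _ _ (mI _ (mcv v1)) (mI _ (mcv v2)))) _.
  by rewrite lerD2l; apply: prU_le; exact: mI.
have h1 : pr mu (W `&` back T t U) <= C * (pr mu U * pr mu U).
  apply: le_trans (mu_decouple t n _ _) _; rewrite ler_pM2l // ler_wpM2r //.
  exact: pr_le.
have := dec v1 s1; have := dec v2 s2; rewrite expr2; lra.
Qed.

Lemma sum_half_pow_le (d n : nat) : (0 < d)%N ->
  \sum_(i < n) (2 ^- (i.+1 * d) : R) <= 2 * 2 ^- d.
Proof.
move=> d0; suff H : \sum_(i < n) (2 ^- (i.+1 * d) : R) + 2 * 2 ^- (n.+1 * d) <= 2 * 2 ^- d.
  by apply: le_trans H; rewrite lerDl mulr_ge0 // invr_ge0 exprn_ge0.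
elim: n => [|n IH]; first by rewrite big_ord0 add0r mul1n.
apply: le_trans IH; rewrite big_ord_recr /= -addrA lerD2l.
set a : R := 2 ^- (n.+1 * d).
have a0 : 0 <= a by rewrite invr_ge0 exprn_ge0.
have -> : 2 ^- (n.+2 * d) = a * 2 ^- d :> R by rewrite mulSn addnC exprD invfM.
have : (2 ^- d : R) <= 2^-1.
  rewrite lef_pV2 ?posrE ?exprn_gt0 //; case: d d0 {a a0} => // d _.
  by rewrite exprS ler_peMr // exprn_ege1 // ler1n.
by move=> h; nra.
Qed.

(** Second moment method: at sparse times the visits to an interval are so weakly
    correlated that the interval is hit with a fixed probability in a number of
    steps of the order of the inverse of its mass. *)
Lemma hit_window : exists2 D, (0 < D)%N & forall n B, is_interval B ->
  let U := cyls n (inside B) in 0 < pr mu U ->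
  exists N, N%:R <= (4 * C * pr mu U)^-1 + 1 /\
    (16 * C)^-1 <= pr mu (\bigcup_(i < N) back T (i * D) U).
Proof.
have [d [d0 d2]] : exists d, (0 < d)%N /\ 16 * C * 2 ^- d <= 1.
  have e0 : 0 < (16 * C)^-1 by rewrite invr_gt0 mulr_gt0.
  have [d [_ hd]] := half_pow_small e0; exists d.+1; split=> //.
  rewrite -ler_pdivlMl ?mulr_gt0 // mulr1 exprS invfM; apply: le_trans hd.
  by rewrite ler_piMl ?invr_ge0 ?exprn_ge0 // invf_le1 // ler1n.
(* At multiples of this spacing the error terms of the correlations form a geometric
   series with sum at most 4 / 2 ^ d, hence at most 1 / (4 C). *)
exists (d * L0)%N; first by rewrite muln_gt0 d0.
move=> n B iB U U0; set u := pr mu U in U0 *; set D := (d * L0)%N.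
have mU : measurable (U : set mR) by exact: mcyls.
have [ub|us] := ltP (8 * C)^-1 u.
  exists 1%N; split; first by rewrite lerDr invr_ge0 !mulr_ge0 // ltW.
  apply: le_trans (_ : pr mu (back T 0 U) <= _).
    rewrite mu_inv //; apply: le_trans (ltW ub); rewrite lef_pV2 ?posrE ?mulr_gt0 //.
    by rewrite ler_pM2r // ler_nat.
  apply: pr_le; [exact: mback|by apply: bigcup_measurable => i _; exact: mback|].
  by move=> x bx; exists 0%N.
(* So few times that the product terms C u^2 of the correlations add up to u / 4. *)
pose N := Num.truncn (4 * C * u)^-1; exists N.
have p0 : 0 < 4 * C * u by rewrite !mulr_gt0.
have N1 : N%:R <= (4 * C * u)^-1 by rewrite truncn_le // invr_ge0 ltW.
split; first by apply: le_trans N1 _; rewrite lerDl.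
have N2 : (8 * C * u)^-1 <= N%:R.
  have : (4 * C * u)^-1 < N%:R + 1 by rewrite natr1; exact: truncnS_gt.
  have e8 : (8 * C * u)^-1 = (4 * C * u)^-1 / 2.
    have -> : 8 * C * u = 4 * C * u * 2 by ring.
    by rewrite invfM.
  have : 1 <= (8 * C * u)^-1.
    rewrite invf_ge1 ?mulr_gt0 //; move: us; rewrite -[u <= _]/(u <= (8 * C)^-1).
    by rewrite -ler_pdivlMl ?mulr_gt0 // mulr1.
  rewrite e8; lra.
pose F i := back T (i * D) U.
have mF i : measurable (F i : set mR) by exact: mback.
apply: le_trans (pr_bonferroni mu N mF).
have corr (i l : nat) : (l < i)%N -> pr mu (F l `&` F i) <= C * (u ^+ 2 + 2 * 2 ^- ((i - l) * d) * u).
  move=> li; have -> : F l `&` F i = back T (l * D) (U `&` back T ((i - l) * D) U).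
    rewrite /F -{1}(subnKC (ltnW li)) mulnDl -back_back.
    by apply/seteqP; split=> x; [move=> [[Lx Ux] [_ bx]]|move=> [Lx [Ux bx]]].
  rewrite mu_inv; last by apply: measurableI => //; exact: mback.
  by apply: interval_correlation => //; rewrite /D mulnA.
have Cu0 : 0 <= C * u by rewrite mulr_ge0 // ltW.
have row (i : 'I_N) : u / 2 <= pr mu (F i) - \sum_(l < i) pr mu (F l `&` F i).
  have h : \sum_(l < i) pr mu (F l `&` F i) <=
      i%:R * (C * u ^+ 2) + C * u * (2 * (2 * 2 ^- d)).
    apply: le_trans (_ : \sum_(l < i) (C * u ^+ 2 + C * u * (2 * 2 ^- ((i - l) * d))) <= _).
      apply: ler_sum => l _; apply: le_trans (corr i l (ltn_ord l)) _.
      by rewrite le_eqVlt; apply/orP; left; apply/eqP; ring.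
    rewrite big_split /= sumr_const card_ord -[_ *+ i]mulr_natl lerD2l -mulr_sumr ler_wpM2l //.
    rewrite -mulr_sumr ler_pM2l //; apply: le_trans (sum_half_pow_le i d0).
    rewrite (reindex_inj rev_ord_inj) /= le_eqVlt; apply/orP; left; apply/eqP.
    by apply: eq_bigr => l _; rewrite subKn.
  have hF : pr mu (F i) = u by rewrite /F mu_inv.
  have hi : (i%:R : R) <= (4 * C * u)^-1.
    by apply: le_trans N1; rewrite ler_nat ltnW.
  have h2 : i%:R * (C * u ^+ 2) <= u / 4.
    apply: le_trans (ler_wpM2r _ hi) _; first by rewrite mulr_ge0 ?exprn_ge0 // ltW.
    rewrite le_eqVlt; apply/orP; left; apply/eqP; field.
    by rewrite !gt_eqF.
  have h3 : C * u * (2 * (2 * 2 ^- d)) <= u / 4.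
    have -> : C * u * (2 * (2 * 2 ^- d)) = u / 4 * (16 * C * 2 ^- d) by field.
    by rewrite ler_piMr // divr_ge0 // ltW.
  rewrite hF; lra.
apply: (@le_trans _ _ (\sum_(i < N) u / 2)); last by apply: ler_sum => i _; exact: row.
rewrite sumr_const card_ord -[_ *+ N]mulr_natl.
apply: (@le_trans _ _ ((8 * C * u)^-1 * (u / 2))); last by rewrite ler_wpM2r // divr_ge0 // ltW.
rewrite le_eqVlt; apply/orP; left; apply/eqP; field.
by rewrite !gt_eqF.
Qed.

Lemma take_drop_itin a b n x : (a + b <= n)%N ->
  take b (drop a (itin T n x)) = itin T b (iter a f x).
Proof.
by move=> abn; rewrite -(subnKC abn) -addnA drop_itin take_itin.
Qed.

Definition avoid t B : set R := [set x | Lam x /\ forall k, (k < t)%N -> ~ B (iter k f x)].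

Lemma measurable_avoid t B : measurable B -> measurable (avoid t B : set mR).
Proof.
move=> mB; have mL := @measurable_repeller R T.
have -> : avoid t B = Lam `\` \bigcup_(k < t) back T k B.
  apply/seteqP; split=> x [Lx H]; split=> //; first by move=> [k /= kt [_ Bx]]; exact: (H k kt).
  by move=> k kt Bx; apply: H; exists k.
by apply: measurableD => //; apply: bigcup_measurable => k _; exact: mback.
Qed.

(** Consecutive windows, separated by gaps of length j, give independent chances
    of hitting the interval, up to constants. *)
Lemma avoid_tail : exists p a : R, [/\ 0 < p, p < 1, 0 < a &
  forall n B, is_interval B -> 0 < pr mu (cyls n (inside B)) ->
  forall S : nat, a / pr mu (cyls n (inside B)) + n%:R + a <= S%:R ->
  forall q, pr mu (avoid (q * S) B) <= (1 - p) ^+ q].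
Proof.
have [D D0 HD] := hit_window.
have C16 : 0 < (16 * C)^-1 by rewrite invr_gt0 mulr_gt0.
exists (2^-1 * (16 * C)^-1), (D%:R + j%:R); split.
- by rewrite mulr_gt0 // invr_gt0.
- have : (16 * C)^-1 < 1.
    by rewrite invf_lt1 ?mulr_gt0 //; have := C1; lra.
  lra.
- by rewrite ltr_wpDr // ltr0n.
move=> n B iB; set U := cyls n (inside B) => U0 S HS q.
have [N [N1 N2]] := HD n B iB U0; rewrite -/U in N1 N2.
pose L := (N * D + n)%N.
pose Q : set (seq (idx T)) := [set w | exists2 i, (i < N)%N & inside B (take n (drop (i * D) w))].
have WE : \bigcup_(i < N) back T (i * D) U = cyls L Q.
  have E i x : (i < N)%N -> take n (drop (i * D) (itin T L x)) = itin T n (iter (i * D) f x).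
    by move=> iN; rewrite take_drop_itin // leq_add2r leq_mul2r ltnW ?orbT.
  apply/seteqP; split=> x.
    by move=> [i /= iN [Lx [_ Ux]]]; split=> //; exists i => //; rewrite E.
  move=> [Lx [i iN]]; rewrite E // => Ux; exists i => //; split=> //; split=> //.
  exact: repeller_iter.
have LS : (L + j <= S)%N.
  rewrite -(ler_nat R); apply: le_trans HS; rewrite /L !natrD natrM.
  have N3 : N%:R <= (pr mu U)^-1 + 1.
    apply: le_trans N1 _; rewrite lerD2r lef_pV2 ?posrE ?mulr_gt0 //.
    by rewrite ler_peMl ?ltW //; have := C1; lra.
  have h1 : N%:R * D%:R <= ((pr mu U)^-1 + 1) * D%:R by rewrite ler_wpM2r.
  have h2 : 0 <= j%:R / pr mu U by rewrite divr_ge0 // ltW.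
  lra.
have mB : measurable B by exact: is_interval_measurable.
apply: le_trans (_ : pr mu (miss L j Q q) <= _).
  apply: pr_le; [exact: measurable_avoid|exact: measurable_miss|].
  move=> x [Lx H]; split=> // i iq; rewrite -WE => -[l /= lN [Ly Ux]].
  have [_ Bx] := cyls_inside_sub Ux; rewrite -iterD in Bx; apply: H Bx.
  apply: leq_trans (_ : (i.+1 * (L + j) <= _)%N); last by apply: leq_mul.
  have lND : (l.+1 * D <= N * D)%N by rewrite leq_mul2r lN orbT.
  by rewrite [(i.+1 * _)%N]mulSn; rewrite mulSn in lND; move: (i * (L + j))%N => z; rewrite /L; lia.
apply: le_trans (miss_tail L Q q mu_rep mu_mixing) _.
have h := decoupled_below_le1 L Q mu_rep mu_mixing.
apply: lerXn2r; rewrite ?nnegrE ?subr_ge0 //.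
  have := pr_le1 mu (mcyls L Q); have : (16 * C)^-1 <= 1 by rewrite invf_le1 ?mulr_gt0 //; have := C1; lra.
  lra.
by rewrite lerD2l lerN2 ler_pM2l // -WE.
Qed.

End HittingIntervals.

(** * The lower bound without logarithm *)

Section CoverTimeBounds.
Variables (R : realType) (T : interval_map R).
Variables (m mu : probability (measurableTypeR R) R).
Local Notation f := (imap T).
Local Notation Lam := (repeller T).
Local Notation mR := (measurableTypeR R).
Local Notation s := (repeller_dim T).

Hypothesis m_rep : pr m Lam = 1.
Hypothesis mu_rep : pr mu Lam = 1.

Variable c : R.
Hypothesis c_gt0 : 0 < c.
Hypothesis regular : forall x r : R, Lam x -> 0 < r <= 1 ->
  r `^ s / c <= pr m (ball x r) <= c * r `^ s.

Lemma repeller_dim_ge0 : 0 <= s.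
Proof.
rewrite /repeller_dim; apply: fine_ge0; apply/ereal_infP => _ [r [r0 _] <-].
by rewrite lee_fin.
Qed.

Lemma ball_is_interval (x r : R) : is_interval (ball x r).
Proof. by rewrite ball_itv; exact: interval_is_interval. Qed.

Lemma measurable_ball_itv (x r : R) : measurable (ball x r : set mR).
Proof. by apply: is_interval_measurable; exact: ball_is_interval. Qed.

(** The balls of radius 2 delta around n + 1 points of a delta-dense orbit cover the
    repeller, and by regularity each of them carries little of the mass of m. *)
Lemma cover_time_ge (delta x : R) : 0 < delta <= 2^-1 -> Lam x ->
  (((2 * c * 2 `^ s)^-1 * delta `^ (- s))%:E <= cover_time T delta x)%E.
Proof.
move=> /andP[d0 d1] Lx; apply/ereal_infP => _ [n [n1 dn] <-]; rewrite lee_fin.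
have r01 : 0 < 2 * delta <= 1 by rewrite mulr_gt0 //= -ler_pdivlMl // mulr1.
have : pr m Lam <= \sum_(k <- iota 0 n.+1) pr m (ball (iter k f x) (2 * delta)).
  apply: pr_cover => [k||y Ly]; [exact: measurable_ball_itv|exact: measurable_repeller|].
  have [k kn yk] := dn y Ly; exists k; first by rewrite mem_iota.
  by rewrite /ball /= distrC; apply: le_lt_trans yk _; lra.
rewrite m_rep => h1.
have h2 : 1 <= n.+1%:R * (c * (2 * delta) `^ s).
  apply: le_trans h1 _; apply: le_trans (_ : \sum_(k <- iota 0 n.+1) c * (2 * delta) `^ s <= _).
    apply: ler_sum => k _; have /andP[] // := regular (repeller_iter k Lx) r01.
  by rewrite big_const_seq count_predT size_iota iter_addr_0 -[_ *+ n.+1]mulr_natl.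
have ds0 : 0 < delta `^ s by rewrite powR_gt0.
have ts0 : (0 : R) < 2 `^ s by rewrite powR_gt0.
rewrite powRN -invfM -[X in X <= _]mul1r ler_pdivrMr ?mulr_gt0 //.
apply: le_trans h2 _; rewrite powRM ?(ltW d0) //.
have -> : n%:R * (2 * c * 2 `^ s * delta `^ s) = (2 * n%:R) * (c * (2 `^ s * delta `^ s)) by ring.
apply: ler_wpM2r; first by rewrite !mulr_ge0 // ltW.
have : (1 : R) <= n%:R by rewrite ler1n.
by rewrite -natr1; lra.
Qed.

Lemma mean_cover_time_ge (delta : R) : 0 < delta <= 2^-1 ->
  (((2 * c * 2 `^ s)^-1 * delta `^ (- s))%:E <= mean_cover_time T mu delta)%E.
Proof.
move=> d01; set t := (X in X%:E); have mL := @measurable_repeller R T.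
have t0 : 0 <= t by rewrite mulr_ge0 ?invr_ge0 ?mulr_ge0 ?powR_ge0 // ltW.
have -> : t%:E = (\int[mu]_(x in Lam) (cst t%:E) x)%E.
  by rewrite integral_cst // -[X in (_ * X)%E](prE mu mL) mu_rep mule1.
by apply: integral_le_ge0 => x Lx; [rewrite lee_fin|exact: cover_time_ge].
Qed.

End CoverTimeBounds.

(** * The upper bound *)

Section CoverTimeUpperBound.
Variables (R : realType) (T : interval_map R).
Variables (m mu : probability (measurableTypeR R) R).
Local Notation f := (imap T).
Local Notation Lam := (repeller T).
Local Notation mR := (measurableTypeR R).
Local Notation s := (repeller_dim T).

Hypothesis m_rep : pr m Lam = 1.
Variable c : R.
Hypothesis c_gt0 : 0 < c.
Hypothesis regular : forall x r : R, Lam x -> 0 < r <= 1 ->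
  r `^ s / c <= pr m (ball x r) <= c * r `^ s.
Variables (n1 : nat) (D p a : R).
Hypothesis m_decay : forall k (w : seq (idx T)), (k * n1 <= size w)%N -> pr m (cyl w) <= 2 ^- k.
Hypothesis D_gt0 : 0 < D.
Hypothesis m_le_mu : forall k (Q : set (seq (idx T))), pr m (cyls k Q) <= D * pr mu (cyls k Q).
Hypothesis p01 : 0 < p < 1.
Hypothesis a_gt0 : 0 < a.
Hypothesis avoid_tail : forall n (B : set R), is_interval B -> 0 < pr mu (cyls n (@inside R T B)) ->
  forall S : nat, a / pr mu (cyls n (@inside R T B)) + n%:R + a <= S%:R ->
  forall q, pr mu (@avoid R T (q * S) B) <= (1 - p) ^+ q.

Lemma geometric_sum_le (n : nat) : \sum_(i < n) (1 - p) ^+ i <= p^-1.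
Proof.
have /andP[p0 p1] := p01.
have H : p * \sum_(i < n) (1 - p) ^+ i = 1 - (1 - p) ^+ n.
  elim: n => [|n IH]; first by rewrite big_ord0 mulr0 expr0 subrr.
  by rewrite big_ord_recr /= mulrDr IH exprS; ring.
rewrite -[leLHS]mul1r -{1}(mulVf (lt0r_neq0 p0)) -mulrA H -[leRHS]mulr1.
rewrite ler_pM2l ?invr_gt0 // gerBl exprn_ge0 //; lra.
Qed.

(** At a generation n where cylinders have at most a quarter of the mass of a ball,
    the cylinders inside the ball carry half of it.  The crude bound on n, of the
    order of the inverse mass, costs nothing since hitting takes as long. *)
Lemma inside_mass x (r : R) : Lam x -> 0 < r <= 1 ->
  exists n : nat, n%:R <= (4 * c * r `^ (- s) + 1) * n1%:R /\
    r `^ s / (2 * c * D) <= pr mu (cyls n (@inside R T (ball x r))).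
Proof.
move=> Lx r01; have /andP[r0 r1] := r01; have /andP[lb _] := regular Lx r01.
set b := r `^ s / c in lb; have b0 : 0 < b by rewrite divr_gt0 // powR_gt0.
have b4 : 0 < b / 4 by rewrite divr_gt0.
have [k [k1 k2]] := half_pow_small b4; rewrite invf_div in k1.
pose n := (k * n1)%N.
exists n; split.
  rewrite /n natrM ler_wpM2r // (le_trans k1) // lerD2r powRN.
  rewrite le_eqVlt; apply/orP; left; apply/eqP; rewrite /b; field.
  by rewrite !gt_eqF // powR_gt0.
have iB := @ball_is_interval R x r.
have [v1 [v2 [s1 s2 _ _ h]]] := interval_cyls T n iB; rewrite -/(@inside R T _) in h.
set U := cyls n _ in h *.
have mU : measurable (U : set mR) by exact: measurable_cyls.
have mL := @measurable_repeller R T.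
have mB : measurable (ball x r : set mR) by exact: measurable_ball_itv.
have mv (v : seq (idx T)) : measurable (cyl v : set mR) by exact: measurable_cyl.
have h1 : pr m (ball x r) <= pr m U + (2 ^- k + 2 ^- k).
  rewrite (pr_split _ mB mL) [X in _ + X](_ : _ = 0) ?addr0; last first.
    exact: pr_full.
  rewrite setIC; have mv12 := measurableU _ _ (mv v1) (mv v2).
  apply: le_trans (pr_le _ (measurableI _ _ mL mB) (measurableU _ _ mU mv12) h) _.
  apply: le_trans (prU_le _ mU mv12) _; rewrite lerD2l.
  apply: le_trans (prU_le _ (mv v1) (mv v2)) _.
  by apply: lerD; apply: m_decay; rewrite ?s1 ?s2.
have h2 : b / 2 <= pr m U by lra.
have := le_trans h2 (m_le_mu _ _); rewrite -ler_pdivrMl // => h3.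
apply: le_trans h3; rewrite le_eqVlt; apply/orP; left; apply/eqP; rewrite /b; field.
by rewrite !gt_eqF.
Qed.

(** Union bound over a grid: the cover time exceeds q time units only if one of
    the intervals around the grid cells has been avoided for that long. *)
Lemma mean_cover_time_le_grid (delta : R) (N S q1 : nat) : 0 < delta <= 1 ->
  (forall x, dom T x -> `|x| <= N%:R * delta / 4) -> (0 < S)%N ->
  2 * c * D * a * (delta / 2) `^ (- s) + (4 * c * (delta / 2) `^ (- s) + 1) * n1%:R + a <= S%:R ->
  N.+1%:R * (1 - p) ^+ q1 <= 1 ->
  (mean_cover_time T mu delta <= (S%:R * (q1%:R + p^-1))%:E)%E.
Proof.
move=> /andP[d0 d1] domN S0 HS Hq1; have /andP[p0 p1] := p01.
set r := delta / 2 in HS; have r0 : 0 < r by rewrite divr_gt0.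
have r01 : 0 < r <= 1 by rewrite r0 /r; lra.
have mL := @measurable_repeller R T.
pose lo := - (N%:R * delta / 4).
have domlo x : dom T x -> lo <= x by move=> /domN; rewrite ler_norml => /andP[].
pose lab x := Num.truncn ((x - lo) / r).
have labN x : dom T x -> (lab x < N.+1)%N.
  move=> Ix; rewrite ltnS -(ler_nat R).
  have h0 : 0 <= (x - lo) / r by rewrite divr_ge0 ?subr_ge0 ?(ltW r0) //; exact: domlo.
  have /andP[h1 _] := truncn_itv h0; apply: le_trans h1 _.
  rewrite ler_pdivrMr // /r /lo; have := domN x Ix; rewrite ler_norml => /andP[_]; lra.
(* One point of the repeller in each cell that meets it; the cells have length r. *)
pose y l := xget 0 [set x | Lam x /\ lab x = l].
pose ls := [seq l <- iota 0 N.+1 | `[< Lam (y l) /\ lab (y l) = l >]].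
have yP x : Lam x -> lab x \in ls /\ `|x - y (lab x)| <= r.
  move=> Lx; have [Ly ly] : Lam (y (lab x)) /\ lab (y (lab x)) = lab x.
    by apply: (@xgetI _ 0 [set z | Lam z /\ lab z = lab x] x).
  split; last by apply: (@cell_close _ lo r) => //; apply: domlo; [case: Lx|case: Ly].
  by rewrite mem_filter mem_iota /= labN ?andbT; [apply/asboolP|case: Lx].
pose W q : set R := if q is 0 then Lam else \bigcup_(l in [set` ls]) @avoid R T (q * S) (ball (y l) r).
have mav q l : measurable (@avoid R T (q * S) (ball (y l) r) : set mR).
  by apply: measurable_avoid; exact: measurable_ball_itv.
have mW q : measurable (W q : set mR).
  by case: q => [|q] //=; rewrite bigcup_seq; apply: bigsetU_measurable.
have avle l q : l \in ls -> pr mu (@avoid R T (q * S) (ball (y l) r)) <= (1 - p) ^+ q.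
  rewrite mem_filter => /andP[/asboolP[Ly _] _].
  have [n [nle Un]] := inside_mass Ly r01.
  set u := pr mu _ in Un; have rs0 : 0 < r `^ s by rewrite powR_gt0.
  have u0 : 0 < u by apply: lt_le_trans Un; rewrite divr_gt0 // !mulr_gt0.
  apply: (avoid_tail (n := n)) => //; first exact: ball_is_interval.
  apply: le_trans HS; rewrite lerD2r lerD // -/u.
  rewrite ler_pdivrMr //; apply: (@le_trans _ _ (2 * c * D * a * r `^ (- s) * (r `^ s / (2 * c * D)))).
    rewrite powRN le_eqVlt; apply/orP; left; apply/eqP; field.
    by rewrite !gt_eqF.
  by apply: ler_wpM2l => //; rewrite !mulr_ge0 ?powR_ge0 // ltW.
have Wle1 q : pr mu (W q) <= 1 by exact: pr_le1.
have sz : (size ls <= N.+1)%N.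
  by rewrite size_filter; apply: leq_trans (count_size _ _) _; rewrite size_iota.
have Wle q : pr mu (W (q1 + q)%N) <= (1 - p) ^+ q.
  case E : (q1 + q)%N => [|q'].
    by move/eqP: E; rewrite addn_eq0 => /andP[_ /eqP->]; rewrite expr0.
  rewrite /= -E.
  apply: le_trans (_ : \sum_(l <- ls) pr mu (@avoid R T ((q1 + q) * S) (ball (y l) r)) <= _).
    apply: pr_cover => //.
    by rewrite bigcup_seq; apply: bigsetU_measurable.
  apply: le_trans (_ : \sum_(l <- ls) (1 - p) ^+ (q1 + q) <= _).
    by rewrite big_seq [leRHS]big_seq; apply: ler_sum => l lls; exact: avle.
  rewrite big_const_seq count_predT iter_addr_0 -[_ *+ size ls]mulr_natl exprD mulrA.
  have p1' : 0 <= 1 - p by lra.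
  rewrite -[leRHS]mul1r ler_wpM2r ?exprn_ge0 //; apply: le_trans Hq1.
  by rewrite ler_wpM2r ?exprn_ge0 // ler_nat.
apply: (@mean_le_tail _ mR R mu Lam W (cover_time T delta) S%:R _ mL mW).
- by rewrite ltr0n.
- by move=> x _; apply/ereal_infP => _ [n _ <-]; rewrite lee_fin.
- move=> [|q] x Lx; first by move=> /(_ Lx).
  move=> nW; apply: ereal_inf_lbound; exists (q.+1 * S)%N; last by rewrite natrM.
  split; first by rewrite muln_gt0.
  move=> z Lz; have [lls zy] := yP z Lz.
  have [k [kq Bk]] : exists k, (k < q.+1 * S)%N /\ ball (y (lab z)) r (iter k f x).
    apply: contrapT => /forallNP no; apply: nW; exists (lab z) => //; split=> // k kq Bk.
    exact: (no k).
  exists k; first exact: ltnW.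
  move: Bk; rewrite /ball /= => Bk.
  have := ler_normD (z - y (lab z)) (y (lab z) - iter k f x).
  by rewrite subrKA => /le_trans; apply; rewrite /r in zy Bk *; lra.
- move=> n; apply: le_trans (_ : \sum_(q < q1 + n) pr mu (W q) <= _).
    rewrite -!(big_mkord xpredT (fun q => pr mu (W q))) (@big_cat_nat _ _ _ n 0 (q1 + n)) //=; last exact: leq_addl.
    by rewrite lerDl; apply: sumr_ge0 => q _; exact: pr_ge0.
  rewrite big_split_ord /= lerD //.
    apply: le_trans (_ : \sum_(i < q1) 1 <= _); first by apply: ler_sum => i _; exact: Wle1.
    by rewrite sumr_const card_ord.
  by apply: le_trans (geometric_sum_le n); apply: ler_sum => i _; exact: Wle.
Qed.

(** The grid has of the order of 1 / delta cells, so that a number of time units of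
    the order of log (1 / delta) makes the union bound summable; a time unit is of
    the order of delta ^ (- s). *)
Lemma mean_cover_time_le : exists C delta0 : R, [/\ 0 < C, 0 < delta0 &
  forall delta, 0 < delta < delta0 ->
    (mean_cover_time T mu delta <= (C * delta `^ (- s) * ln (1 / delta))%:E)%E].
Proof.
have /andP[p0 p1] := p01; have s0 := repeller_dim_ge0 T.
have [M M1 domM] : exists2 M : R, 1 <= M & forall x, dom T x -> `|x| <= M.
  have [M [_ HM]] := @dom_bounded _ T; exists (`|M| + 1); first by rewrite lerDr.
  move=> x Ix; have /(_ _ Ix) // : globally (dom T) [set y | `|y| <= `|M| + 1].
  by apply: HM; rewrite (le_lt_trans (ler_norm M)) // ltrDl.
pose A := 2 * c * D * a * 2 `^ s + (4 * c * 2 `^ s + 1) * n1%:R + a + 1.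
have ts0 : (0 : R) < 2 `^ s by rewrite powR_gt0.
have A0 : 0 < A.
  rewrite /A ltr_pwDr // !addr_ge0 ?(ltW a_gt0) //; rewrite !mulr_ge0 ?addr_ge0 //; try exact: ltW.
  by rewrite !mulr_ge0 // ltW.
pose E := (ln (6 * M) + 1) / p + 1 + p^-1.
have lnM0 : 0 <= ln (6 * M) by rewrite ln_ge0 //; lra.
have E0 : 0 < E.
  by rewrite /E ltr_wpDl ?invr_gt0 // addr_ge0 // divr_ge0 ?addr_ge0 // ltW.
exists (A * E), (expR (- 1)); split; [by rewrite mulr_gt0|exact: expR_gt0|].
move=> delta /andP[d0 de].
have d1 : delta < 1 by apply: lt_trans de _; rewrite -[ltRHS]expR0 ltr_expR; lra.
have ln1 : 1 <= ln (1 / delta).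
  rewrite div1r lnV ?posrE // lerNr -ler_expR lnK ?posrE //; exact: ltW.
have ds1 : 1 <= delta `^ (- s).
  rewrite powRN -[1]invr1 lef_pV2 ?posrE ?powR_gt0 //.
  by apply: le_trans (ge0_ler_powR s0 _ _ (ltW d1)) _; rewrite ?nnegrE ?(ltW d0) // powR1.
set ds := delta `^ (- s) in ds1 *.
have rds : (delta / 2) `^ (- s) = 2 `^ s * ds.
  rewrite powRN powRM ?(ltW d0) ?invr_ge0 // invfM mulrC /ds powRN; congr (_ * _).
  have h : 2^-1 `^ s * 2 `^ s = 1 :> R by rewrite -powRM // mulVf // powR1.
  have n0 : 2^-1 `^ s != 0 :> R by rewrite gt_eqF // powR_gt0.
  by apply: (mulfI n0); rewrite mulfV // h.
pose N := (Num.truncn (4 * M / delta)).+1.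
pose S := Num.truncn (A * ds).
pose q1 := (Num.truncn (ln N.+1%:R / p)).+1.
have lnN0 : 0 <= ln (N.+1%:R : R) by rewrite ln_ge0 // ler1n.
have SA : S%:R <= A * ds by rewrite truncn_le // mulr_ge0 ?(ltW A0) //; lra.
have SA' : A * ds < S%:R + 1 by rewrite natr1; exact: truncnS_gt.
have h0 : 0 <= 2 * c * D * a * 2 `^ s by rewrite !mulr_ge0 // ltW.
have h1 : 0 <= 4 * c * 2 `^ s by rewrite !mulr_ge0 // ltW.
have h2 : 0 <= (n1%:R : R) by [].
have h3 : 0 <= 4 * c * 2 `^ s * n1%:R by rewrite mulr_ge0.
have Sbig : 2 * c * D * a * (2 `^ s * ds) + (4 * c * (2 `^ s * ds) + 1) * n1%:R + a + 1 <= A * ds.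
  have -> : A * ds = 2 * c * D * a * (2 `^ s * ds) + (4 * c * (2 `^ s * ds)) * n1%:R + n1%:R * ds + a * ds + ds.
    by rewrite /A; ring.
  have : n1%:R <= n1%:R * ds by rewrite ler_peMr.
  have : a <= a * ds by rewrite ler_peMr // ltW.
  lra.
apply: le_trans (mean_cover_time_le_grid (N := N) (S := S) (q1 := q1) _ _ _ _ _) _.
- by rewrite d0 ltW.
- move=> x Ix; apply: le_trans (domM x Ix) _.
  have : 4 * M / delta < N%:R by exact: truncnS_gt.
  by rewrite ltr_pdivrMr //; lra.
- rewrite -(ltr_nat R); have hx : 0 <= 2 * c * D * a * (2 `^ s * ds) + (4 * c * (2 `^ s * ds) + 1) * n1%:R.
    by rewrite addr_ge0 ?mulr_ge0 ?addr_ge0 ?mulr_ge0 ?mulr_ge0 //; try lra; rewrite ltW.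
  have := a_gt0; lra.
- by rewrite rds; lra.
- have e1 : (1 - p) ^+ q1 <= N.+1%:R^-1.
    apply: le_trans (_ : expR (- p) ^+ q1 <= _).
      by apply: lerXn2r; rewrite ?nnegrE ?expR_ge0 //; [lra|exact: expR_ge1Dx].
    rewrite -expRM_natl -[N.+1%:R]lnK ?posrE ?ltr0n // -expRN ler_expR mulrN lerN2 -ler_pdivrMr //.
    exact/ltW/truncnS_gt.
  by rewrite -ler_pdivlMl ?ltr0n // mulr1.
rewrite lee_fin.
have q1E : q1%:R + p^-1 <= E * ln (1 / delta).
  have hq : q1%:R <= ln N.+1%:R / p + 1.
    by rewrite /q1 -natr1 lerD2r truncn_le // divr_ge0 // ltW.
  have hN : ln (N.+1%:R : R) <= (ln (6 * M) + 1) * ln (1 / delta).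
    apply: (@le_trans _ _ (ln (6 * M * (1 / delta)))).
      rewrite ler_ln ?posrE ?ltr0n //; last by rewrite mulr_gt0 ?divr_gt0 //; lra.
      have hn : N.+1%:R <= 4 * M / delta + 2.
        rewrite /N -natr1 -natr1 -addrA; have -> : 1 + 1 = 2 :> R by lra.
        by rewrite lerD2r truncn_le // divr_ge0 ?(ltW d0) //; lra.
      apply: le_trans hn _; rewrite mulrA mulr1.
      have : 2 <= 2 * M / delta by rewrite ler_pdivlMr //; nra.
      have -> : 6 * M / delta = 4 * M / delta + 2 * M / delta by field; rewrite gt_eqF.
      lra.
    rewrite lnM ?posrE ?divr_gt0 //; last by lra.
    set z := ln (1 / delta) in ln1 *.
    by rewrite (mulrDl (ln (6 * M))) mul1r lerD2r ler_peMr.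
  have hNp : ln (N.+1%:R : R) / p <= (ln (6 * M) + 1) * ln (1 / delta) / p.
    by rewrite ler_wpM2r // invr_ge0 ltW.
  have hp : p^-1 <= p^-1 * ln (1 / delta) by rewrite ler_peMr // invr_ge0 ltW.
  have -> : E * ln (1 / delta) = (ln (6 * M) + 1) * ln (1 / delta) / p + ln (1 / delta) + p^-1 * ln (1 / delta).
    by rewrite /E; ring.
  lra.
apply: (@le_trans _ _ (A * ds * (E * ln (1 / delta)))).
  by rewrite ler_pM // addr_ge0 // invr_ge0 ltW.
by rewrite le_eqVlt; apply/orP; left; apply/eqP; ring.
Qed.

End CoverTimeUpperBound.

(** * Collecting non-overlapping targets *)

Section NonOverlappingTargets.
Variables (R : realType) (T : interval_map R) (mu : probability (measurableTypeR R) R).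
Local Notation f := (imap T).
Local Notation Lam := (repeller T).
Local Notation mR := (measurableTypeR R).
Implicit Types (w : seq (idx T)) (P Q : set (seq (idx T))) (A B : set mR).

Hypothesis mu_rep : pr mu Lam = 1.
Variable C : R.
Hypothesis C_gt0 : 0 < C.
Hypothesis mu_decouple : forall n k P Q,
  pr mu (cyls n P `&` back T n (cyls k Q)) <= C * (pr mu (cyls n P) * pr mu (cyls k Q)).

Variables (I : finType) (target : I -> seq (idx T)) (p : R).
Hypothesis target_gt0 : forall i, (0 < size (target i))%N.
Hypothesis target_mass : forall i, C * pr mu (cyl (target i)) <= p.
Hypothesis non_overlapping : forall z i i' k k', Lam z ->
  cyl (target i) (iter k f z) -> cyl (target i') (iter k' f z) ->
  (k <= k' < k + size (target i))%N -> k = k' /\ i = i'.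

(** A target is seen by time t if it has been completed in the first t letters.  As a
    condition on words this is measurable and independent of the later letters. *)
Definition seen_in w (i : I) : bool :=
  [exists k : 'I_(size w).+1, (k + size (target i) <= size w)%N &&
     (take (size (target i)) (drop k w) == target i)].

Definition unseen t (z : R) : {set I} := [set i | ~~ seen_in (itin T t z) i].

Lemma unseenP t z i : Lam z -> i \notin unseen t z <->
  exists2 k, (k + size (target i) <= t)%N & cyl (target i) (iter k f z).
Proof.
move=> Lz; rewrite inE negbK /seen_in size_itin; split.
  move=> /existsP [[k kt] /= /andP[kti]]; rewrite take_drop_itin // => /eqP e.
  by exists k => //; apply/cylP; split=> //; exact: repeller_iter.
move=> [k kti /cylP [_ e]]; apply/existsP.
have kt : (k < t.+1)%N by rewrite ltnS; apply: leq_trans kti; exact: leq_addr.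
by exists (Ordinal kt) => /=; rewrite kti take_drop_itin // e eqxx.
Qed.

Lemma unseen_mono t t' z : Lam z -> (t <= t')%N -> unseen t' z \subset unseen t z.
Proof.
move=> Lz tt; apply/fintype.subsetP => i; apply: contraTT => /(unseenP _ _ Lz) [k kt ck].
by apply/(unseenP _ _ Lz); exists k => //; exact: leq_trans tt.
Qed.

Lemma unseen0 z : Lam z -> unseen 0 z = [set: I]%SET.
Proof.
move=> Lz; apply/setP => i; rewrite finset.in_setT; apply/negPn/negP => /(unseenP _ _ Lz) [k].
by have := target_gt0 i; case: (size _) => // n _; rewrite addnS.
Qed.

(** When a target is first completed, no other target is being completed or under
    way, so that the progress made so far is known before this target begins. *)
Lemma unseen_step t z i : Lam z -> i \in unseen t z -> i \notin unseen t.+1 z ->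
  exists2 k, (k + size (target i) = t.+1)%N &
    [/\ cyl (target i) (iter k f z), unseen k z = unseen t z &
        unseen t.+1 z = unseen t z :\ i].
Proof.
move=> Lz it /(unseenP _ _ Lz) [k kt ck].
have kt1 : (k + size (target i) = t.+1)%N.
  apply/eqP; rewrite eqn_leq kt /= leqNgt; apply/negP => lt.
  by move: it; apply/negP/(unseenP _ _ Lz); exists k.
exists k => //; split=> //.
  apply/setP => i'; apply/idP/idP; last first.
    apply/fintype.subsetP; apply: unseen_mono => //.
    by rewrite -ltnS -kt1 -addn1 leq_add2l.
  apply: contraTT => /(unseenP _ _ Lz) [k' kt' ck'].
  apply/(unseenP _ _ Lz); exists k' => //; rewrite leqNgt; apply/negP => kk'.
  have [k'k|kk] := leqP k' k.
    have [ekk eii] := non_overlapping Lz ck' ck (introT andP (conj k'k kk')).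
    by move: kt'; rewrite ekk eii kt1 ltnn.
  have k't : (k' < k + size (target i))%N.
    by rewrite kt1 ltnS; apply: leq_trans kt'; exact: leq_addr.
  have [ekk _] := non_overlapping Lz ck ck' (introT andP (conj (ltnW kk) k't)).
  by rewrite ekk ltnn in kk.
apply/setP => i'; rewrite !inE -/(unseen t z) -/(unseen t.+1 z).
have [->|ne] := eqVneq i' i; first by apply/negbTE; rewrite negbK; have := (unseenP t.+1 i Lz).2 (ex_intro2 _ _ k kt ck); rewrite inE negbK.
rewrite andTb; have sub := fintype.subsetP (unseen_mono Lz (leqnSn t)) i'; rewrite !inE in sub.
apply/idP/idP => //; apply: contraTT => s'; have : i' \notin unseen t.+1 z by rewrite inE.
move=> /(unseenP _ _ Lz) [k' kt' ck'].
have [k't|k't] := leqP (k' + size (target i')) t.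
  by have := (unseenP t i' Lz).2 (ex_intro2 _ _ k' k't ck'); rewrite inE.
have kt1' : (k' + size (target i') = t.+1)%N by apply/eqP; rewrite eqn_leq kt'.
exfalso; move/eqP: ne; apply; have [k'k|kk] := leqP k' k.
  have lt : (k < k' + size (target i'))%N by rewrite kt1' -kt1 -addn1 leq_add2l.
  by have [] := non_overlapping Lz ck' ck (introT andP (conj k'k lt)).
have lt : (k' < k + size (target i))%N by rewrite kt1 -kt1' -addn1 leq_add2l.
by have [_ ->] := non_overlapping Lz ck ck' (introT andP (conj (ltnW kk) lt)).
Qed.

Definition harmonic (n : nat) : R := \sum_(k < n) k.+1%:R^-1.

Definition unseen_mass t (S : {set I}) : R := pr mu (Lam `&` unseen t @^-1` [set S]).

Lemma unseen_cyls t (S : {set I}) : Lam `&` unseen t @^-1` [set S] =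
  cyls t [set w | [set i | ~~ seen_in w i]%SET = S].
Proof. by apply/seteqP; split. Qed.

Let mseen t S : measurable (Lam `&` unseen t @^-1` [set S] : set mR).
Proof. by rewrite unseen_cyls; exact: measurable_cyls. Qed.

Let mcyl (w : seq (idx T)) : measurable (cyl w : set mR).
Proof. exact: measurable_cyl. Qed.

Definition potential t : R := \sum_(S : {set I}) harmonic #|S| * unseen_mass t S.

(** The harmonic potential drops by 1/u when one of u remaining targets is hit, so
    that its mean speed of decrease is at most the mass of one target. *)
Lemma potential_drop t : potential t - potential t.+1 <=
  \sum_(S : {set I}) \sum_(i in S) #|S|%:R^-1 *
    (if (size (target i) <= t.+1)%N then p * unseen_mass (t.+1 - size (target i)) S else 0).
Proof.
pose h z := (unseen t z, unseen t.+1 z).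
pose c S S' := pr mu (Lam `&` h @^-1` [set (S, S')]).
have hE S S' : Lam `&` h @^-1` [set (S, S')] =
    (Lam `&` unseen t @^-1` [set S]) `&` (Lam `&` unseen t.+1 @^-1` [set S']).
  by apply/seteqP; split=> z; [move=> [Lz [<- <-]]|move=> [[Lz e] [_ e']]; split=> //; congr pair].
have mh SS : measurable (Lam `&` h @^-1` [set SS] : set mR).
  by case: SS => S S'; rewrite hE; exact: measurableI.
have q1 S : unseen_mass t S = \sum_S' c S S'.
  rewrite /unseen_mass (@pr_partition _ mR R mu _ (unseen t.+1)).
    apply: eq_bigr => S' _; rewrite /c hE; congr pr.
    by apply/seteqP; split=> z; [move=> [[Lz e] e']|move=> [[Lz e] [_ e']]].
  move=> S'; rewrite (_ : (Lam `&` unseen t @^-1` [set S]) `&` _ = Lam `&` h @^-1` [set (S, S')]) //.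
  by rewrite hE; apply/seteqP; split=> z; [move=> [[Lz e] e']|move=> [[Lz e] [_ e']]].
have q2 S' : unseen_mass t.+1 S' = \sum_S c S S'.
  rewrite /unseen_mass (@pr_partition _ mR R mu _ (unseen t)).
    apply: eq_bigr => S _; rewrite /c hE; congr pr.
    by apply/seteqP; split=> z; [move=> [[Lz e] e']|move=> [[Lz e] [_ e']]].
  move=> S; rewrite (_ : (Lam `&` unseen t.+1 @^-1` [set S']) `&` _ = Lam `&` h @^-1` [set (S, S')]) //.
  by rewrite hE; apply/seteqP; split=> z; [move=> [[Lz e] e']|move=> [[Lz e] [_ e']]].
have -> : potential t = \sum_(S : {set I}) \sum_(S' : {set I}) harmonic #|S| * c S S'.
  by apply: eq_bigr => S _; rewrite q1 mulr_sumr.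
have -> : potential t.+1 = \sum_(S : {set I}) \sum_(S' : {set I}) harmonic #|S'| * c S S'.
  by rewrite exchange_big; apply: eq_bigr => S' _; rewrite q2 mulr_sumr.
rewrite -sumrB; apply: ler_sum => S _; rewrite -sumrB.
pose e i := if (size (target i) <= t.+1)%N then p * unseen_mass (t.+1 - size (target i)) S else 0.
have c_le i : i \in S -> c S (S :\ i) <= e i.
  move=> iS; rewrite /c /e; have [[z [Lz [eS eS']]]|/forallNP c0] :=
    pselect (exists z, (Lam `&` h @^-1` [set (S, S :\ i)]) z); last first.
    rewrite (_ : _ `&` _ = set0) ?pr0; last by apply/seteqP; split=> // z /c0.
    case: ifP => // _; rewrite mulr_ge0 ?pr_ge0 //.
    by apply: le_trans (target_mass i); rewrite mulr_ge0 ?pr_ge0 // ltW.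
  have step z' : Lam z' -> h z' = (S, S :\ i) -> exists2 k, (k + size (target i) = t.+1)%N &
      cyl (target i) (iter k f z') /\ unseen k z' = S.
    move=> Lz' [e1 e2]; have iu : i \in unseen t z' by rewrite e1.
    have nu : i \notin unseen t.+1 z' by rewrite e2 !inE eqxx.
    by have [k kt [ck ek _]] := unseen_step Lz' iu nu; exists k; rewrite // ek.
  have [k kt _] := step z Lz (congr2 pair eS eS').
  have -> : (size (target i) <= t.+1)%N by rewrite -kt leq_addl.
  have -> : (t.+1 - size (target i) = k)%N by rewrite -kt addnK.
  apply: le_trans (_ : pr mu (cyls k [set w | [set i | ~~ seen_in w i]%SET = S] `&`
      back T k (cyls (size (target i)) [set target i])) <= _).
    apply: pr_le => //.
      apply: measurableI; first exact: measurable_cyls.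
      by apply: measurable_back; exact: measurable_cyls.
    move=> z' [Lz' hz']; have [k' kt' [ck' ek']] := step z' Lz' hz'.
    have <- : k' = k by apply/eqP; rewrite -(eqn_add2r (size (target i))) kt kt'.
    by rewrite cyls1 -unseen_cyls.
  apply: le_trans (mu_decouple _ _ _ _) _; rewrite cyls1 -unseen_cyls -/(unseen_mass k S).
  by rewrite mulrCA mulrC ler_wpM2r ?pr_ge0.
apply: le_trans (_ : \sum_(S' : {set I}) \sum_(i in S) #|S|%:R^-1 * ((S' == S :\ i)%:R * c S S') <= _).
  apply: ler_sum => S' _; rewrite -mulrBl.
  have nn i : 0 <= #|S|%:R^-1 * ((S' == S :\ i)%:R * c S S') by rewrite !mulr_ge0 ?invr_ge0 ?pr_ge0.
  have [[z [Lz [eS eS']]]|/forallNP c0] := pselect (exists z, (Lam `&` h @^-1` [set (S, S')]) z); last first.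
    rewrite /c (_ : _ `&` _ = set0) ?pr0 ?mulr0; last by apply/seteqP; split=> // z /c0.
    by apply: sumr_ge0 => i _; rewrite !mulr0.
  have [E|ne] := eqVneq S' S; first by rewrite {1}E subrr mul0r; apply: sumr_ge0 => i _; exact: nn.
  have [i iS iS'] : exists2 i, i \in S & i \notin S'.
    apply: contrapT => no; move/eqP: ne; apply; apply/eqP; rewrite finset.eqEsubset; apply/andP; split.
      by rewrite -eS -eS'; exact: unseen_mono.
    by apply/fintype.subsetP => i iS; apply/negPn/negP => iS'; apply: no; exists i.
  have iu : i \in unseen t z by rewrite eS.
  have nu : i \notin unseen t.+1 z by rewrite eS'.
  have [k kt [_ _]] := unseen_step Lz iu nu; rewrite eS eS' => S'E.
  rewrite (bigD1 i) //= S'E eqxx mul1r.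
  have -> : harmonic #|S| - harmonic #|S :\ i| = #|S|%:R^-1.
    by rewrite (cardsD1 i S) iS add1n /harmonic big_ord_recr /= addrAC subrr add0r.
  by rewrite lerDl; apply: sumr_ge0 => i' _; rewrite -S'E; exact: nn.
rewrite exchange_big /=; apply: ler_sum => i iS; rewrite -mulr_sumr ler_wpM2l ?invr_ge0 //.
rewrite (bigD1 (S :\ i)) //= eqxx mul1r big1 ?addr0; first exact: c_le.
by move=> S' /negbTE ->; rewrite mul0r.
Qed.

Lemma shifted_sum_le (Q : nat -> R) l n : (forall k, 0 <= Q k) -> (0 < l)%N ->
  \sum_(t < n) (if (l <= t.+1)%N then Q (t.+1 - l)%N else 0) <= \sum_(k < n) Q k.
Proof.
move=> Q0; case: l => // l _; have -> : \sum_(t < n) (if (l.+1 <= t.+1)%N then Q (t.+1 - l.+1)%N else 0)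
    = \sum_(k < n - l) Q k.
  elim: n => [|n IH]; first by rewrite sub0n !big_ord0.
  rewrite big_ord_recr /= IH ltnS subSS; case: leqP => ln; first by rewrite subSn // big_ord_recr.
  by rewrite addr0 (eqP (ltnW ln)) (eqP ln).
rewrite -!(big_mkord xpredT Q) (@big_cat_nat _ _ _ (n - l) 0 n) //= ?leq_subr //.
by rewrite lerDl; apply: sumr_ge0.
Qed.

Definition unseen_prob t : R := pr mu (Lam `&` [set z | unseen t z != finset.set0]).

Lemma unseen_probE t : unseen_prob t = \sum_(S | S != finset.set0) unseen_mass t S.
Proof.
have mP : measurable (Lam `&` [set z | unseen t z != finset.set0] : set mR).
  rewrite (_ : _ `&` _ = cyls t [set w | [set i | ~~ seen_in w i]%SET != finset.set0]).
    exact: measurable_cyls.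
  by apply/seteqP; split.
rewrite /unseen_prob (@pr_partition _ mR R mu _ (unseen t)); last first.
  move=> S; rewrite (_ : (Lam `&` [set z | unseen t z != finset.set0]) `&` _ =
      (Lam `&` [set z | unseen t z != finset.set0]) `&` (Lam `&` unseen t @^-1` [set S])).
    by apply: measurableI; [exact: mP|exact: mseen].
  by apply/seteqP; split=> z; [move=> [[Lz e] e']|move=> [[Lz e] [_ e']]].
rewrite [RHS]big_mkcond; apply: eq_bigr => S _; case: ifP => S0.
  by congr pr; apply/seteqP; split=> z; [move=> [[Lz e] e']|move=> [Lz e]; split=> //; split=> //=; rewrite (e : unseen t z = S) S0].
rewrite (_ : _ `&` _ = set0) ?pr0 //; apply/seteqP; split=> // z [[_ /= e] e'].
by move: e; rewrite e' S0.
Qed.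

(** The decrease of the potential from time 0, when it is the harmonic number of all
    the targets, is at most its speed p times the time spent with a target unseen. *)
Lemma harmonic_sweep n :
  harmonic #|I| * (1 - unseen_prob n) <= p * \sum_(k < n) unseen_prob k.
Proof.
have p0 (i : I) : 0 <= p by apply: le_trans (target_mass i); rewrite mulr_ge0 ?pr_ge0 // ltW.
have m0 t S : 0 <= unseen_mass t S := pr_ge0 _ _.
have H : potential 0 - potential n <= p * \sum_(k < n) unseen_prob k.
  have -> : potential 0 - potential n = \sum_(t < n) (potential t - potential t.+1).
    elim: n => [|n IH]; first by rewrite big_ord0 subrr.
    by rewrite big_ord_recr /= -IH; ring.
  apply: le_trans (ler_sum _ (fun (t : 'I_n) _ => potential_drop t)) _.
  rewrite exchange_big /= (eq_bigr (fun k : 'I_n => \sum_(S | S != finset.set0) unseen_mass k S)); last first.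
    by move=> k _; exact: unseen_probE.
  rewrite [X in p * X]exchange_big /= mulr_sumr [leRHS]big_mkcond; apply: ler_sum => S _.
  have [->|S0] := eqVneq S finset.set0.
    by rewrite big1 // => t _; rewrite big_set0.
  rewrite exchange_big /=.
  apply: le_trans (_ : \sum_(i in S) #|S|%:R^-1 * (p * \sum_(k < n) unseen_mass k S) <= _).
    apply: ler_sum => i iS; rewrite -mulr_sumr ler_wpM2l ?invr_ge0 // mulr_sumr.
    apply: (@shifted_sum_le (fun k => p * unseen_mass k S)) => // k.
    by rewrite mulr_ge0 // (p0 i).
  rewrite sumr_const -[_ *+ #|S|]mulr_natl mulrA mulfV ?mul1r //.
  by rewrite pnatr_eq0 cards_eq0.
apply: le_trans H; rewrite mulrBr mulr1 lerB //.
  rewrite /potential (bigD1 [set: I]%SET) //= cardsT.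
  have -> : unseen_mass 0 [set: I]%SET = 1.
    rewrite /unseen_mass -mu_rep; congr pr; apply/seteqP; split=> z; first by case.
    by move=> Lz; split=> //=; exact: unseen0.
  by rewrite mulr1 lerDl; apply: sumr_ge0 => S _; rewrite mulr_ge0 // sumr_ge0 // => k _; rewrite invr_ge0.
rewrite unseen_probE mulr_sumr /potential (bigD1 finset.set0) //= cards0.
rewrite {1}/harmonic big_ord0 mul0r add0r; apply: ler_sum => S _; rewrite ler_wpM2r //.
rewrite /harmonic -!(big_mkord xpredT (fun k => k.+1%:R^-1)) (@big_cat_nat _ _ _ #|S| 0 #|I|) //= ?max_card //.
by rewrite lerDl; apply: sumr_ge0 => k _; rewrite invr_ge0.
Qed.

End NonOverlappingTargets.

Section SweepingTime.
Variables (R : realType) (T : interval_map R) (mu : probability (measurableTypeR R) R).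
Local Notation f := (imap T).
Local Notation Lam := (repeller T).
Local Notation mR := (measurableTypeR R).
Implicit Types (w : seq (idx T)) (P Q : set (seq (idx T))) (A B : set mR).

Hypothesis mu_rep : pr mu Lam = 1.
Variable C : R.
Hypothesis C_gt0 : 0 < C.
Hypothesis mu_decouple : forall n k P Q,
  pr mu (cyls n P `&` back T n (cyls k Q)) <= C * (pr mu (cyls n P) * pr mu (cyls k Q)).

Variables (I : finType) (target : I -> seq (idx T)) (p : R).
Hypothesis target_gt0 : forall i, (0 < size (target i))%N.
Hypothesis target_mass : forall i, C * pr mu (cyl (target i)) <= p.
Hypothesis non_overlapping : forall z i i' k k', Lam z ->
  cyl (target i) (iter k f z) -> cyl (target i') (iter k' f z) ->
  (k <= k' < k + size (target i))%N -> k = k' /\ i = i'.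

Hypothesis p_ge0 : 0 <= p.
Variables (delta : R) (y : I -> R) (l : nat).
Hypothesis y_rep : forall i, Lam (y i).
Hypothesis y_deep : forall i z, Lam z -> `|y i - z| <= delta -> cyl (target i) z.
Hypothesis target_size : forall i, (size (target i) <= l)%N.

Local Notation unseen := (unseen target).
Local Notation unseen_prob := (unseen_prob mu target).

(** A delta-dense orbit segment comes close to y i, hence enters the i-th target; at
    most l further letters complete it. *)
Lemma dense_unseen n t z : Lam z -> orbit_dense T delta n z -> (n + l <= t)%N ->
  unseen t z = finset.set0.
Proof.
move=> Lz dn nt; apply/eqP; rewrite -finset.subset0; apply/fintype.subsetP => i; apply: contraTT => _.
have [k kn yk] := dn (y i) (y_rep i).
apply/(unseenP _ _ _ Lz); exists k; first by apply: leq_trans nt; exact: leq_add.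
by apply: y_deep => //; exact: repeller_iter.
Qed.

Let D t : set R := Lam `&` [set z | unseen t z != finset.set0].

Let mD t : measurable (D t : set mR).
Proof.
rewrite (_ : D t = cyls t [set w | [set i | ~~ seen_in target w i]%SET != finset.set0]).
  exact: measurable_cyls.
by apply/seteqP; split.
Qed.

Lemma unseen_prob_mean (b : R) n : (mean_cover_time T mu delta <= b%:E)%E ->
  \sum_(k < n) unseen_prob (l + k) <= b.
Proof.
move=> mb; rewrite -lee_fin; apply: le_trans mb; have mL := @measurable_repeller R T.
pose F (k : 'I_n) (z : R) : \bar R := (\1_(D (l + k)) z)%:E.
have -> : (\sum_(k < n) unseen_prob (l + k))%:E = (\int[mu]_(z in Lam) \sum_(k < n) F k z)%E.
  rewrite ge0_integral_sum //; last 2 first.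
  - by move=> k; apply/measurable_EFinP; exact: measurable_indic.
  - by move=> k z _; rewrite lee_fin.
  rewrite -sumEFin; apply: eq_bigr => k _; rewrite /F integral_indic //.
  apply: etrans (@prE _ mR _ mu (D (l + k)) (mD _)) _; congr (mu _).
  by apply/esym/setIidPl => z [].
apply: integral_le_ge0 => z Lz.
  by apply: sume_ge0 => k _; rewrite lee_fin.
apply/ereal_infP => _ [N [N1 dN] <-].
rewrite /F sumEFin lee_fin.
apply: (@le_trans _ _ (\sum_(k < n) (if (k < N)%N then 1 else 0))).
  apply: ler_sum => k _; case: ltnP => kN; first by rewrite indicE; case: (_ \in _).
  rewrite indicE memNset // => -[_] /=.
  by rewrite (dense_unseen Lz dN) ?eqxx // addnC leq_add2l.
have -> : \sum_(k < n) (if (k < N)%N then 1 else 0) = (minn n N)%:R :> R.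
  elim: n {F} => [|n IH]; first by rewrite big_ord0 min0n.
  rewrite big_ord_recr /= IH; case: ltnP => nN.
    by rewrite natr1; congr _%:R; lia.
  by rewrite addr0; congr _%:R; lia.
by rewrite ler_nat geq_minr.
Qed.

(** Collecting all the targets takes a harmonic sum of waiting times.  It suffices to
    sweep until the probability of an unseen target is at most 1/2. *)
Lemma harmonic_mean_le (b : R) : (mean_cover_time T mu delta <= b%:E)%E ->
  harmonic R #|I| <= 2 * p * (b + l%:R).
Proof.
move=> mb.
have sweep := harmonic_sweep mu_rep C_gt0 mu_decouple target_gt0 target_mass non_overlapping.
have up0 t : 0 <= unseen_prob t := pr_ge0 _ _.
have up1 t : unseen_prob t <= 1 by exact: pr_le1 (mD t).
have umono t t' : (t <= t')%N -> unseen_prob t' <= unseen_prob t.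
  move=> tt; apply: pr_le; [exact: mD|exact: mD|].
  move=> z [Lz /= nz]; split=> //=; apply: contraNN nz => /eqP z0.
  by rewrite -finset.subset0 -z0; exact: unseen_mono.
have b0 : 0 <= b by have := unseen_prob_mean 0 mb; rewrite big_ord0.
have SB n : \sum_(k < n) unseen_prob k <= b + l%:R.
  apply: (@le_trans _ _ (\sum_(k < l + n) unseen_prob k)).
    rewrite -!(big_mkord xpredT (fun k => unseen_prob k)) (@big_cat_nat _ _ _ n 0 (l + n)) //= ?leq_addl //.
    by rewrite lerDl; apply: sumr_ge0 => k _.
  rewrite big_split_ord /= addrC lerD //; first exact: unseen_prob_mean.
  apply: (@le_trans _ _ (\sum_(k < l) 1)); first by apply: ler_sum.
  by rewrite sumr_const card_ord.
have B0 : 0 <= b + l%:R by rewrite addr_ge0.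
have [n nB] : exists n : nat, 2 * (b + l%:R) < n%:R.
  by exists (Num.truncn (2 * (b + l%:R))).+1; exact: truncnS_gt.
have half : unseen_prob n <= 2^-1.
  have h1 : n%:R * unseen_prob n <= b + l%:R.
    apply: le_trans (SB n); apply: (@le_trans _ _ (\sum_(k < n) unseen_prob n)).
      by rewrite sumr_const card_ord mulr_natl.
    by apply: ler_sum => k _; apply: umono; exact: ltnW.
  have n0 : (0 : R) < n%:R by apply: le_lt_trans nB; rewrite mulr_ge0.
  by rewrite -(ler_pM2l n0); apply: le_trans h1 _; rewrite ler_pdivlMr // mulrC ltW.
have H0 : 0 <= harmonic R #|I| by apply: sumr_ge0 => k _; rewrite invr_ge0.
have h2 := le_trans (sweep n) (ler_wpM2l p_ge0 (SB n)).
have h3 : harmonic R #|I| * 2^-1 <= harmonic R #|I| * (1 - unseen_prob n).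
  by rewrite ler_wpM2l //; lra.
have := le_trans h3 h2; lra.
Qed.

End SweepingTime.

(** * Non-overlapping words from two full branches *)

Section MarkedWords.
Variables (R : realType) (T : interval_map R).
Local Notation f := (imap T).
Local Notation Z := (@br R T).
Local Notation Lam := (repeller T).
Implicit Types (w v : seq (idx T)).

Lemma admissible_full i v : full_branch i -> admissible v -> admissible (i :: v).
Proof.
move=> fi [s [[x [Lx sx]] sv]].
have [y [Ly zy] yx] : (image_on_repeller i) x by rewrite fi.
exists (fun k => if k is k'.+1 then s k' else i); split.
  exists y; split=> // -[|n] //=; rewrite -iterS iterSr yx; exact: sx.
by rewrite /mkseq /= (iotaDl 1 0) -map_comp; congr (_ :: _).
Qed.

Variables (a b : idx T).
Hypothesis ab : a <> b.
Hypotheses (full_a : full_branch a) (full_b : full_branch b).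

(** A marked word is a run of r + 1 letters a, a letter b, r free letters, and letters
    b up to the chosen length.  The free letters contain no run as long as the first
    one, so that the beginning of a marked word can be recognized. *)
Definition marked_bits r (x : seq bool) : nat -> bool :=
  nth false (nseq r.+1 true ++ false :: x).

Definition marked_word r x (l : nat) : seq (idx T) :=
  mkseq (fun p => if marked_bits r x p then a else b) l.

Lemma size_marked_word r x l : size (marked_word r x l) = l.
Proof. exact: size_mkseq. Qed.

Lemma marked_bits_head r x p : (p <= r)%N -> marked_bits r x p = true.
Proof. by move=> pr'; rewrite /marked_bits nth_cat size_nseq ltnS pr' nth_nseq ltnS pr'. Qed.

Lemma marked_bits_mark r x : marked_bits r x r.+1 = false.
Proof. by rewrite /marked_bits nth_cat size_nseq ltnn subnn. Qed.

Lemma marked_bits_body r x i : marked_bits r x (r.+2 + i) = nth false x i.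
Proof.
rewrite /marked_bits nth_cat size_nseq ltnNge (_ : (r.+1 <= r.+2 + i)%N); last by lia.
by rewrite (_ : (r.+2 + i - r.+1 = i.+1)%N); last by lia.
Qed.

Lemma marked_bits_tail r (x : r.-tuple bool) p : (r.*2.+2 <= p)%N -> marked_bits r x p = false.
Proof.
move=> rp; rewrite /marked_bits nth_default // size_cat size_nseq /= size_tuple.
by move: rp; rewrite -addnn; lia.
Qed.

(** An occurrence at a positive distance d from a previous one would put its initial
    run over one of the letters b of the previous word: the one after the run, the
    first one after the free letters, or, for larger d, the one at d itself. *)
Lemma marked_non_overlapping r (x x' : r.-tuple bool) l l' z k k' : Lam z ->
  (r.*2.+3 <= l)%N -> (r.*2.+3 <= l')%N ->
  cyl (marked_word r x l) (iter k f z) -> cyl (marked_word r x' l') (iter k' f z) ->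
  (k <= k' < k + l)%N -> k = k' /\ x = x'.
Proof.
move=> Lz rl rl'.
pose G p := code T (iter p f z) == a.
have read (x1 : r.-tuple bool) l1 k1 : cyl (marked_word r x1 l1) (iter k1 f z) ->
    forall p, (p < l1)%N -> G (k1 + p)%N = marked_bits r x1 p.
  move=> /cylP [_]; rewrite size_marked_word => e p pl.
  have := congr1 (fun w => nth point w p) e; rewrite nth_itin // nth_mkseq // -iterD addnC.
  by rewrite /G => ->; case: (marked_bits _ _ _); [rewrite eqxx|apply/eqP => /esym].
move=> /read E /read E' /andP[kk' k'l]; move: rl rl'; rewrite -addnn => rl rl'.
have [ekk|lt] : k = k' \/ (k < k')%N by move: kk'; rewrite leq_eqVlt => /orP[/eqP|]; auto.
  split=> //; apply: val_inj; apply: (@eq_from_nth _ false); rewrite !size_tuple // => i ir.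
  rewrite -!(marked_bits_body r) -E; last by lia.
  by rewrite -E'; [rewrite ekk|lia].
exfalso; set d := (k' - k)%N; have dk : (k' = k + d)%N by rewrite /d; lia.
have clash q : (d <= q <= d + r)%N -> (q < l)%N -> marked_bits r x q = true.
  move=> /andP[q1 q2] ql; rewrite -E // -(@marked_bits_head r x' (q - d)%N); last by lia.
  by rewrite -E'; [congr G; lia|lia].
have no q : (d <= q <= d + r)%N -> (q < l)%N -> marked_bits r x q = false -> False.
  by move=> h1 h2; rewrite (clash q h1 h2).
have [d1|d1] := leqP d r.+1.
  by apply: (no r.+1); [lia|lia|exact: marked_bits_mark].
have [d2|d2] := leqP d r.*2.+2; move: d2; rewrite -addnn => d2.
  by apply: (no r.*2.+2); [rewrite -addnn; lia|rewrite -addnn; lia|exact: marked_bits_tail].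
by apply: (no d); [lia|lia|apply: marked_bits_tail; rewrite -addnn; lia].
Qed.

Lemma admissible_marked_word r x l : Lam !=set0 -> admissible (marked_word r x l).
Proof.
move=> [z Lz]; rewrite /marked_word /mkseq; elim: (iota 0 l) => [|p s IH] /=.
  by apply: admissible_cyl; exists z; rewrite cyl_nil.
by case: ifP => _; apply: admissible_full.
Qed.

Lemma marked_wordS r (x : r.-tuple bool) l : (r.*2.+2 <= l)%N ->
  marked_word r x l.+1 = marked_word r x l ++ [:: b].
Proof.
move=> rl; rewrite /marked_word /mkseq -[l.+1]addn1 iotaD map_cat /= add0n.
by rewrite marked_bits_tail.
Qed.

End MarkedWords.

(** * The lower bound with logarithm *)

Section CoverTimeLowerBound.
Variables (R : realType) (T : interval_map R).
Variables (m mu : probability (measurableTypeR R) R).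
Local Notation f := (imap T).
Local Notation Lam := (repeller T).
Local Notation mR := (measurableTypeR R).
Local Notation s := (repeller_dim T).
Implicit Types (w v : seq (idx T)) (P Q : set (seq (idx T))) (A B : set mR).

Hypothesis m_nonatomic : nonatomic m.
Hypothesis mu_rep : pr mu Lam = 1.
Variable c : R.
Hypothesis c_gt0 : 0 < c.
Hypothesis regular : forall x r : R, Lam x -> 0 < r <= 1 ->
  r `^ s / c <= pr m (ball x r) <= c * r `^ s.

Lemma repeller_nonempty : Lam !=set0.
Proof.
apply: contrapT => /forallNP no; have : Lam = set0 by apply/seteqP; split=> // x /no.
by move=> L0; have := mu_rep; rewrite L0 pr0 => /eqP; rewrite eq_sym oner_eq0.
Qed.

(** In dimension 0 the balls around a point would have masses bounded below, and the
    point itself would have mass. *)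
Lemma repeller_dim_gt0 : 0 < s.
Proof.
rewrite lt_neqAle repeller_dim_ge0 andbT; apply/eqP => s0.
have [x Lx] := repeller_nonempty.
pose F n : set R := ball x n.+1%:R^-1.
have mF n : measurable (F n : set mR) by exact: measurable_ball_itv.
have F1 : \bigcap_n F n = [set x].
  apply/seteqP; split=> y; last by move=> -> n _; apply: ballxx; rewrite invr_gt0.
  move=> Fy; apply/eqP; apply: contrapT => /negP ne.
  have d0 : 0 < `|x - y| by rewrite normr_gt0 subr_eq0 eq_sym.
  have := Fy (Num.truncn `|x - y|^-1) I; rewrite /F /ball /= => h.
  have := truncnS_gt `|x - y|^-1; rewrite ltNge => /negP; apply.
  by rewrite -[leLHS]invrK lef_pV2 ?posrE ?invr_gt0 // ltW.
have cv : (m \o F) n @[n --> \oo] --> m [set x].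
  rewrite -F1; apply: nonincreasing_cvg_mu.
  - by rewrite (le_lt_trans (probability_le1 _ _)) ?ltry //; exact: mF.
  - exact: mF.
  - by apply: bigcapT_measurable => i; exact: mF.
  - move=> p q pq; apply/subsetPset => y; rewrite /F /ball /= => /lt_le_trans; apply.
    by rewrite lef_pV2 ?posrE // ler_nat.
rewrite m_nonatomic in cv.
have : ((c^-1)%:E <= 0 :> \bar R)%E.
  rewrite -(cvg_lim _ cv) //; apply: lime_ge; first by apply/cvg_ex; exists 0%E.
  apply: nearW => n; rewrite /= -(@prE _ mR _ m _ (mF n)) lee_fin.
  have r01 : 0 < (n.+1%:R^-1 : R) <= 1 by rewrite invr_gt0 ltr0n invf_le1 // ler1n.
  by have /andP[+ _] := regular Lx r01; rewrite -s0 powRr0 mul1r.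
by rewrite lee_fin leNgt invr_gt0 c_gt0.
Qed.

(** A cylinder of mass well above that of a ball of radius delta contains a point
    together with its delta-neighbourhood in the repeller: the points without this
    property are close to the ends of the cylinder, where balls cover them. *)
Lemma deep_point w (delta : R) : 0 < delta -> 2 * delta <= 1 ->
  2 * (c * (2 * delta) `^ s) < pr m (cyl w) ->
  exists2 y, Lam y & forall z, Lam z -> `|y - z| <= delta -> cyl w z.
Proof.
move=> d0 d1; rewrite ltNge => big; apply: contrapT => no; move/negP: big; apply.
have r01 : 0 < 2 * delta <= 1 by rewrite mulr_gt0.
have small (A : set R) : A `<=` Lam -> (forall y y', A y -> A y' -> y < y' -> y' - y <= delta) ->
    exists2 G : set mR, measurable G & A `<=` G /\ pr m G <= c * (2 * delta) `^ s.
  move=> AL Ad; have [[y0 Ay0]|/forallNP A0] := pselect (exists y, A y); last first.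
    exists set0 => //; split; first by move=> y /A0.
    by rewrite pr0 mulr_ge0 ?powR_ge0 // ltW.
  exists (ball y0 (2 * delta)); first exact: measurable_ball_itv.
  split; last by have /andP[] := regular (AL _ Ay0) r01.
  move=> y Ay; rewrite /ball /= ltr_norml; have [lt|lt|<-] := ltgtP y y0.
  - by have := Ad _ _ Ay Ay0 lt => h; apply/andP; split; lra.
  - by have := Ad _ _ Ay0 Ay lt => h; apply/andP; split; lra.
  - by apply/andP; split; lra.
pose L y := cyl w y /\ exists z, [/\ ~ piece w z, y - delta <= z & z < y].
pose U y := cyl w y /\ exists z, [/\ ~ piece w z, y < z & z <= y + delta].
have btw y y' z : cyl w y -> cyl w y' -> ~ piece w z -> y < z -> z < y' -> False.
  by move=> [_ wy] [_ wy'] nz yz zy'; apply: nz; apply: (piece_itv wy wy'); rewrite !ltW.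
have Ld y y' : L y -> L y' -> y < y' -> y' - y <= delta.
  move=> [wy _] [wy' [z [nz z1 z2]]] yy'; rewrite leNgt; apply/negP => h.
  by apply: (btw y y' z) => //; lra.
have Ud y y' : U y -> U y' -> y < y' -> y' - y <= delta.
  move=> [wy [z [nz z1 z2]]] [wy' _] yy'; rewrite leNgt; apply/negP => h.
  by apply: (btw y y' z) => //; lra.
have [G1 mG1 [LG1 G1le]] := small L (fun y Ly => Ly.1.1) Ld.
have [G2 mG2 [UG2 G2le]] := small U (fun y Uy => Uy.1.1) Ud.
apply: (@le_trans _ _ (pr m (G1 `|` G2))); last first.
  by apply: le_trans (prU_le _ mG1 mG2) _; rewrite mulr_natl mulr2n lerD.
apply: pr_le; [exact: measurable_cyl|exact: measurableU|].
move=> y wy; have [z [Lz yz nz]] : exists z, [/\ Lam z, `|y - z| <= delta & ~ cyl w z].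
  apply: contrapT => nz; apply: no; exists y; first by case: wy.
  by move=> z Lz yz; apply: contrapT => nwz; apply: nz; exists z.
have npz : ~ piece w z by move=> pz; apply: nz; split.
move: yz; rewrite ler_norml => /andP[z1 z2].
have [zy|yz|e] := ltgtP z y.
- by left; apply: LG1; split=> //; exists z; split=> //; lra.
- by right; apply: UG2; split=> //; exists z; split=> //; lra.
- by rewrite e in nz.
Qed.

Variables (C D : R) (L0 : nat).
Hypothesis C1 : 1 < C.
Hypothesis D_gt0 : 0 < D.
Hypothesis mu_decay : forall k w, (k * L0 <= size w)%N -> pr mu (cyl w) <= 2 ^- k.
Hypothesis mu_decouple : forall n k P Q,
  pr mu (cyls n P `&` back T n (cyls k Q)) <= C * (pr mu (cyls n P) * pr mu (cyls k Q)).
Hypothesis mu_cat_ge : forall u v, admissible (u ++ v) ->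
  pr mu (cyl u) * pr mu (cyl v) <= C * pr mu (cyl (u ++ v)).
Hypothesis mu_gt0 : forall w, admissible w -> 0 < pr mu (cyl w).
Hypothesis mu_le_m : forall k Q, pr mu (cyls k Q) <= D * pr m (cyls k Q).
Variables (a b : idx T).
Hypothesis ab : a <> b.
Hypotheses (full_a : full_branch a) (full_b : full_branch b).

Let C0 : 0 < C. Proof. exact: lt_trans C1. Qed.

Let adm r x l : admissible (marked_word a b r x l).
Proof. by apply: admissible_marked_word => //; exact: repeller_nonempty. Qed.

Lemma letter_mass : exists2 rho : R, 0 < rho <= 2^-1 &
  rho * C <= pr mu (cyl [:: a]) /\ rho * C <= pr mu (cyl [:: b]).
Proof.
have [z Lz] := repeller_nonempty.
have adm1 (i : idx T) : full_branch i -> 0 < pr mu (cyl [:: i]).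
  move=> fi; apply: mu_gt0; apply: admissible_full => //.
  by apply: admissible_cyl; exists z; rewrite cyl_nil.
have a0 := adm1 _ full_a; have b0 := adm1 _ full_b.
exists (Num.min 2^-1 (Num.min (pr mu (cyl [:: a])) (pr mu (cyl [:: b])) / C)).
  by rewrite lt_min invr_gt0 ltr0n divr_gt0 ?lt_min ?a0 // ge_min lexx.
by split; rewrite -ler_pdivlMr // ge_min; apply/orP; right;
  rewrite ler_pM2r ?invr_gt0 // ge_min lexx ?orbT.
Qed.

Lemma harmonic_pow2 r : r%:R / 2 <= harmonic R (2 ^ r).
Proof.
elim: r => [|r IH]; first by rewrite mul0r sumr_ge0 // => k _; rewrite invr_ge0.
rewrite /harmonic expnS mul2n -addnn big_split_ord /= -/(harmonic R (2 ^ r)).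
rewrite -natr1 mulrDl lerD //; apply: (@le_trans _ _ (\sum_(i < 2 ^ r) (2 ^ r.+1)%:R^-1)).
  have z : (2 ^ r)%:R != 0 :> R by rewrite pnatr_eq0 expn_eq0.
  by rewrite sumr_const card_ord -[_ *+ (2 ^ r)]mulr_natl expnS natrM invfM mulrCA mulfV // mulr1 mul1r.
apply: ler_sum => i _; rewrite lef_pV2 ?posrE ?ltr0n ?expn_gt0 // ler_nat.
by rewrite expnS mul2n -addnn -addnS leq_add2l.
Qed.

(** Appending a letter b divides the mass of a marked word by at most a constant and
    long words have small mass, so that some length brings the mass within a constant
    factor of theta. *)
Lemma marked_word_length (rho theta : R) r (x : r.-tuple bool) : 0 < rho <= 2^-1 ->
  rho * C <= pr mu (cyl [:: a]) -> rho * C <= pr mu (cyl [:: b]) ->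
  0 < theta -> theta < rho ^+ r.*2.+3 ->
  exists l, [/\ (r.*2.+3 <= l)%N, l%:R <= (2 * L0%:R + 1) / theta &
    rho * theta <= pr mu (cyl (marked_word a b r x l)) <= theta].
Proof.
move=> /andP[rho0 rho2] ra rb t0 tr.
have mass l : rho ^+ l <= pr mu (cyl (marked_word a b r x l)).
  rewrite -{1}(size_marked_word a b r x l); have := adm r x l.
  rewrite /marked_word /mkseq; elim: (iota 0 l) => [|q s' IH] /=; first by rewrite expr0 cyl_nil mu_rep.
  move=> aw; have {}IH := IH (@admissible_drop _ _ [:: _] _ aw).
  have := mu_cat_ge (u := [:: _]) aw; rewrite -ler_pdivrMl // => h; apply: le_trans h.
  rewrite ler_pdivlMl // exprS mulrA.
  have h1 : C * rho <= pr mu (cyl [:: if marked_bits r x q then a else b]).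
    by rewrite mulrC; case: ifP.
  by apply: ler_pM => //; [rewrite mulr_ge0 ?ltW|rewrite exprn_ge0 ?ltW].
have t1 : theta^-1 >= r.*2.+3%:R.
  rewrite -[leLHS]invrK lef_pV2 ?posrE ?invr_gt0 ?ltr0n //; apply: le_trans (ltW tr) _.
  apply: le_trans (_ : 2^-1 ^+ r.*2.+3 <= _).
    by apply: lerXn2r; rewrite ?nnegrE ?(ltW rho0).
  by rewrite exprVn lef_pV2 ?posrE ?exprn_gt0 ?ltr0n // -natrX ler_nat ltnW // ltn_expl.
have [k [k1 k2]] := half_pow_small t0.
pose P l := (r.*2.+3 <= l)%N && (pr mu (cyl (marked_word a b r x l)) <= theta).
pose l1 := (k * L0 + r.*2.+3)%N.
have Pl1 : P l1.
  rewrite /P leq_addl /=; apply: le_trans k2; apply: mu_decay.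
  by rewrite size_marked_word leq_addr.
case: (ex_minnP (ex_intro _ l1 Pl1)) => l /andP[rl lt] min.
exists l; split=> //.
  apply: (@le_trans _ _ l1%:R); first by rewrite ler_nat min.
  rewrite /l1 natrD natrM; apply: (@le_trans _ _ ((theta^-1 + 1) * L0%:R + theta^-1)).
    by rewrite lerD // ler_wpM2r.
  have t2 : 1 <= theta^-1 by apply: le_trans t1; rewrite ler1n.
  have l0 : 0 <= (L0%:R : R) by [].
  by nra.
rewrite lt andbT; move: rl; rewrite leq_eqVlt => /orP[/eqP e|].
  by move: lt; rewrite leNgt -e (lt_le_trans tr (mass _)).
case: l lt min => // l lt min rl.
have lbig : theta < pr mu (cyl (marked_word a b r x l)).
  rewrite ltNge; apply/negP => h; have : P l by rewrite /P h andbT.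
  by move=> /min; rewrite ltnn.
have E := @marked_wordS _ _ a b r x l (leq_trans (leqnSn _) rl).
have := adm r x l.+1; rewrite E => /mu_cat_ge h.
rewrite -(ler_pM2l C0); apply: le_trans h.
have -> : C * (rho * theta) = theta * (rho * C) by ring.
by rewrite ler_pM ?mulr_ge0 // ltW.
Qed.

(** At the scale theta, of the order of delta ^ s, there are 2 ^ r marked words with r
    of the order of log (1 / delta).  Their cylinders contain deep points, so that all
    of them are collected by the cover time, and each has a waiting time of the order
    of 1 / theta. *)
Lemma mean_cover_time_ge_log : exists c' delta0 : R, [/\ 0 < c', 0 < delta0 &
  forall delta, 0 < delta < delta0 ->
    ((c' * delta `^ (- s) * ln (1 / delta))%:E <= mean_cover_time T mu delta)%E].
Proof.
have s0 := repeller_dim_gt0.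
have [rho rho01 [ra rb]] := letter_mass; have /andP[rho0 rho2] := rho01.
have ts0 : (0 : R) < 2 `^ s by rewrite powR_gt0.
(* With this K the marked cylinders, of mass at least rho theta, have deep points. *)
have [K K0 KE] : exists2 K, 0 < K & K = 4 * c * D * 2 `^ s / rho.
  by eexists; [|reflexivity]; rewrite divr_gt0 // !mulr_gt0.
pose lam := - ln rho; have lam0 : 0 < lam by rewrite oppr_gt0 ln_lt0 // rho0; lra.
pose V := 2 * C * (2 * L0%:R + 1).
have V0 : 0 < V by rewrite !mulr_gt0 // ltr_wpDl.
pose X1 := 16 * lam / s * (V + 1); pose X2 := 2 * (3 * lam + `|ln K|) / s.
have X10 : 0 < X1 by rewrite mulr_gt0 ?divr_gt0 ?mulr_gt0 ?addr_gt0.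
have X20 : 0 < X2 by rewrite divr_gt0 // mulr_gt0 // ltr_pwDl // mulr_gt0.
exists (s / (32 * lam * C * K)), (expR (- (X1 + X2 + 1))); split.
- by rewrite divr_gt0 ?mulr_gt0.
- exact: expR_gt0.
move=> delta /andP[d0 de].
pose Y := ln (1 / delta).
have YE : ln delta = - Y by rewrite /Y div1r lnV ?posrE // opprK.
have YX : X1 + X2 + 1 < Y.
  by rewrite -[Y]opprK -YE ltrNr -ltr_expR lnK ?posrE.
have d2 : 2 * delta <= 1.
  have e2 : 2 <= expR (1 : R) by apply: le_trans (expR_ge1Dx 1); lra.
  have : delta <= expR (- 1) by apply: le_trans (ltW de) _; rewrite ler_expR; lra.
  rewrite expRN => h; have : expR 1 * delta <= 1 by rewrite mulrC -ler_pdivlMr ?expR_gt0 // mul1r.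
  by move=> h2; have : 2 * delta <= expR 1 * delta; [rewrite ler_pM2r|lra].
have ds : delta `^ s = expR (- (s * Y)) by rewrite /powR gt_eqF // YE mulrN.
have rhoE n : rho ^+ n = expR (- (lam * n%:R)).
  by rewrite -{1}(lnK (rho0 : rho \in Num.pos)) -expRM_natl /lam mulNr opprK mulrC.
pose theta := K * delta `^ s.
have t0 : 0 < theta by rewrite mulr_gt0 // powR_gt0.
have tE : theta = expR (ln K - s * Y) by rewrite /theta ds expRD lnK ?posrE.
have Y0 : 0 < Y by lra.
(* The largest r up to a constant for which marked words can be as long as needed
   for the free letters and still have mass theta. *)
have [r [r1 r2]] : exists r : nat, r%:R <= s * Y / (4 * lam) /\ s * Y / (4 * lam) < r%:R + 1.
  exists (Num.truncn (s * Y / (4 * lam))); split; last by rewrite natr1; exact: truncnS_gt.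
  by rewrite truncn_le // divr_ge0 ?mulr_ge0 // ltW.
have r1' : r%:R * lam * 4 <= s * Y by rewrite -mulrA [lam * 4]mulrC -ler_pdivlMr // mulr_gt0.
have sX1 : 16 * lam * (V + 1) < s * Y.
  have -> : 16 * lam * (V + 1) = s * X1 by rewrite /X1; field; rewrite gt_eqF.
  by rewrite ltr_pM2l //; lra.
have sX2 : 2 * (3 * lam + `|ln K|) < s * Y.
  have -> : 2 * (3 * lam + `|ln K|) = s * X2 by rewrite /X2; field; rewrite gt_eqF.
  by rewrite ltr_pM2l //; lra.
have tr : theta < rho ^+ r.*2.+3.
  rewrite tE rhoE ltr_expR -addn3 -mul2n natrD natrM.
  by have := ler_norm (ln K); lra.
have /choice [l Hl] := fun x : r.-tuple bool => marked_word_length x rho01 ra rb t0 tr.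
pose target (x : r.-tuple bool) := marked_word a b r x (l x).
have mass_m x : 2 * (c * (2 * delta) `^ s) < pr m (cyl (target x)).
  have [_ _ /andP[h _]] := Hl x.
  have := mu_le_m (size (target x)) [set target x]; rewrite !cyls1 => h2.
  rewrite -(ltr_pM2l D_gt0); apply: lt_le_trans h2; apply: lt_le_trans h.
  rewrite powRM ?(ltW d0) // /theta KE.
  have -> : rho * (4 * c * D * 2 `^ s / rho * delta `^ s) = 2 * (D * (2 * (c * (2 `^ s * delta `^ s)))).
    by field; rewrite gt_eqF.
  have : 0 < D * (2 * (c * (2 `^ s * delta `^ s))) by rewrite !mulr_gt0 // powR_gt0.
  lra.
have /choice [y Hy] : forall x : r.-tuple bool, exists y, Lam y /\
    forall z, Lam z -> `|y - z| <= delta -> cyl (target x) z.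
  by move=> x; have [y Ly Hy] := deep_point d0 d2 (mass_m x); exists y.
pose maxl := Num.truncn ((2 * L0%:R + 1) / theta).
have maxl1 : maxl%:R <= (2 * L0%:R + 1) / theta.
  by rewrite truncn_le // divr_ge0 ?addr_ge0 // ltW.
have tsize x : (size (target x) <= maxl)%N.
  rewrite size_marked_word -ltnS -(ltr_nat R); have [_ h _] := Hl x.
  exact: le_lt_trans h (truncnS_gt _).
set bb := s / _ * _ * _; rewrite leNgt; apply/negP => mlt.
have := @harmonic_mean_le R T mu mu_rep C C0 mu_decouple _ target (C * theta) _ _ _ _ delta y maxl _ _ tsize bb (ltW mlt).
rewrite card_tuple card_bool => H.
have {H} : harmonic R (2 ^ r) <= 2 * (C * theta) * (bb + maxl%:R).
  apply: H.
  - by move=> x; rewrite size_marked_word; have [+ _ _] := Hl x; case: (l x).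
  - by move=> x; rewrite ler_pM2l //; have [_ _ /andP[]] := Hl x.
  - move=> z x x' k k' Lz cx cx'; rewrite size_marked_word.
    by apply: (marked_non_overlapping ab Lz _ _ cx cx'); [have [] := Hl x|have [] := Hl x'].
  - by rewrite mulr_ge0 // ltW.
  - by move=> x; case: (Hy x).
  - by move=> x; case: (Hy x).
move=> H; have {H} := le_trans (harmonic_pow2 r) H.
have -> : bb = s * Y / (32 * lam * C * theta).
  rewrite /bb /theta powRN -/Y; field.
  by rewrite !gt_eqF // powR_gt0.
have h1 : 2 * (C * theta) * (s * Y / (32 * lam * C * theta)) = s * Y / (16 * lam).
  by field; rewrite !gt_eqF.
have h2 : 2 * (C * theta) * maxl%:R <= V.
  apply: le_trans (_ : 2 * (C * theta) * ((2 * L0%:R + 1) / theta) <= _).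
    by rewrite ler_pM2l // mulr_gt0 // mulr_gt0.
  by rewrite le_eqVlt; apply/orP; left; apply/eqP; rewrite /V; field; rewrite gt_eqF.
rewrite mulrDr h1 => H.
have h3 : s * Y / (16 * lam) <= V + 2^-1.
  have e1 : s * Y / (4 * lam) = 4 * (s * Y / (16 * lam)) by field; rewrite gt_eqF.
  lra.
move: h3; rewrite ler_pdivrMr ?mulr_gt0 //; nra.
Qed.

End CoverTimeLowerBound.

(** * The mean cover time *)

Section EventualBounds.
Variables (R : realType) (E : R -> \bar R).

Lemma eventual_bounds (lo up : R -> R) (c C d1 d2 : R) : 0 < c -> 0 < C -> 0 < d1 -> 0 < d2 ->
  (forall d, 0 < d < 1 -> 0 <= up d) ->
  (forall d, 0 < d < d1 -> ((c * lo d)%:E <= E d)%E) ->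
  (forall d, 0 < d < d2 -> (E d <= (C * up d)%:E)%E) ->
  exists c C : R, [/\ 0 < c, c < C & \forall d \near 0^'+,
    ((c * lo d)%:E <= E d)%E /\ (E d <= (C * up d)%:E)%E].
Proof.
move=> c0 C0 d10 d20 up0 lo_le up_ge; exists c, (c + C); split=> //; first by rewrite ltrDl.
near=> d.
have d0 : 0 < d by near: d; exact: nbhs_right_gt.
have dd1 : d < d1 by near: d; exact: nbhs_right_lt.
have dd2 : d < d2 by near: d; exact: nbhs_right_lt.
have dd3 : d < 1 by near: d; exact: nbhs_right_lt.
split; first by apply: lo_le; rewrite d0.
apply: le_trans (up_ge d _) _; first by rewrite d0.
by rewrite lee_fin ler_wpM2r ?lerDr ?(ltW c0) // up0 // d0.
Unshelve. all: by end_near. Qed.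

End EventualBounds.

Unset Implicit Arguments.

Theorem theorem2p1 (R : realType) (T : interval_map R) (phi : R -> R)
    (m mu : probability (measurableTypeR R) R)
    (mut : probability (coding_space T) R) (Cd : R) (n1 : nat)
    (m_dom : m (dom T) = 1%E) (m_nonatomic : nonatomic m)
    (m_holes : m (holes T) = 0%E) (m_conformal : conformal T phi m)
    (a1 : bounded_distortion_potential T phi Cd)
    (a2 : contracting_potential T phi)
    (a3 : covering_potential T phi)
    (n1_large :
      (((2 * n1 + 5)%:R * (Cd + 1))%:E * sup_exp_birkhoff T phi n1 < 1)%E)
    (a4 : large_cylinder_images T m n1)
    (mu_invariant : imap_invariant T mu) (mu_ac : mu `<< m)
    (mut_lift : symbolic_lift mu mut)
    (a5 : quasi_bernoulli mut)
    (a6 : psi_mixing mut)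
    (Diam : diam_regular T m)
    (BD : bounded_distortion T)
    (Adj : adjacent_comparable T mu)
    (AR : ahlfors_regular T m) :
  (exists c C : R, [/\ 0 < c, c < C & \forall delta \near 0^'+,
     ((c * delta `^ (- repeller_dim T))%:E <= mean_cover_time T mu delta)%E /\
     (mean_cover_time T mu delta
        <= (C * delta `^ (- repeller_dim T) * ln (1 / delta))%:E)%E]) /\
  (gibbs_markov mut -> two_full_branches T ->
   exists c C : R, [/\ 0 < c, c < C & \forall delta \near 0^'+,
     ((c * delta `^ (- repeller_dim T) * ln (1 / delta))%:E
        <= mean_cover_time T mu delta)%E /\
     (mean_cover_time T mu delta
        <= (C * delta `^ (- repeller_dim T) * ln (1 / delta))%:E)%E]).
Proof.
have m_rep := m_repeller m_dom m_holes m_conformal.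
have [K K0 dist] := m_distortion m_conformal a1.
have mdec := m_decay m_conformal a1 n1_large.
have mu_rep := mu_repeller m_rep mu_ac.
have mu_inv n A : measurable A -> pr mu (back T n A) = pr mu A.
  exact: (mu_iter_invariant m_rep mu_invariant mu_ac).
have mu_gt0 := admissible_gt0 m_rep m_nonatomic mu_invariant mu_ac mut_lift a6.
have [C C1 [cat_le cat_ge]] := mu_quasi_bernoulli m_rep m_nonatomic mu_invariant mu_ac mut_lift a5.
have [j mix] := mu_supermixing m_rep m_nonatomic mu_invariant mu_ac mut_lift a6.
have {}mix (u v : seq (idx T)) : admissible u -> admissible v ->
    2^-1 * (pr mu (cyl u) * pr mu (cyl v)) <= pr mu (cyl u `&` back T (size u + j) (cyl v)).
  by move=> hu hv; have := mix u v hu hv; rewrite cyl_back.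
have [c [c0 AR']] := AR.
have reg x r : repeller T x -> 0 < r <= 1 ->
    r `^ repeller_dim T / c <= pr m (ball x r) <= c * r `^ repeller_dim T.
  move=> Lx r01; have [h1 h2] := AR' x r Lx r01.
  by rewrite -!lee_fin (prE m (@measurable_ball_itv R x r)) h1.
have [L0 L00 mudec] := mu_decay mu_ac mdec C1 cat_le.
have decouple := mu_decouple C1 cat_le.
have mixing : decoupled_below T mu 2^-1 j := mu_mixing mix.
have [C2 C20 mle] := m_decouple_le mu_rep mu_ac K0 dist mdec C1 cat_le cat_ge mu_gt0.
have [kap kap0 mge] := m_decouple_ge m_rep mu_ac K0 dist mdec C1 cat_le cat_ge mu_gt0 mix.
have [D D0 m_mu] := m_le_mu m_rep mu_rep mu_inv mu_ac kap0 mge.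
have [D' D'0 mu_m] := mu_le_m m_rep mu_rep mu_ac C20 mle mixing.
have [p [a [p0 p1 a0 tail]]] := avoid_tail mu_rep mu_inv C1 L00 mudec decouple mixing.
have p01 : 0 < p < 1 by rewrite p0.
have [Cu [du [Cu0 du0 up]]] := mean_cover_time_le m_rep c0 reg mdec D0 m_mu p01 a0 tail.
set s := repeller_dim T in reg up *.
pose scale (d : R) := d `^ (- s) * ln (1 / d).
have scale0 d : 0 < d < 1 -> 0 <= scale d.
  by move=> /andP[d0 d1]; rewrite mulr_ge0 ?powR_ge0 // ln_ge0 // ler_pdivlMr // mul1r ltW.
have up' d : 0 < d < du -> (mean_cover_time T mu d <= (Cu * scale d)%:E)%E.
  by move=> /up; rewrite /scale mulrA.
split.
  have c1 : 0 < (2 * c * 2 `^ s)^-1 by rewrite invr_gt0 !mulr_gt0 // powR_gt0.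
  have h0 : (0 : R) < 2^-1 by rewrite invr_gt0.
  have lo d : 0 < d < 2^-1 -> (((2 * c * 2 `^ s)^-1 * d `^ (- s))%:E <= mean_cover_time T mu d)%E.
    move=> /andP[d0 d1]; apply: (mean_cover_time_ge m_rep mu_rep c0 reg).
    by rewrite d0 ltW.
  have [c' [C' [h1 h2 h3]]] := eventual_bounds c1 Cu0 h0 du0 scale0 lo up'.
  exists c', C'; split=> //; move: h3; apply: filterS => d.
  by rewrite /scale mulrA.
move=> _ [i0 [i1 [ne full0 full1]]].
have [cl [dl [cl0 dl0 lo]]] := mean_cover_time_ge_log m_nonatomic mu_rep c0 reg C1 D'0
  mudec decouple cat_ge mu_gt0 mu_m ne full0 full1.
have lo' d : 0 < d < dl -> ((cl * scale d)%:E <= mean_cover_time T mu d)%E.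
  by move=> /lo; rewrite /scale mulrA.
have [c' [C' [h1 h2 h3]]] := eventual_bounds cl0 Cu0 dl0 du0 scale0 lo' up'.
exists c', C'; split=> //; move: h3; apply: filterS => d.
by rewrite /scale !mulrA.
Qed.
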